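(* Let $k$ be an algebraically closed field of odd characteristic $p$, let $H=H_{1,\mathbf{c}}(V,\omega,\Gamma)$ be a symplectic reflection algebra over $k$ with $t=1$, where $p\nmid|\Gamma|$, and let $e=\frac{1}{|\Gamma|}\sum_{\gamma\in\Gamma}\gamma\in k\Gamma\subseteq H$. Then, via the natural maps given by multiplication: (i) $\mathrm{End}_H(He)\cong eHe$. (ii) $\mathrm{End}_{eHe}(He)\cong H$. (iii) $\mathrm{Hom}_{eHe}(He,eHe)\cong eH$, where $He$ and $eHe$ are regarded as right $eHe$-modules, and $\mathrm{Hom}_{eHe}(eH,eHe)\cong He$, where $eH$ and $eHe$ are regarded as left $eHe$-modules. In particular, $He$ is a reflexive right $eHe$-module, and $eH$ is a reflexive left $eHe$-module.
   Context: Symplectic reflection algebra: $(V,\omega)$ is a finite dimensional symplectic $k$-vector space, $\Gamma$ a finite group of symplectic automorphisms of $V$, generated by its set $S$ of symplectic reflections (elements $s$ for which $\mathrm{Id}-s$ has rank 2), and $\mathbf{c}:S\to k$, $s\mapsto c_s$, is a $\Gamma$-invariant (under conjugation) function. $H_{1,\mathbf{c}}(V,\omega,\Gamma)$ is the factor of the skew group algebra $T(V)*\Gamma$ of the tensor algebra by the relations $$xy-yx=\omega(x,y)1_\Gamma-\sum_{s\in S}c_s\,\omega_s(x,y)\,s\qquad(x,y\in V),$$ where $\omega_s$ is the skew-symmetric form on $V$ having $\ker(\mathrm{Id}-s)$ in its radical and coinciding with $\omega$ on $\mathrm{im}(\mathrm{Id}-s)$. The group algebra $k\Gamma$ embeds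 in $H$, and $eHe$ is an algebra with identity $e$. In (i), $He$ is a left $H$-module, and $eHe$ acts on it by right multiplication; endomorphisms of a left module are written on the right, so that the isomorphism is one of algebras. In (ii), $He$ is a right $eHe$-module and the isomorphism of algebras is given by $H$ acting on $He$ by left multiplication. In (iii), $eH$ acts by left multiplication $He\to eHe$ and $He$ acts by right multiplication $eH\to eHe$. A module $M$ over a ring $R$ is reflexive if the natural map $M\to M^{**}$ is an isomorphism, where $M^*=\mathrm{Hom}_R(M,R)$. *)

(* Defs.v *)
From HB Require Import structures.
From mathcomp Require Import all_boot all_order all_algebra all_fingroup.
From mathcomp Require Import cyclic generic_quotient sesquilinear boolp.

Set Implicit Arguments.
Unset Strict Implicit.
Unset Printing Implicit Defensive.

Import GRing.Theory.

Local Open Scope ring_scope.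
Local Open Scope quotient_scope.

(* The tensor algebra T(V): formal expressions in vectors and scalars, modulo
   the congruence generated by the axioms of associative unital k-algebras and
   the linearity of V -> T(V). Its universal property is tensor_lift_inj and
   tensor_lift_unique below. *)
Section TensorAlgebra.

Variables (k : comNzRingType) (V : lmodType k).

Inductive texpr : Type :=
  | TVar of V
  | TConst of k
  | TAdd of texpr & texpr
  | TMul of texpr & texpr.

Inductive texpr_cong : texpr -> texpr -> Prop :=
  | tc_refl t : texpr_cong t t
  | tc_sym t u : texpr_cong t u -> texpr_cong u t
  | tc_trans t u v : texpr_cong t u -> texpr_cong u v -> texpr_cong t v
  | tc_add t t' u u' : texpr_cong t t' -> texpr_cong u u' ->
      texpr_cong (TAdd t u) (TAdd t' u')
  | tc_mul t t' u u' : texpr_cong t t' -> texpr_cong u u' ->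
      texpr_cong (TMul t u) (TMul t' u')
  | tc_addA t u v : texpr_cong (TAdd t (TAdd u v)) (TAdd (TAdd t u) v)
  | tc_addC t u : texpr_cong (TAdd t u) (TAdd u t)
  | tc_add0 t : texpr_cong (TAdd (TConst 0) t) t
  | tc_mulA t u v : texpr_cong (TMul t (TMul u v)) (TMul (TMul t u) v)
  | tc_mul0 t : texpr_cong (TMul (TConst 0) t) (TConst 0)
  | tc_mul1 t : texpr_cong (TMul (TConst 1) t) t
  | tc_mulDl t u v :
      texpr_cong (TMul (TAdd t u) v) (TAdd (TMul t v) (TMul u v))
  | tc_mulDr t u v :
      texpr_cong (TMul t (TAdd u v)) (TAdd (TMul t u) (TMul t v))
  | tc_constD a b : texpr_cong (TConst (a + b)) (TAdd (TConst a) (TConst b))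
  | tc_constM a b : texpr_cong (TConst (a * b)) (TMul (TConst a) (TConst b))
  | tc_constC a t : texpr_cong (TMul (TConst a) t) (TMul t (TConst a))
  | tc_varD x y : texpr_cong (TVar (x + y)) (TAdd (TVar x) (TVar y))
  | tc_varZ a x : texpr_cong (TVar (a *: x)) (TMul (TConst a) (TVar x)).

HB.instance Definition _ := gen_eqMixin texpr.
HB.instance Definition _ := gen_choiceMixin texpr.

Definition texpr_eqv : rel texpr := fun t u => `[< texpr_cong t u >].

Lemma texpr_eqv_refl : reflexive texpr_eqv.
Proof. by move=> t; apply/asboolP/tc_refl. Qed.

Lemma texpr_eqv_sym : symmetric texpr_eqv.
Proof. by move=> t u; apply/asboolP/asboolP; apply: tc_sym. Qed.

Lemma texpr_eqv_trans : transitive texpr_eqv.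
Proof. by move=> u t v /asboolP tu /asboolP uv; apply/asboolP/(tc_trans tu). Qed.

Canonical texpr_equiv :=
  EquivRel texpr_eqv texpr_eqv_refl texpr_eqv_sym texpr_eqv_trans.

Definition tensor := {eq_quot texpr_eqv}.
HB.instance Definition _ := Choice.on tensor.

Definition tclass (t : texpr) : tensor := \pi_{eq_quot texpr_eqv} t.
Definition trepr (a : tensor) : texpr := repr (a : {eq_quot texpr_eqv}).

Lemma treprK : cancel trepr tclass.
Proof. by move=> a; rewrite /tclass /trepr reprK. Qed.

Lemma tclassP t u : tclass t = tclass u <-> texpr_cong t u.
Proof.
split=> [/(@eqquotP _ texpr_equiv) /asboolP // | tu].
by apply/(@eqquotP _ texpr_equiv)/asboolP.
Qed.

Lemma trepr_class t : texpr_cong (trepr (tclass t)) t.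
Proof. by apply/tclassP; rewrite treprK. Qed.

Definition tensor_add (a b : tensor) : tensor :=
  tclass (TAdd (trepr a) (trepr b)).
Definition tensor_mul (a b : tensor) : tensor :=
  tclass (TMul (trepr a) (trepr b)).
Definition tensor_scale (c : k) (a : tensor) : tensor :=
  tclass (TMul (TConst c) (trepr a)).
Definition tensor_opp (a : tensor) : tensor := tensor_scale (- 1) a.

Lemma tclass_add t u : tensor_add (tclass t) (tclass u) = tclass (TAdd t u).
Proof. by apply/tclassP/tc_add; apply: trepr_class. Qed.

Lemma tclass_mul t u : tensor_mul (tclass t) (tclass u) = tclass (TMul t u).
Proof. by apply/tclassP/tc_mul; apply: trepr_class. Qed.

Lemma tclass_scale c t :
  tensor_scale c (tclass t) = tclass (TMul (TConst c) t).
Proof. by apply/tclassP/tc_mul; [apply: tc_refl | apply: trepr_class]. Qed.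

Lemma tensorW (P : tensor -> Prop) : (forall t, P (tclass t)) -> forall a, P a.
Proof. by move=> Pt a; rewrite -(treprK a). Qed.

Let tE := (tclass_add, tclass_mul, tclass_scale).

Lemma tensor_addA : associative tensor_add.
Proof. by do 3![elim/tensorW => ?]; rewrite !tE; apply/tclassP/tc_addA. Qed.

Lemma tensor_addC : commutative tensor_add.
Proof. by do 2![elim/tensorW => ?]; rewrite !tE; apply/tclassP/tc_addC. Qed.

Lemma tensor_add0 : left_id (tclass (TConst 0)) tensor_add.
Proof. by elim/tensorW => ?; rewrite !tE; apply/tclassP/tc_add0. Qed.

Lemma tensor_scale_addl a : {morph tensor_scale^~ a : c d / c + d >-> tensor_add c d}.
Proof.
elim/tensorW: a => t c d; rewrite !tE; apply/tclassP.
exact: tc_trans (tc_mul (tc_constD _ _) (tc_refl _)) (tc_mulDl _ _ _).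
Qed.

Lemma tensor_scale1 : left_id 1 tensor_scale.
Proof. by elim/tensorW => ?; rewrite !tE; apply/tclassP/tc_mul1. Qed.

Lemma tensor_addN : left_inverse (tclass (TConst 0)) tensor_opp tensor_add.
Proof.
move=> a; rewrite -{2}[a]tensor_scale1 -tensor_scale_addl addNr.
by elim/tensorW: a => t; rewrite !tE; apply/tclassP/tc_mul0.
Qed.

HB.instance Definition _ := GRing.isZmodule.Build tensor
  tensor_addA tensor_addC tensor_add0 tensor_addN.

Lemma tensor_scaleA c d a :
  tensor_scale c (tensor_scale d a) = tensor_scale (c * d) a.
Proof.
elim/tensorW: a => t; rewrite !tE; apply/tclassP.
exact: tc_trans (tc_mulA _ _ _) (tc_mul (tc_sym (tc_constM _ _)) (tc_refl _)).
Qed.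

Lemma tensor_scale_addr : right_distributive tensor_scale tensor_add.
Proof.
by move=> c; do 2![elim/tensorW => ?]; rewrite !tE; apply/tclassP/tc_mulDr.
Qed.

HB.instance Definition _ := GRing.Zmodule_isLmodule.Build k tensor
  tensor_scaleA tensor_scale1 tensor_scale_addr tensor_scale_addl.

Lemma tensor_mulA : associative tensor_mul.
Proof. by do 3![elim/tensorW => ?]; rewrite !tE; apply/tclassP/tc_mulA. Qed.

Lemma tensor_mul1l : left_id (tclass (TConst 1)) tensor_mul.
Proof. by elim/tensorW => ?; rewrite !tE; apply/tclassP/tc_mul1. Qed.

Lemma tensor_mul1r : right_id (tclass (TConst 1)) tensor_mul.
Proof.
elim/tensorW => t; rewrite !tE; apply/tclassP.
exact: tc_trans (tc_sym (tc_constC _ _)) (tc_mul1 _).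
Qed.

Lemma tensor_mulDl : left_distributive tensor_mul tensor_add.
Proof. by do 3![elim/tensorW => ?]; rewrite !tE; apply/tclassP/tc_mulDl. Qed.

Lemma tensor_mulDr : right_distributive tensor_mul tensor_add.
Proof. by do 3![elim/tensorW => ?]; rewrite !tE; apply/tclassP/tc_mulDr. Qed.

Section Eval.

Variables (A : algType k) (f : {linear V -> A}).

Fixpoint teval (t : texpr) : A :=
  match t with
  | TVar x => f x
  | TConst c => c%:A
  | TAdd t u => teval t + teval u
  | TMul t u => teval t * teval u
  end.

Lemma teval_cong t u : texpr_cong t u -> teval t = teval u.
Proof.
elim=> {t u} //=; try by move=> *; congruence.
- by move=> *; rewrite addrA.
- by move=> *; rewrite addrC.
- by move=> *; rewrite scale0r add0r.
- by move=> *; rewrite mulrA.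
- by move=> *; rewrite scale0r mul0r.
- by move=> *; rewrite scale1r mul1r.
- by move=> *; rewrite mulrDl.
- by move=> *; rewrite mulrDr.
- by move=> *; rewrite scalerDl.
- by move=> *; rewrite -scalerAl mul1r scalerA.
- by move=> *; rewrite -scalerAl -scalerAr mul1r mulr1.
- by move=> *; rewrite linearD.
- by move=> *; rewrite linearZ -scalerAl mul1r.
Qed.

Definition tensor_lift (a : tensor) : A := teval (trepr a).

Lemma tensor_lift_class t : tensor_lift (tclass t) = teval t.
Proof. exact/teval_cong/trepr_class. Qed.

End Eval.

Lemma tensor_1_neq0 : tclass (TConst 1) != 0 :> tensor.
Proof.
apply/eqP => /(congr1 (tensor_lift (\0 : {linear V -> k^o}))).
rewrite !tensor_lift_class /= scale0r scale1r => /eqP.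
by rewrite oner_eq0.
Qed.

HB.instance Definition _ := GRing.Zmodule_isNzRing.Build tensor
  tensor_mulA tensor_mul1l tensor_mul1r tensor_mulDl tensor_mulDr tensor_1_neq0.

Lemma tensor_scaleAl (c : k) (a b : tensor) : c *: (a * b) = (c *: a) * b.
Proof.
elim/tensorW: a => t; elim/tensorW: b => u.
by rewrite /GRing.scale /GRing.mul /= !tE; apply/tclassP/tc_mulA.
Qed.

HB.instance Definition _ := GRing.Lmodule_isLalgebra.Build k tensor tensor_scaleAl.

Lemma tensor_scaleAr (c : k) (a b : tensor) : c *: (a * b) = a * (c *: b).
Proof.
elim/tensorW: a => t; elim/tensorW: b => u.
rewrite /GRing.scale /GRing.mul /= !tE; apply/tclassP.
apply: tc_trans (tc_mulA _ _ _) _.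
apply: tc_trans (tc_mul (tc_constC _ _) (tc_refl _)) _.
exact: tc_sym (tc_mulA _ _ _).
Qed.

HB.instance Definition _ := GRing.Lalgebra_isAlgebra.Build k tensor tensor_scaleAr.

Definition tensor_inj (x : V) : tensor := tclass (TVar x).

Lemma tensor_inj_linear : linear tensor_inj.
Proof.
move=> c x y; rewrite /tensor_inj /GRing.scale /GRing.add /= !tE; apply/tclassP.
exact: tc_trans (tc_varD _ _) (tc_add (tc_varZ _ _) (tc_refl _)).
Qed.

HB.instance Definition _ :=
  GRing.isLinear.Build k V tensor *:%R tensor_inj tensor_inj_linear.

Section Lift.

Variables (A : algType k) (f : {linear V -> A}).

Lemma tensor_lift_linear : linear (tensor_lift f).
Proof.
move=> c; do 2![elim/tensorW => ?].
rewrite /GRing.scale /GRing.add /= !tE !tensor_lift_class /=.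
by rewrite -scalerAl mul1r.
Qed.

Lemma tensor_lift_monoid_morphism : monoid_morphism (tensor_lift f).
Proof.
split; first by rewrite /GRing.one /= tensor_lift_class /= scale1r.
do 2![elim/tensorW => ?].
by rewrite /GRing.mul /= !tE !tensor_lift_class.
Qed.

HB.instance Definition _ :=
  GRing.isLinear.Build k tensor A *:%R (tensor_lift f) tensor_lift_linear.
HB.instance Definition _ := GRing.isMonoidMorphism.Build tensor A
  (tensor_lift f) tensor_lift_monoid_morphism.

Lemma tensor_lift_inj x : tensor_lift f (tensor_inj x) = f x.
Proof. exact: tensor_lift_class. Qed.

Lemma tensor_lift_unique (g : {lrmorphism tensor -> A}) :
  (forall x, g (tensor_inj x) = f x) -> g =1 tensor_lift f.
Proof.
move=> gf; elim/tensorW=> t; rewrite tensor_lift_class.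
elim: t => [x | c | t IHt u IHu | t IHt u IHu] /=.
- exact: gf.
- rewrite -(rmorph1 g) -linearZ; congr (g _).
  rewrite /GRing.scale /GRing.one /= !tE; apply/tclassP.
  exact: tc_trans (tc_sym (tc_mul1 _)) (tc_constC _ _).
- by rewrite -IHt -IHu -raddfD /GRing.add /= !tE.
- by rewrite -IHt -IHu -rmorphM /GRing.mul /= !tE.
Qed.

End Lift.

End TensorAlgebra.

(* The algebra endomorphism T(f) of T(V) extending f. *)
Definition tensor_map (k : comNzRingType) (V : lmodType k) (f : {linear V -> V}) :
    {lrmorphism tensor V -> tensor V} :=
  tensor_lift (@tensor_inj k V \o f).

Lemma tensor_map_inj (k : comNzRingType) (V : lmodType k) (f : {linear V -> V}) x :
  tensor_map f (tensor_inj x) = tensor_inj (f x).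
Proof. exact: tensor_lift_inj. Qed.

Lemma tensor_map_id (k : comNzRingType) (V : lmodType k) (f : {linear V -> V}) :
  f =1 id -> tensor_map f =1 id.
Proof.
move=> fid a; symmetry.
apply: (@tensor_lift_unique _ _ _ _ (idfun : {lrmorphism _ -> _})) => x /=.
by rewrite fid.
Qed.

Lemma tensor_map_comp (k : comNzRingType) (V : lmodType k)
    (f g h : {linear V -> V}) :
  h =1 f \o g -> tensor_map h =1 tensor_map f \o tensor_map g.
Proof.
move=> hfg a; symmetry; apply: (@tensor_lift_unique _ _ _ _
  (tensor_map f \o tensor_map g : {lrmorphism _ -> _})) => x /=.
by rewrite !tensor_map_inj hfg.
Qed.

(* The skew group algebra A * Gamma, for Gamma acting on A by algebra
   automorphisms: f stands for the sum of the f(g) g over g in Gamma, and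
   (a g) (b h) = a g(b) gh. *)
Section SkewGroupAlgebra.

Variables (k : comNzRingType) (A : algType k) (gT : finGroupType).

Record alg_action := AlgAction {
  aact :> gT -> {lrmorphism A -> A};
  aact1 : aact 1%g =1 id;
  aactM : forall g h, aact (g * h)%g =1 aact g \o aact h
}.

Definition skew_alg of alg_action := {ffun gT -> A}.

Variable act : alg_action.
Local Notation S := (skew_alg act).

HB.instance Definition _ := GRing.Lmodule.on S.

Definition skew_elt (a : A) (g : gT) : S :=
  [ffun h => if h == g then a else 0].

Definition skew_mul (u v : S) : S :=
  [ffun z => \sum_(g : gT) u g * act g (v (g^-1 * z)%g)].

Definition skew_one : S := skew_elt 1 1%g.

Lemma skew_mulA : associative skew_mul.
Proof.
move=> u v w; apply/ffunP => z; rewrite !ffunE.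
under [RHS]eq_bigr => h _ do rewrite ffunE mulr_suml.
rewrite exchange_big /=; apply: eq_bigr => g _.
rewrite ffunE rmorph_sum mulr_sumr [RHS](reindex_inj (mulgI g)) /=.
apply: eq_bigr => h _; rewrite mulKg rmorphM mulrA; congr (_ * _).
by rewrite aactM /= invMg mulgA.
Qed.

Lemma skew_mul1l : left_id skew_one skew_mul.
Proof.
move=> u; apply/ffunP => z; rewrite ffunE (bigD1 1%g) //= big1 => [|g /negPf g1].
  by rewrite ffunE eqxx mul1r aact1 invg1 mul1g addr0.
by rewrite ffunE g1 mul0r.
Qed.

Lemma skew_mul1r : right_id skew_one skew_mul.
Proof.
move=> u; apply/ffunP => z; rewrite ffunE (bigD1 z) //= big1 => [|g gz].
  by rewrite ffunE mulVg eqxx rmorph1 mulr1 addr0.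
by rewrite ffunE -eq_mulVg1 (negPf gz) rmorph0 mulr0.
Qed.

Lemma skew_mulDl : left_distributive skew_mul +%R.
Proof.
move=> u v w; apply/ffunP => z; rewrite !ffunE -big_split /=.
by apply: eq_bigr => g _; rewrite ffunE mulrDl.
Qed.

Lemma skew_mulDr : right_distributive skew_mul +%R.
Proof.
move=> u v w; apply/ffunP => z; rewrite !ffunE -big_split /=.
by apply: eq_bigr => g _; rewrite ffunE rmorphD mulrDr.
Qed.

Lemma skew_1_neq0 : skew_one != 0.
Proof. by apply/eqP=> /ffunP/(_ 1%g)/eqP; rewrite !ffunE eqxx oner_eq0. Qed.

HB.instance Definition _ := GRing.Zmodule_isNzRing.Build S
  skew_mulA skew_mul1l skew_mul1r skew_mulDl skew_mulDr skew_1_neq0.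

Lemma skew_scaleAl (c : k) (u v : S) : c *: (u * v) = (c *: u) * v.
Proof.
apply/ffunP => z; rewrite !ffunE scaler_sumr; apply: eq_bigr => g _.
by rewrite ffunE scalerAl.
Qed.

HB.instance Definition _ := GRing.Lmodule_isLalgebra.Build k S skew_scaleAl.

Lemma skew_scaleAr (c : k) (u v : S) : c *: (u * v) = u * (c *: v).
Proof.
apply/ffunP => z; rewrite !ffunE scaler_sumr; apply: eq_bigr => g _.
by rewrite ffunE linearZ scalerAr.
Qed.

HB.instance Definition _ := GRing.Lalgebra_isAlgebra.Build k S skew_scaleAr.

Lemma skew_eltM a b g h :
  skew_elt a g * skew_elt b h = skew_elt (a * act g b) (g * h)%g.
Proof.
apply/ffunP => z; rewrite !ffunE (bigD1 g) //= big1 => [|g' /negPf g'g].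
  rewrite !ffunE eqxx addr0 (canF_eq (mulKVg g)).
  by case: eqP => _ //; rewrite rmorph0 mulr0.
by rewrite ffunE g'g mul0r.
Qed.

End SkewGroupAlgebra.

Section IdealQuotient.

Variables (k : comNzRingType) (A : algType k) (rel : A -> Prop).

Inductive ideal_gen : A -> Prop :=
  | ideal_gen_rel x : rel x -> ideal_gen x
  | ideal_gen0 : ideal_gen 0
  | ideal_genD x y : ideal_gen x -> ideal_gen y -> ideal_gen (x + y)
  | ideal_genMl a x : ideal_gen x -> ideal_gen (a * x)
  | ideal_genMr a x : ideal_gen x -> ideal_gen (x * a).

Lemma ideal_genN x : ideal_gen x -> ideal_gen (- x).
Proof. by rewrite -mulN1r; apply: ideal_genMl. Qed.

Lemma ideal_genZ (c : k) x : ideal_gen x -> ideal_gen (c *: x).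
Proof. by rewrite -[x in c *: x]mul1r scalerAl; apply: ideal_genMl. Qed.

Definition ideal_eqv (x y : A) : bool := `[< ideal_gen (x - y) >].

Lemma ideal_eqv_refl : reflexive ideal_eqv.
Proof. by move=> x; apply/asboolP; rewrite subrr; apply: ideal_gen0. Qed.

Lemma ideal_eqv_sym : symmetric ideal_eqv.
Proof.
by move=> x y; apply/asboolP/asboolP => /ideal_genN; rewrite opprB.
Qed.

Lemma ideal_eqv_trans : transitive ideal_eqv.
Proof.
move=> y x z /asboolP xy /asboolP yz; apply/asboolP.
by have := ideal_genD xy yz; rewrite addrA subrK.
Qed.

Canonical ideal_equiv :=
  EquivRel ideal_eqv ideal_eqv_refl ideal_eqv_sym ideal_eqv_trans.

Definition ideal_quot := {eq_quot ideal_eqv}.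
HB.instance Definition _ := Choice.on ideal_quot.

Definition iq_pi (x : A) : ideal_quot := \pi_{eq_quot ideal_eqv} x.
Definition iq_repr (q : ideal_quot) : A := repr (q : {eq_quot ideal_eqv}).

Lemma iq_reprK : cancel iq_repr iq_pi.
Proof. by move=> q; rewrite /iq_pi /iq_repr reprK. Qed.

Lemma iq_piP x y : iq_pi x = iq_pi y <-> ideal_gen (x - y).
Proof.
split=> [/(@eqquotP _ ideal_equiv) /asboolP // | xy].
by apply/(@eqquotP _ ideal_equiv)/asboolP.
Qed.

Lemma iq_repr_pi x : ideal_gen (iq_repr (iq_pi x) - x).
Proof. by apply/iq_piP; rewrite iq_reprK. Qed.

Lemma iqW (P : ideal_quot -> Prop) : (forall x, P (iq_pi x)) -> forall q, P q.
Proof. by move=> Px q; rewrite -(iq_reprK q). Qed.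

Definition iq_add (p q : ideal_quot) := iq_pi (iq_repr p + iq_repr q).
Definition iq_opp (p : ideal_quot) := iq_pi (- iq_repr p).
Definition iq_scale (c : k) (p : ideal_quot) := iq_pi (c *: iq_repr p).
Definition iq_mul (p q : ideal_quot) := iq_pi (iq_repr p * iq_repr q).

Lemma iq_pi_add x y : iq_add (iq_pi x) (iq_pi y) = iq_pi (x + y).
Proof.
by apply/iq_piP; rewrite opprD addrACA; apply: ideal_genD; apply: iq_repr_pi.
Qed.

Lemma iq_pi_opp x : iq_opp (iq_pi x) = iq_pi (- x).
Proof. by apply/iq_piP; rewrite -opprD; apply/ideal_genN/iq_repr_pi. Qed.

Lemma iq_pi_scale c x : iq_scale c (iq_pi x) = iq_pi (c *: x).
Proof. by apply/iq_piP; rewrite -scalerBr; apply/ideal_genZ/iq_repr_pi. Qed.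

Lemma iq_pi_mul x y : iq_mul (iq_pi x) (iq_pi y) = iq_pi (x * y).
Proof.
apply/iq_piP; set x' := iq_repr _; set y' := iq_repr _.
have ->: x' * y' - x * y = (x' - x) * y' + x * (y' - y).
  by rewrite mulrBl mulrBr addrA subrK.
by apply: ideal_genD; [apply: ideal_genMr | apply: ideal_genMl];
  apply: iq_repr_pi.
Qed.

Let qE := (iq_pi_add, iq_pi_opp, iq_pi_scale, iq_pi_mul).

Lemma iq_addA : associative iq_add.
Proof. by do 3![elim/iqW => ?]; rewrite !qE addrA. Qed.
Lemma iq_addC : commutative iq_add.
Proof. by do 2![elim/iqW => ?]; rewrite !qE addrC. Qed.
Lemma iq_add0 : left_id (iq_pi 0) iq_add.
Proof. by elim/iqW => ?; rewrite !qE add0r. Qed.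
Lemma iq_addN : left_inverse (iq_pi 0) iq_opp iq_add.
Proof. by elim/iqW => ?; rewrite !qE addNr. Qed.

HB.instance Definition _ := GRing.isZmodule.Build ideal_quot
  iq_addA iq_addC iq_add0 iq_addN.

Lemma iq_scaleA c d p : iq_scale c (iq_scale d p) = iq_scale (c * d) p.
Proof. by elim/iqW: p => ?; rewrite !qE scalerA. Qed.
Lemma iq_scale1 : left_id 1 iq_scale.
Proof. by elim/iqW => ?; rewrite !qE scale1r. Qed.
Lemma iq_scaleDr : right_distributive iq_scale iq_add.
Proof. by move=> c; do 2![elim/iqW => ?]; rewrite !qE scalerDr. Qed.
Lemma iq_scaleDl p : {morph iq_scale^~ p : c d / c + d >-> iq_add c d}.
Proof. by move=> c d; elim/iqW: p => ?; rewrite !qE scalerDl. Qed.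

HB.instance Definition _ := GRing.Zmodule_isLmodule.Build k ideal_quot
  iq_scaleA iq_scale1 iq_scaleDr iq_scaleDl.

Lemma iq_mulA : associative iq_mul.
Proof. by do 3![elim/iqW => ?]; rewrite !qE mulrA. Qed.
Lemma iq_mul1l : left_id (iq_pi 1) iq_mul.
Proof. by elim/iqW => ?; rewrite !qE mul1r. Qed.
Lemma iq_mul1r : right_id (iq_pi 1) iq_mul.
Proof. by elim/iqW => ?; rewrite !qE mulr1. Qed.
Lemma iq_mulDl : left_distributive iq_mul iq_add.
Proof. by do 3![elim/iqW => ?]; rewrite !qE mulrDl. Qed.
Lemma iq_mulDr : right_distributive iq_mul iq_add.
Proof. by do 3![elim/iqW => ?]; rewrite !qE mulrDr. Qed.

(* A priori the quotient may be the zero ring, so it is not given a structure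
   of algType (which requires 1 != 0); the compatibility of scaling with
   multiplication is iq_scalerAl and iq_scalerAr. *)
HB.instance Definition _ := GRing.Zmodule_isPzRing.Build ideal_quot
  iq_mulA iq_mul1l iq_mul1r iq_mulDl iq_mulDr.

Lemma iq_scalerAl (c : k) (p q : ideal_quot) : c *: (p * q) = (c *: p) * q.
Proof.
elim/iqW: p => ?; elim/iqW: q => ?.
by rewrite /GRing.scale /GRing.mul /= !qE -scalerAl.
Qed.

Lemma iq_scalerAr (c : k) (p q : ideal_quot) : c *: (p * q) = p * (c *: q).
Proof.
elim/iqW: p => ?; elim/iqW: q => ?.
by rewrite /GRing.scale /GRing.mul /= !qE -scalerAr.
Qed.

Lemma iq_pi_linear : linear iq_pi.
Proof. by move=> c x y; rewrite /GRing.scale /GRing.add /= !qE. Qed.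

Lemma iq_pi_monoid_morphism : monoid_morphism iq_pi.
Proof. by split=> // x y; rewrite [RHS]/GRing.mul /= qE. Qed.

HB.instance Definition _ :=
  GRing.isLinear.Build k A ideal_quot *:%R iq_pi iq_pi_linear.
HB.instance Definition _ :=
  GRing.isMonoidMorphism.Build A ideal_quot iq_pi iq_pi_monoid_morphism.

Lemma iq_pi_eq0 x : iq_pi x = 0 <-> ideal_gen x.
Proof. by rewrite -[X in ideal_gen X]subr0 -iq_piP. Qed.

End IdealQuotient.

Definition sympl_reflections (k : fieldType) (V : vectType k)
    (gT : finGroupType) (rho : gT -> 'End(V)) : {set gT} :=
  [set s | \dim (limg (\1 - rho s)%VF) == 2%N].

(* (V, omega, Gamma, c); Gamma is presented by its faithful action rho on V,
   and only the values of c on the symplectic reflections are relevant. *)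
Record sra_datum (k : fieldType) := SraDatum {
  sra_space : vectType k;
  sra_form : {skew_symmetric sra_space};
  sra_formP : is_psymplectic sra_form;
  sra_group : finGroupType;
  sra_rho : sra_group -> 'End(sra_space);
  sra_rho1 : sra_rho 1%g = \1%VF;
  sra_rhoM : forall g h, sra_rho (g * h)%g = (sra_rho g \o sra_rho h)%VF;
  sra_rho_inj : injective sra_rho;
  sra_rho_form : forall g x y,
    sra_form (sra_rho g x) (sra_rho g y) = sra_form x y;
  sra_gen : <<sympl_reflections sra_rho>>%g = [set: sra_group];
  sra_c : sra_group -> k;
  sra_cJ : forall s g, s \in sympl_reflections sra_rho -> sra_c (s ^ g)%g = sra_c s
}.

Section SymplecticReflectionAlgebra.

Variables (k : fieldType) (D : sra_datum k).

Local Notation V := (sra_space D).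
Local Notation Gamma := (sra_group D).
Local Notation omega := (sra_form D).
Local Notation rho := (@sra_rho k D).

Definition sra_refl : {set Gamma} := sympl_reflections rho.

(* The form omega_s, defined by means of the projection onto im(Id - s) along
   ker(Id - s). It is characterized in sra_form_reflP below. *)
Definition sra_proj (s : Gamma) : 'End(V) :=
  daddv_pi (limg (\1 - rho s)%VF) (lker (\1 - rho s)%VF).

Definition sra_form_refl (s : Gamma) (x y : V) : k :=
  omega (sra_proj s x) (sra_proj s y).

Lemma sra_ker_im (s : Gamma) : (#|Gamma|%:R : k) != 0 ->
  (limg (\1 - rho s)%VF :&: lker (\1 - rho s)%VF = 0)%VS.
Proof.
move=> G0; apply/eqP; rewrite -subv0; apply/subvP => _ /memv_capP[/memv_imgP[y _ ->]].
rewrite memv_ker memv0; set x := fun_of_lfun _ y => /eqP xs.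
have {xs} sx : rho s x = x.
  by apply/esym/eqP; rewrite -subr_eq0 -xs !lfun_simp.
have rX n : rho (s ^+ n)%g y = y - x *+ n.
  elim: n => [|n IHn]; first by rewrite expg0 sra_rho1 lfunE subr0.
  rewrite expgS sra_rhoM comp_lfunE IHn linearB linearMn /= sx.
  have -> : rho s y = y - x by rewrite /x !lfun_simp opprB addrC subrK.
  by rewrite mulrS opprD addrA.
have := rX #|Gamma|; rewrite -cardsT expg_cardG ?inE // sra_rho1 lfunE /=.
rewrite cardsT -scaler_nat => /eqP; rewrite eq_sym subr_eq -subr_eq0 opprD.
by rewrite addNKr oppr_eq0 scaler_eq0 (negPf G0).
Qed.

Lemma sra_form_reflP (s : Gamma) : (#|Gamma|%:R : k) != 0 ->
  [/\ forall x y, sra_form_refl s x y = - sra_form_refl s y x,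
      forall x y, x \in lker (\1 - rho s)%VF -> sra_form_refl s x y = 0,
      forall x y, x \in limg (\1 - rho s)%VF -> y \in limg (\1 - rho s)%VF ->
        sra_form_refl s x y = omega x y &
      forall B : {bilinear V -> V -> k^o},
        (forall x y, x \in lker (\1 - rho s)%VF -> B x y = 0 /\ B y x = 0) ->
        (forall x y, x \in limg (\1 - rho s)%VF -> y \in limg (\1 - rho s)%VF ->
          B x y = omega x y) ->
        forall x y, B x y = sra_form_refl s x y].
Proof.
move=> G0; have IK0 := sra_ker_im s G0; rewrite /sra_form_refl /sra_proj.
set I := limg _ in IK0 *; set K := lker _ in IK0 *.
have KI0 : (K :&: I = 0)%VS by rewrite capvC.
have IK : (I + K = fullv)%VS.
  apply/eqP; rewrite eqEdim subvf /= dimv_disjoint_sum // addnC.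
  by rewrite -(limg_ker_dim (\1 - rho s)%VF fullv) capfv.
have dec w : daddv_pi I K w + daddv_pi K I w = w.
  by apply: daddv_pi_add; rewrite // IK memvf.
have piK w : w \in K -> daddv_pi I K w = 0.
  by move=> wK; apply: (addIr (daddv_pi K I w)); rewrite dec daddv_pi_id ?add0r.
split=> [x y | x y xK | x y xI yI | B BK BI x y].
- by rewrite hermC /= expr1 mulN1r.
- by rewrite piK // linear0l.
- by rewrite !daddv_pi_id.
rewrite -{1}(dec x) linearDl /= [X in _ + X](BK _ _ _).1 ?memv_pi // addr0.
rewrite -{1}(dec y) linearDr /= [X in _ + X](BK _ _ _).2 ?memv_pi // addr0.
by rewrite BI ?memv_pi.
Qed.

Lemma sra_tensor_act1 : tensor_map (rho 1%g) =1 id.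
Proof. by apply: tensor_map_id => x /=; rewrite sra_rho1 id_lfunE. Qed.

Lemma sra_tensor_actM g h :
  tensor_map (rho (g * h)%g) =1 tensor_map (rho g) \o tensor_map (rho h).
Proof. by apply: tensor_map_comp => x /=; rewrite sra_rhoM comp_lfunE. Qed.

Definition sra_tensor_act : alg_action (tensor V) Gamma :=
  AlgAction sra_tensor_act1 sra_tensor_actM.

Local Notation TVG := (skew_alg sra_tensor_act).

Definition skew_vec (x : V) : TVG := skew_elt sra_tensor_act (tensor_inj x) 1%g.
Definition skew_grp (g : Gamma) : TVG := skew_elt sra_tensor_act 1 g.

Definition sra_relator (x y : V) : TVG :=
  skew_vec x * skew_vec y - skew_vec y * skew_vec x
  - (omega x y *: 1
     - \sum_(s in sra_refl) (sra_c s * sra_form_refl s x y) *: skew_grp s).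

Definition sra := ideal_quot (fun r : TVG => exists x y, r = sra_relator x y).

HB.instance Definition _ := GRing.PzRing.on sra.
HB.instance Definition _ := GRing.Lmodule.on sra.

Definition sra_grp (g : Gamma) : sra := iq_pi _ (skew_grp g).

Lemma sra_grpM g h : sra_grp (g * h)%g = sra_grp g * sra_grp h.
Proof. by rewrite -rmorphM /= skew_eltM rmorph1 mulr1. Qed.

Definition sra_sym : sra := (#|Gamma|%:R)^-1 *: \sum_(g : Gamma) sra_grp g.

Lemma sra_sym_idem : (#|Gamma|%:R : k) != 0 -> sra_sym * sra_sym = sra_sym.
Proof.
move=> G0; rewrite /sra_sym -iq_scalerAl; congr (_ *: _).
rewrite mulr_suml (eq_bigr (fun=> sra_sym)) => [|g _].
  rewrite sumr_const /sra_sym -scaler_nat scalerA cardT -cardE.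
  by rewrite divff // scale1r.
rewrite -iq_scalerAr mulr_sumr /sra_sym; congr (_ *: _).
rewrite [RHS](reindex_inj (mulgI g)); apply: eq_bigr => h _.
exact/esym/sra_grpM.
Qed.

End SymplecticReflectionAlgebra.

(* Left R-modules are lmodType R, right R-modules are lmodType R^c. *)
Section Hom.

Variables (R : pzRingType) (M N : lmodType R).

Definition modhom := {linear M -> N}.

HB.instance Definition _ := gen_eqMixin modhom.
HB.instance Definition _ := gen_choiceMixin modhom.

Lemma modhomP (f g : modhom) : f =1 g -> f = g.
Proof.
case: f g => [f [[fD] [fZ]]] [g [[gD] [gZ]]] /= /funext fg.
rewrite {}fg in fD fZ *.
by rewrite (Prop_irrelevance fD gD) (Prop_irrelevance fZ gZ).
Qed.

Definition modhom_zero : modhom := \0.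
Definition modhom_opp (f : modhom) : modhom := \- f.
Definition modhom_add (f g : modhom) : modhom := f \+ g.

Lemma modhom_addA : associative modhom_add.
Proof. by move=> f g h; apply: modhomP => x /=; rewrite addrA. Qed.
Lemma modhom_addC : commutative modhom_add.
Proof. by move=> f g; apply: modhomP => x /=; rewrite addrC. Qed.
Lemma modhom_add0 : left_id modhom_zero modhom_add.
Proof. by move=> f; apply: modhomP => x /=; rewrite add0r. Qed.
Lemma modhom_addN : left_inverse modhom_zero modhom_opp modhom_add.
Proof. by move=> f; apply: modhomP => x /=; rewrite addNr. Qed.

HB.instance Definition _ := GRing.isZmodule.Build modhom
  modhom_addA modhom_addC modhom_add0 modhom_addN.

End Hom.

Section Endo.

Variables (R : pzRingType) (M : lmodType R).

Definition endo := modhom M M.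
HB.instance Definition _ := GRing.Zmodule.on endo.

Definition endo_one : endo := idfun.
Definition endo_mul (f g : endo) : endo := f \o g.

Lemma endo_mulA : associative endo_mul.
Proof. by move=> f g h; apply: modhomP. Qed.
Lemma endo_mul1l : left_id endo_one endo_mul.
Proof. by move=> f; apply: modhomP. Qed.
Lemma endo_mul1r : right_id endo_one endo_mul.
Proof. by move=> f; apply: modhomP. Qed.
Lemma endo_mulDl : left_distributive endo_mul +%R.
Proof. by move=> f g h; apply: modhomP. Qed.
Lemma endo_mulDr : right_distributive endo_mul +%R.
Proof. by move=> f g h; apply: modhomP => x /=; rewrite linearD. Qed.

HB.instance Definition _ := GRing.Zmodule_isPzRing.Build endo
  endo_mulA endo_mul1l endo_mul1r endo_mulDl endo_mulDr.

End Endo.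

(* The dual Hom_R(M, R) of a left module, a right module by (f r)(x) = f(x) r. *)
Section LeftDual.

Variables (R : pzRingType) (M : lmodType R).

Definition ldual := modhom M R^o.
HB.instance Definition _ := GRing.Zmodule.on ldual.

Definition ldual_fun (r : R) (f : ldual) (x : M) : R^o := (f x : R) * r.

Lemma ldual_fun_linear r f : linear (ldual_fun r f).
Proof.
move=> a x y; rewrite /ldual_fun linearP mulrDl; congr (_ + _).
exact/esym/mulrA.
Qed.

HB.instance Definition _ r f :=
  GRing.isLinear.Build R M R^o *:%R (ldual_fun r f) (ldual_fun_linear r f).

Definition ldual_scale (r : R^c) (f : ldual) : ldual := ldual_fun r f.

Lemma ldual_scaleA (r s : R^c) f :
  ldual_scale r (ldual_scale s f) = ldual_scale (r * s) f.
Proof. by apply: modhomP => x; rewrite /= /ldual_fun /= -mulrA. Qed.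
Lemma ldual_scale1 : left_id 1 ldual_scale.
Proof. by move=> f; apply: modhomP => x; rewrite /= /ldual_fun mulr1. Qed.
Lemma ldual_scaleDr : right_distributive ldual_scale +%R.
Proof. by move=> r f g; apply: modhomP => x; rewrite /= /ldual_fun /= mulrDl. Qed.
Lemma ldual_scaleDl f : {morph ldual_scale^~ f : r s / r + s}.
Proof. by move=> r s; apply: modhomP => x; rewrite /= /ldual_fun /= mulrDr. Qed.

HB.instance Definition _ := GRing.Zmodule_isLmodule.Build R^c ldual
  ldual_scaleA ldual_scale1 ldual_scaleDr ldual_scaleDl.

End LeftDual.

(* The dual Hom_R(M, R) of a right module, a left module by (r f)(x) = r f(x). *)
Section RightDual.

Variables (R : pzRingType) (M : lmodType R^c).

Definition rdual := modhom M (R^c)^o.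
HB.instance Definition _ := GRing.Zmodule.on rdual.

Definition rdual_fun (r : R) (f : rdual) (x : M) : (R^c)^o := r * (f x : R).

Lemma rdual_fun_linear r f : linear (rdual_fun r f).
Proof.
move=> a x y; rewrite /rdual_fun linearP mulrDr; congr (_ + _).
exact: (mulrA r (f x : R) (a : R)).
Qed.

HB.instance Definition _ r f :=
  GRing.isLinear.Build R^c M (R^c)^o *:%R (rdual_fun r f) (rdual_fun_linear r f).

Definition rdual_scale (r : R) (f : rdual) : rdual := rdual_fun r f.

Lemma rdual_scaleA (r s : R) f :
  rdual_scale r (rdual_scale s f) = rdual_scale (r * s) f.
Proof. by apply: modhomP => x; rewrite /= /rdual_fun /= mulrA. Qed.
Lemma rdual_scale1 : left_id 1 rdual_scale.
Proof. by move=> f; apply: modhomP => x; rewrite /= /rdual_fun mul1r. Qed.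
Lemma rdual_scaleDr : right_distributive rdual_scale +%R.
Proof. by move=> r f g; apply: modhomP => x; rewrite /= /rdual_fun /= mulrDr. Qed.
Lemma rdual_scaleDl f : {morph rdual_scale^~ f : r s / r + s}.
Proof. by move=> r s; apply: modhomP => x; rewrite /= /rdual_fun /= mulrDl. Qed.

HB.instance Definition _ := GRing.Zmodule_isLmodule.Build R rdual
  rdual_scaleA rdual_scale1 rdual_scaleDr rdual_scaleDl.

End RightDual.

Section LeftReflexive.

Variables (R : pzRingType) (M : lmodType R).

Definition leval (x : M) (f : ldual M) : (R^c)^o := f x.

Lemma leval_linear x : linear (leval x).
Proof. by []. Qed.

HB.instance Definition _ x := GRing.isLinear.Build R^c (ldual M) (R^c)^o *:%R
  (leval x) (leval_linear x).

Definition lbidual (x : M) : rdual (ldual M) := leval x.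

Lemma lbidual_linear : linear lbidual.
Proof. by move=> r x y; apply: modhomP => f; rewrite /= /leval linearP. Qed.

HB.instance Definition _ := GRing.isLinear.Build R M (rdual (ldual M)) *:%R
  lbidual lbidual_linear.

Definition lreflexive : Prop := bijective lbidual.

End LeftReflexive.

Section RightReflexive.

Variables (R : pzRingType) (M : lmodType R^c).

Definition reval (x : M) (f : rdual M) : R^o := f x.

Lemma reval_linear x : linear (reval x).
Proof. by []. Qed.

HB.instance Definition _ x := GRing.isLinear.Build R (rdual M) R^o *:%R
  (reval x) (reval_linear x).

Definition rbidual (x : M) : ldual (rdual M) := reval x.

Lemma rbidual_linear : linear rbidual.
Proof. by move=> r x y; apply: modhomP => f; rewrite /= /reval linearP. Qed.

HB.instance Definition _ := GRing.isLinear.Build R^c M (ldual (rdual M)) *:%R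
  rbidual rbidual_linear.

Definition rreflexive : Prop := bijective rbidual.

End RightReflexive.

Record idempotent_elt (A : pzRingType) := IdempotentElt {
  idem_val : A;
  idemP : idem_val * idem_val = idem_val
}.

Section Corner.

Variables (A : pzRingType) (e0 : idempotent_elt A).
Local Notation e := (idem_val e0).

Definition in_eAe : {pred A} := fun x => `[< exists a : A, x = e * a * e >].
Definition in_Ae : {pred A} := fun x => `[< exists a : A, x = a * e >].
Definition in_eA : {pred A} := fun x => `[< exists a : A, x = e * a >].

Lemma in_AeP x : x \in in_Ae <-> x * e = x.
Proof.
split=> [/asboolP[a ->]|<-]; first by rewrite -mulrA idemP.
by apply/asboolP; exists x.
Qed.

Lemma in_eAP x : x \in in_eA <-> e * x = x.
Proof.
split=> [/asboolP[a ->]|<-]; first by rewrite mulrA idemP.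
by apply/asboolP; exists x.
Qed.

Lemma in_eAeP x : x \in in_eAe <-> e * x = x /\ x * e = x.
Proof.
split=> [/asboolP[a ->]|[ex xe]].
  by split; rewrite ?mulrA ?idemP // -!mulrA idemP.
by apply/asboolP; exists x; rewrite ex xe.
Qed.

Lemma in_Ae_zmod : zmod_closed in_Ae.
Proof.
split=> [|x y /in_AeP xe /in_AeP ye]; apply/in_AeP; first by rewrite mul0r.
by rewrite mulrBl xe ye.
Qed.

Lemma in_eA_zmod : zmod_closed in_eA.
Proof.
split=> [|x y /in_eAP ex /in_eAP ey]; apply/in_eAP; first by rewrite mulr0.
by rewrite mulrBr ex ey.
Qed.

Lemma in_eAe_zmod : zmod_closed in_eAe.
Proof.
split=> [|x y /in_eAeP[ex xe] /in_eAeP[ey ye]]; apply/in_eAeP.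
  by rewrite mul0r mulr0.
by rewrite mulrBr mulrBl ex xe ey ye.
Qed.

HB.instance Definition _ := GRing.isZmodClosed.Build A in_Ae in_Ae_zmod.
HB.instance Definition _ := GRing.isZmodClosed.Build A in_eA in_eA_zmod.
HB.instance Definition _ := GRing.isZmodClosed.Build A in_eAe in_eAe_zmod.

Record Ae := AeElt { Ae_val :> A; Ae_valP : Ae_val \in in_Ae }.
Record eA := EAElt { eA_val :> A; eA_valP : eA_val \in in_eA }.
Record eAe := EAeElt { eAe_val :> A; eAe_valP : eAe_val \in in_eAe }.

HB.instance Definition _ := [isSub for Ae_val].
HB.instance Definition _ := [Choice of Ae by <:].
HB.instance Definition _ := [SubChoice_isSubZmodule of Ae by <:].
HB.instance Definition _ := [isSub for eA_val].
HB.instance Definition _ := [Choice of eA by <:].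
HB.instance Definition _ := [SubChoice_isSubZmodule of eA by <:].
HB.instance Definition _ := [isSub for eAe_val].
HB.instance Definition _ := [Choice of eAe by <:].
HB.instance Definition _ := [SubChoice_isSubZmodule of eAe by <:].

Lemma eAe_one_subproof : e \in in_eAe.
Proof. by apply/in_eAeP; rewrite idemP. Qed.

Lemma eAe_mul_subproof (x y : eAe) : (x : A) * (y : A) \in in_eAe.
Proof.
have [ex _] := (in_eAeP x).1 (eAe_valP x).
have [_ ye] := (in_eAeP y).1 (eAe_valP y).
by apply/in_eAeP; rewrite mulrA ex -mulrA ye.
Qed.

Definition eAe_one : eAe := EAeElt eAe_one_subproof.
Definition eAe_mul (x y : eAe) : eAe := EAeElt (eAe_mul_subproof x y).

Lemma eAe_mulA : associative eAe_mul.
Proof. by move=> x y z; apply: val_inj; rewrite /= mulrA. Qed.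
Lemma eAe_mul1l : left_id eAe_one eAe_mul.
Proof. by move=> x; apply: val_inj => /=; case/in_eAeP: (eAe_valP x). Qed.
Lemma eAe_mul1r : right_id eAe_one eAe_mul.
Proof. by move=> x; apply: val_inj => /=; case/in_eAeP: (eAe_valP x). Qed.
Lemma eAe_mulDl : left_distributive eAe_mul +%R.
Proof. by move=> x y z; apply: val_inj; rewrite /= mulrDl. Qed.
Lemma eAe_mulDr : right_distributive eAe_mul +%R.
Proof. by move=> x y z; apply: val_inj; rewrite /= mulrDr. Qed.

HB.instance Definition _ := GRing.Zmodule_isPzRing.Build eAe
  eAe_mulA eAe_mul1l eAe_mul1r eAe_mulDl eAe_mulDr.

(* Ae as a left A-module. *)
Definition Ae_l := Ae.
HB.instance Definition _ := GRing.Zmodule.on Ae_l.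

Lemma Ae_l_subproof (a : A) (x : Ae) : a * (x : A) \in in_Ae.
Proof. by apply/in_AeP; rewrite -mulrA (in_AeP x).1 // Ae_valP. Qed.

Definition Ae_l_scale (a : A) (x : Ae_l) : Ae_l := AeElt (Ae_l_subproof a x).

Lemma Ae_l_scaleA a b x : Ae_l_scale a (Ae_l_scale b x) = Ae_l_scale (a * b) x.
Proof. by apply: val_inj; rewrite /= mulrA. Qed.
Lemma Ae_l_scale1 : left_id 1 Ae_l_scale.
Proof. by move=> x; apply: val_inj; rewrite /= mul1r. Qed.
Lemma Ae_l_scaleDr : right_distributive Ae_l_scale +%R.
Proof. by move=> a x y; apply: val_inj; rewrite /= mulrDr. Qed.
Lemma Ae_l_scaleDl x : {morph Ae_l_scale^~ x : a b / a + b}.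
Proof. by move=> a b; apply: val_inj; rewrite /= mulrDl. Qed.

HB.instance Definition _ := GRing.Zmodule_isLmodule.Build A Ae_l
  Ae_l_scaleA Ae_l_scale1 Ae_l_scaleDr Ae_l_scaleDl.

(* Ae as a right eAe-module. *)
Definition Ae_r := Ae.
HB.instance Definition _ := GRing.Zmodule.on Ae_r.

Lemma Ae_r_subproof (a : eAe) (x : Ae) : (x : A) * (a : A) \in in_Ae.
Proof.
have [_ ae] := (in_eAeP a).1 (eAe_valP a).
by apply/in_AeP; rewrite -mulrA ae.
Qed.

Definition Ae_r_scale (a : eAe^c) (x : Ae_r) : Ae_r := AeElt (Ae_r_subproof a x).

Lemma Ae_r_scaleA (a b : eAe^c) x :
  Ae_r_scale a (Ae_r_scale b x) = Ae_r_scale (a * b) x.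
Proof. by apply: val_inj; rewrite /= mulrA. Qed.
Lemma Ae_r_scale1 : left_id 1 Ae_r_scale.
Proof. by move=> x; apply: val_inj => /=; apply/in_AeP/Ae_valP. Qed.
Lemma Ae_r_scaleDr : right_distributive Ae_r_scale +%R.
Proof. by move=> a x y; apply: val_inj; rewrite /= mulrDl. Qed.
Lemma Ae_r_scaleDl x : {morph Ae_r_scale^~ x : a b / a + b}.
Proof. by move=> a b; apply: val_inj; rewrite /= mulrDr. Qed.

HB.instance Definition _ := GRing.Zmodule_isLmodule.Build eAe^c Ae_r
  Ae_r_scaleA Ae_r_scale1 Ae_r_scaleDr Ae_r_scaleDl.

(* eA as a left eAe-module. *)
Definition eA_l := eA.
HB.instance Definition _ := GRing.Zmodule.on eA_l.

Lemma eA_l_subproof (a : eAe) (x : eA) : (a : A) * (x : A) \in in_eA.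
Proof.
have [ea _] := (in_eAeP a).1 (eAe_valP a).
by apply/in_eAP; rewrite mulrA ea.
Qed.

Definition eA_l_scale (a : eAe) (x : eA_l) : eA_l := EAElt (eA_l_subproof a x).

Lemma eA_l_scaleA a b x : eA_l_scale a (eA_l_scale b x) = eA_l_scale (a * b) x.
Proof. by apply: val_inj; rewrite /= mulrA. Qed.
Lemma eA_l_scale1 : left_id 1 eA_l_scale.
Proof. by move=> x; apply: val_inj => /=; apply/in_eAP/eA_valP. Qed.
Lemma eA_l_scaleDr : right_distributive eA_l_scale +%R.
Proof. by move=> a x y; apply: val_inj; rewrite /= mulrDr. Qed.
Lemma eA_l_scaleDl x : {morph eA_l_scale^~ x : a b / a + b}.
Proof. by move=> a b; apply: val_inj; rewrite /= mulrDl. Qed.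

HB.instance Definition _ := GRing.Zmodule_isLmodule.Build eAe eA_l
  eA_l_scaleA eA_l_scale1 eA_l_scaleDr eA_l_scaleDl.

End Corner.

Section SymmetrizingIdempotent.

Variables (k : fieldType) (D : sra_datum k) (p : nat).
Hypotheses (kp : p \in [pchar k]) (pG : ~~ (p %| #|sra_group D|)%N).

Lemma sra_card_neq0 : (#|sra_group D|%:R : k) != 0.
Proof. by rewrite -(dvdn_pcharf kp). Qed.

Definition sra_e : idempotent_elt (sra D) :=
  IdempotentElt (sra_sym_idem sra_card_neq0).

End SymmetrizingIdempotent.

(* Main.v *)
(* Let P = S(V), presented as k[x_1, ..., x_n], and let A = P * Gamma. H is a
   filtered algebra with associated graded A (PBW): following the classical
   argument for enveloping algebras, one builds by induction on the degree
   operators on A which represent the generators x_i and g; the relations of H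
   reduce to the Gamma-equivariance of the commutator form kappa and to the
   Jacobi identity for it.

   For g <> 1 the image of g - 1 contains two linearly independent vectors, since
   a symplectic transvection <> 1 cannot have order prime to p. Choose one v_g in
   V for each g <> 1. Expanding prod_g (g v_g (x) 1 - 1 (x) v_g) as
   sum_i f_i (x) f'_i gives sum_i f_i h(f'_i) = [h = 1] d, where
   d = prod_g (g v_g - v_g). Hence d f = sum_i f_i tr(f'_i f), so that a
   P^Gamma-linear map phi : P -> P satisfies phi(d f) = sum_h a_h h(f) with
   a_h = sum_i phi(f_i) h(f'_i); letting the v_g vary, the products d have no
   common factor, whence h(d) | a_h and phi is itself in P * Gamma.

   Finally He is the image of P under f |-> f e, and an eHe-linear map out of He
   has bounded degree since P is finitely generated over P^Gamma. Its symbol is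
   P^Gamma-linear, so it is the symbol of a left multiplication by an element of
   H; subtract and induct on the degree, which may become negative. The left
   module eH is dealt with in the opposite algebra. *)

From HB Require Import structures.
Require Import Defs.
From mathcomp Require Import all_boot all_order all_algebra all_fingroup.
From mathcomp Require Import generic_quotient sesquilinear boolp.
From mathcomp Require Import ring zify mpoly ssrcomplements.

Set Implicit Arguments.
Unset Strict Implicit.
Unset Printing Implicit Defensive.

Import GRing.Theory.
Local Open Scope ring_scope.

(** * Group actions and linear maps over the invariants *)

(** The ideal HeH may be proper, so (ii) cannot come from a Morita equivalence. It is replaced by
    one statement, [sym_double_centralizer]: every additive eHe-linear map from He to H is left
    multiplication by an element of H. This yields surjectivity in (ii) and in the first half of
    (iii) at once; injectivity is [sym_faithful].

    Two independent vectors in the image of [g - 1] are needed to exclude poles: if that image were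
    spanned by one linear form l, the divided difference f |-> (f - g f) / l would be P^Gamma-linear
    without lying in P * Gamma.

    Oddness of p makes the skew-symmetric form omega alternating. That p does not divide the order
    of Gamma also splits V into the image and the kernel of 1 - s; for a reflection s the
    coefficient kappa_s then only sees a plane, where any three vectors satisfy the Jacobi identity.

    Degrees are counted strictly: level d of a filtration means degree less than d, so level 0 is
    zero. With truncated subtraction, an element whose degree bound drops below zero is then
    zero. *)

Definition coprime_pair (P : idomainType) (u v : P) : Prop :=
  u != 0 /\ forall y z, y * v = z * u -> exists w, y = w * u.

(** Cross-multiplying the quotients x = a u / b and y = a v / b gives x v = y u, so u divides x. No
    unique factorization is involved: coprimality means that [v] can be cancelled modulo [u]. *)
Lemma coprime_pair_dvd (P : idomainType) (u v a b : P) : b != 0 ->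
  coprime_pair u v -> (exists q, a * u = q * b) -> (exists q, a * v = q * b) ->
  exists q, a = q * b.
Proof.
move=> b0 [u0 uv] [x ax] [y ay].
have /uv[w xw] : x * v = y * u.
  by apply: (mulIf b0); rewrite mulrAC -ax mulrAC ay mulrAC.
by exists w; apply: (mulIf u0); rewrite ax xw mulrAC.
Qed.

(** The products over all choices [c] have no common factor: by induction the two choices at the
    first index make [a * l i false] and [a * l i true] multiples of [b], and [coprime_pair_dvd]
    removes that factor. *)
Lemma coprime_family_dvd (P : idomainType) (I : eqType) (l : I -> bool -> P)
    (s : seq I) (a b : P) : b != 0 -> uniq s ->
  (forall i, i \in s -> coprime_pair (l i false) (l i true)) ->
  (forall c : I -> bool, exists q, a * \prod_(i <- s) l i (c i) = q * b) ->
  exists q, a = q * b.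
Proof.
move=> b0; elim: s a => [|i s IHs] a /=.
  by move=> _ _ /(_ (fun=> true)); rewrite big_nil mulr1.
move=> /andP[is_ us] cop H; apply: (coprime_pair_dvd b0 (cop i (mem_head _ _))).
- apply: IHs => // [j js|c]; first by apply: cop; rewrite inE js orbT.
  (* Since the list has no repetition, fixing the choice at [i] leaves the other factors alone. *)
  have [q] := H (fun j => if j == i then false else c j).
  rewrite big_cons eqxx mulrA => E; exists q; rewrite -E; congr (_ * _).
  by apply: eq_big_seq => j js; case: eqP => // ji; rewrite -ji js in is_.
- apply: IHs => // [j js|c]; first by apply: cop; rewrite inE js orbT.
  have [q] := H (fun j => if j == i then true else c j).
  rewrite big_cons eqxx mulrA => E; exists q; rewrite -E; congr (_ * _).
  by apply: eq_big_seq => j js; case: eqP => // ji; rewrite -ji js in is_.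
Qed.

Section InvariantLinear.

Variables (P : idomainType) (G : finGroupType) (act : G -> {rmorphism P -> P}).
Hypotheses (act1 : act 1%g =1 id)
  (actM : forall g h, act (g * h)%g =1 act g \o act h).

Definition invariant (q : P) : Prop := forall g, act g q = q.

Hypothesis act_reg : forall g, g != 1%g ->
  exists v w, coprime_pair (act g v - v) (act g w - w).

Lemma act_inj g : injective (act g).
Proof.
by apply: (can_inj (g := act g^-1%g)) => x; rewrite -[LHS]/((_ \o _) x) -actM mulVg act1.
Qed.

Lemma coprime_pair_act g u v : coprime_pair u v -> coprime_pair (act g u) (act g v).
Proof.
have actK x : act g (act g^-1%g x) = x.
  by rewrite -[LHS]/((_ \o _) x) -actM mulgV act1.
move=> [u0 uv]; split=> [|y z]; first by rewrite raddf_eq0 //; apply: act_inj.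
rewrite -(actK y) -(actK z) -!rmorphM => /act_inj/uv[w ->].
by exists (act g w); rewrite rmorphM.
Qed.

Lemma invariant_trace f : invariant (\sum_h act h f).
Proof.
move=> g; rewrite rmorph_sum [RHS](reindex_inj (mulgI g)) /=.
by apply: eq_bigr => h _; rewrite actM.
Qed.

Lemma invariant_norm f : invariant (\prod_h act h f).
Proof.
move=> g; rewrite rmorph_prod [RHS](reindex_inj (mulgI g)) /=.
by apply: eq_bigr => h _; rewrite actM.
Qed.

(** A list of pairs stands for an element of P (x) P, expanded factor by factor; applying [h] to the
    second components and multiplying out evaluates it at [h]. *)
Lemma separating_tensor (v : G -> P) (r : seq G) :
  exists s : seq (P * P), forall h,
    \sum_(x <- s) x.1 * act h x.2 = \prod_(g <- r) (act g (v g) - act h (v g)).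
Proof.
elim: r => [|g r [s Hs]].
  by exists [:: (1, 1)] => h; rewrite big_seq1 big_nil /= rmorph1 mulr1.
exists ([seq (x.1 * act g (v g), x.2) | x <- s] ++ [seq (- x.1, x.2 * v g) | x <- s]).
move=> h; rewrite big_cat !big_map big_cons -Hs mulrBl !mulr_sumr -sumrN.
by congr (_ + _); apply: eq_bigr => x _ /=; rewrite ?rmorphM; ring.
Qed.


(** Each [g] has two candidates for v_g, told apart by the boolean, so that a function
    [c : G -> bool] is a choice of all the v_g. *)
Definition root_diff (v : G -> bool -> P) (g : G) (b : bool) : P :=
  act g (v g b) - v g b.

Lemma regular_root_diffs : exists v, forall g, g != 1%g ->
  coprime_pair (root_diff v g false) (root_diff v g true).
Proof.
have /choice[p Hp] g : exists p : P * P, g != 1%g ->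
    coprime_pair (act g p.1 - p.1) (act g p.2 - p.2).
  have [->|/act_reg[v [w vw]]] := eqVneq g 1%g; first by exists (0, 0).
  by exists (v, w).
by exists (fun g b => if b then (p g).2 else (p g).1) => g /Hp.
Qed.

Let G1 : seq G := [seq g <- index_enum G | g != 1%g].

Lemma mem_G1 g : (g \in G1) = (g != 1%g).
Proof. by rewrite mem_filter mem_index_enum andbT. Qed.

Lemma separating_tensor1 v (c : G -> bool) : exists s : seq (P * P),
  forall h, \sum_(x <- s) x.1 * act h x.2 =
            if h == 1%g then \prod_(g <- G1) root_diff v g (c g) else 0.
Proof.
have [s Hs] := separating_tensor (fun g => v g (c g)) G1.
exists s => h; rewrite Hs; case: eqP => [->|/eqP h1].
  by apply: eq_bigr => g _; rewrite act1.
(* The factor of index [h] itself is zero. *)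
by apply/eqP; rewrite prodf_seq_eq0; apply/hasP; exists h; rewrite ?mem_G1 //= subrr.
Qed.

Lemma root_diff_prod_neq0 v (c : G -> bool) :
  (forall g, g != 1%g -> coprime_pair (root_diff v g false) (root_diff v g true)) ->
  (forall g, c g = false) ->
  \prod_(g <- G1) root_diff v g (c g) != 0.
Proof.
move=> Hv c0; rewrite prodf_seq_neq0; apply/allP => g; rewrite mem_G1 => /Hv[+ _].
by rewrite c0.
Qed.

(** Weighting the relations at [f = x.2] by [act g x.1] and summing over the separating tensor
    leaves only the term [h = g], which is [b g * act g d]. *)
Lemma act_independent (b : G -> P) :
  (forall f, \sum_h b h * act h f = 0) -> forall h, b h = 0.
Proof.
move=> Hb g; have [v Hv] := regular_root_diffs.
have [s Hs] := separating_tensor1 v (fun=> false).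
set d := \prod_(g <- G1) _ in Hs.
have d0 : d != 0 by apply: root_diff_prod_neq0.
suff /eqP : b g * act g d = 0.
  by rewrite mulf_eq0 (raddf_eq0 _ (@act_inj g)) (negPf d0) orbF => /eqP.
have -> : b g * act g d = \sum_h b h * \sum_(x <- s) act g x.1 * act h x.2.
  rewrite (bigD1 g) //= [X in _ + X]big1 => [|h hg].
    rewrite addr0; have := Hs 1%g; rewrite eqxx => <-.
    by rewrite rmorph_sum; congr (_ * _); apply: eq_bigr => x _; rewrite rmorphM act1.
  suff -> : \sum_(x <- s) act g x.1 * act h x.2 = 0 by rewrite mulr0.
  transitivity (act g (\sum_(x <- s) x.1 * act (g^-1 * h)%g x.2)).
    rewrite rmorph_sum; apply: eq_bigr => x _; rewrite rmorphM /=.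
    by rewrite -[act g (act _ _)]/((_ \o _) _) -actM mulKVg.
  by rewrite Hs -eq_mulVg1 eq_sym (negPf hg) rmorph0.
under eq_bigr => h _ do rewrite mulr_sumr.
rewrite exchange_big big1 //= => x _.
under eq_bigr => h _ do rewrite mulrCA.
by rewrite -mulr_sumr Hb mulr0.
Qed.

Theorem invariant_linear_act (phi : P -> P) : {morph phi : x y / x + y} ->
  (forall f q, invariant q -> phi (f * q) = phi f * q) ->
  exists a : G -> P, forall f, phi f = \sum_g a g * act g f.
Proof.
move=> phiD phiM; have [v Hv] := regular_root_diffs.
pose d c := \prod_(g <- G1) root_diff v g (c g).
have phi0 : phi 0 = 0 by apply: (addrI (phi 0)); rewrite -phiD !addr0.
have phi_sum (I : Type) (r : seq I) (F : I -> P) :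
    phi (\sum_(i <- r) F i) = \sum_(i <- r) phi (F i) by apply: big_morph.
have /choice[a Ha] c : exists a : G -> P, forall f,
    phi (d c * f) = \sum_g a g * act g f.
  have [s Hs] := separating_tensor1 v c.
  exists (fun h => \sum_(x <- s) phi x.1 * act h x.2) => f.
  have -> : d c * f = \sum_(x <- s) x.1 * \sum_h act h (x.2 * f).
    under eq_bigr => x _ do rewrite mulr_sumr.
    rewrite exchange_big (bigD1 1%g) //= [X in _ = _ + X]big1 ?addr0.
      have := Hs 1%g; rewrite eqxx -/(d c) => <-; rewrite mulr_suml.
      by apply: eq_bigr => x _; rewrite !act1 mulrA.
    move=> h /negPf h1; under eq_bigr => x _ do rewrite rmorphM mulrA.
    by rewrite -mulr_suml Hs h1 mul0r.
  rewrite phi_sum; under eq_bigr => x _.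
    rewrite phiM; last exact: invariant_trace.
    rewrite mulr_sumr; over.
  rewrite exchange_big /=; apply: eq_bigr => h _; rewrite mulr_suml.
  by apply: eq_bigr => x _; rewrite rmorphM mulrA.
pose c0 := fun _ : G => false; have d0 : d c0 != 0 by apply: root_diff_prod_neq0.
(* Expand [phi (d c0 * d c * f)] once with the coefficients for [c0] and once with those for [c];
   independence allows the coefficients to be compared. *)
have swap c g : a c0 g * act g (d c) = a c g * act g (d c0).
  apply/eqP; rewrite -subr_eq0; apply/eqP; move: g.
  apply: act_independent => f.
  under eq_bigr => h _ do rewrite mulrBl -!mulrA -!rmorphM.
  by rewrite sumrB -!Ha mulrCA subrr.
have /choice[q Hq] g : exists q, a c0 g = q * act g (d c0).
  apply: (@coprime_family_dvd _ G (fun i b => act g (root_diff v i b)) G1).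
  - by rewrite raddf_eq0 //; apply: act_inj.
  - by rewrite filter_uniq // index_enum_uniq.
  - by move=> i; rewrite mem_G1 => /Hv; apply: coprime_pair_act.
  by move=> c; exists (a c g); rewrite -swap /d rmorph_prod.
(* To undo the factor [d c0], multiply by its norm [N]: it is a multiple of [d c0] and, being
   invariant, passes through [phi]. *)
exists q => f; pose N := \prod_h act h (d c0).
have N0 : N != 0.
  by apply/prodf_neq0 => h _; rewrite raddf_eq0 //; apply: act_inj.
apply: (mulIf N0); rewrite -phiM; last exact: invariant_norm.
rewrite {1}/N (bigD1 1%g) //= act1 [f * _]mulrCA Ha mulr_suml.
apply: eq_bigr => g _; rewrite Hq -!mulrA -rmorphM; congr (_ * _).
have actN : act g N = N := invariant_norm (d c0) g.
rewrite -[in RHS]actN -rmorphM; congr (act g _).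
by rewrite [in RHS]/N [in RHS](bigD1 1%g) //= act1 mulrCA.
Qed.

End InvariantLinear.

(** * Polynomials as a finite graded module over the invariants *)

Section FiniteGeneration.

Variables (k : idomainType) (n : nat) (G : finGroupType).
Local Notation P := {mpoly k[n]}.
Variable act : G -> {lrmorphism P -> P}.
Hypotheses (act1 : act 1%g =1 id)
  (actM : forall g h, act (g * h)%g =1 act g \o act h)
  (act_homog : forall g d p, p \is d.-homog -> act g p \is d.-homog).

Local Notation inv := (invariant act).

Lemma act_polyC g c : act g c%:MP = c%:MP.
Proof. by rewrite -alg_mpolyC linearZ /= rmorph1. Qed.

Lemma homog_coef_prod_XsubC (s : seq P) j :
  (forall x, x \in s -> x \is 1.-homog) -> (j <= size s)%N ->
  (\prod_(x <- s) ('X - x%:P))`_j \is (size s - j)%N.-homog.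
Proof.
elim: s j => [|x s IHs] j hs.
  by rewrite leqn0 => /eqP->; rewrite big_nil coef1 eqxx dhomog1.
have {}IHs i := IHs i (fun y (ys : y \in s) => hs y (mem_behead (s := x :: s) ys)).
move=> js; rewrite big_cons mulrBl coefB coefXM coefCM.
have xh : x \is 1.-homog by apply: hs; rewrite mem_head.
apply: rpredB.
  case: j js => [|j] js /=; first exact: dhomog0.
  by rewrite subSS; apply: IHs.
case: (leqP j (size s)) => jles.
  by have := dhomogM xh (IHs j jles); rewrite add1n -subSn.
by rewrite nth_default ?mulr0 ?dhomog0 // size_prod_XsubC.
Qed.

(** [x] is a root of the monic product of the X - g x, whose coefficients are symmetric in the orbit
    and hence invariant. Their degrees are recorded because generation must respect the grading. *)
Lemma integral_relation (x : P) : x \is 1.-homog ->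
  exists c : nat -> P, [/\ forall j, inv (c j),
    forall j, (j <= #|G|)%N -> c j \is (#|G| - j)%N.-homog &
    x ^+ #|G| = \sum_(j < #|G|) c j * x ^+ j].
Proof.
move=> xh; pose s := [seq act g x | g <- index_enum G].
have szs : size s = #|G| by rewrite size_map cardT enumT [index_enum _]unlock.
pose p := \prod_(y <- s) ('X - y%:P).
have szp : size p = #|G|.+1 by rewrite size_prod_XsubC szs.
have px : p.[x] = 0.
  apply/eqP; rewrite -[_ == 0]/(root p x) root_prod_XsubC.
  by apply/mapP; exists 1%g; rewrite ?mem_index_enum ?act1.
exists (fun j => - p`_j); split=> [j g | j jG |].
- suff pg : map_poly (act g) p = p by rewrite rmorphN -{2}pg coef_map.
  rewrite rmorph_prod /p !big_map [RHS](reindex_inj (mulgI g)).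
  by apply: eq_bigr => h _; rewrite rmorphB /= map_polyX map_polyC /= actM.
- by rewrite rpredN -szs; apply: homog_coef_prod_XsubC => [y /mapP[g _ ->]|];
    [apply: act_homog | rewrite szs].
move: px; rewrite horner_coef szp big_ord_recr /=.
have -> : p`_#|G| = 1.
  by have /monicP := monic_prod_XsubC s predT id; rewrite /lead_coef szp.
rewrite mul1r addrC => /eqP; rewrite addr_eq0 => /eqP->.
by rewrite -sumrN; apply: eq_bigr => j _; rewrite mulNr.
Qed.

(** By pigeonhole a monomial of degree at least [B] has an exponent at least [#|G|], which
    [integral_relation] lowers. *)
Let B := (n * #|G|).+1.

(** Every summand has degree exactly [d]; the alternative [q m = 0] covers the generators that do
    not occur, in particular those of degree above [d]. *)
Definition generated (d : nat) (f : P) : Prop :=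
  exists q : 'X_{1..n < B} -> P, [/\ forall m, inv (q m),
    forall m, exists2 e, q m = 0 \/ (mdeg m + e = d)%N & q m \is e.-homog &
    f = \sum_(m : 'X_{1..n < B}) 'X_[m] * q m].

Lemma generated0 d : generated d 0.
Proof.
exists (fun=> 0); split=> [m g|m|]; first by rewrite rmorph0.
  by exists 0%N; [left | apply: dhomog0].
by rewrite big1 // => m _; rewrite mulr0.
Qed.

Lemma generatedD d f g : generated d f -> generated d g -> generated d (f + g).
Proof.
move=> [q [qi qh ->]] [r [ri rh ->]]; exists (fun m => q m + r m); split=> [m h|m|].
- by rewrite rmorphD qi ri.
- have [e [q0|eq] he] := qh m; have [e' [r0|eq'] he'] := rh m.
  + by exists 0%N; [left; rewrite q0 r0 addr0 | rewrite q0 r0 addr0 dhomog0].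
  + by exists e'; [right | rewrite q0 add0r].
  + by exists e; [right | rewrite r0 addr0].
  exists e; first by right.
  apply: rpredD => //; suff <- : e' = e by [].
  by move: eq'; rewrite -eq => /addnI.
by rewrite -big_split; apply: eq_bigr => m _; rewrite mulrDr.
Qed.

Lemma generatedM d e f r : generated d f -> inv r -> r \is e.-homog ->
  generated (d + e) (f * r).
Proof.
move=> [q [qi qh ->]] ri rh; exists (fun m => q m * r); split=> [m h|m|].
- by rewrite rmorphM qi ri.
- have [e' [q0|eq] he'] := qh m.
    by exists 0%N; [left; rewrite q0 mul0r | rewrite q0 mul0r dhomog0].
  by exists (e' + e)%N; [right; rewrite addnA eq | apply: dhomogM].
by rewrite mulr_suml; apply: eq_bigr => m _; rewrite mulrA.
Qed.

Lemma generated_sum d (I : Type) (s : seq I) (F : I -> P) :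
  (forall i, generated d (F i)) -> generated d (\sum_(i <- s) F i).
Proof.
move=> H; elim/big_rec: _ => [|i x _]; first exact: generated0.
exact: generatedD.
Qed.

Lemma generatedX m : generated (mdeg m) 'X_[m].
Proof.
have [d] := ubnP (mdeg m); elim: d => // d IHd in m *; rewrite ltnS => md.
have [mB|mB] := ltnP (mdeg m) B.
  exists (fun m' => if m' == BMultinom mB then 1 else 0); split=> [m' g|m'|].
  - by case: eqP; rewrite ?rmorph0 ?rmorph1.
  - exists 0%N; first by case: eqP => [->|_]; [right; rewrite addn0 | left].
    by case: ifP; rewrite ?dhomog0 ?dhomog1.
  rewrite (bigD1 (BMultinom mB)) //= eqxx mulr1 big1 => [|m'].
    exact/esym/addr0.
  by case: eqP; rewrite // mulr0.
have /existsP[i iN] : [exists i : 'I_n, #|G| <= m i]%N.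
  apply: contraLR mB; rewrite negb_exists => /forallP H.
  rewrite -ltnNge ltnS mdegE; apply: (@leq_trans (\sum_(i < n) #|G|)).
    by apply: leq_sum => i _; rewrite ltnW // ltnNge.
  by rewrite sum_nat_const card_ord.
have Xi : ('X_i : P) \is 1.-homog by rewrite dhomogX /= mdeg1.
have [c [ci ch cE]] := integral_relation Xi.
pose m' := (m - U_(i) *+ #|G|)%MM.
have mE : m = (m' + U_(i) *+ #|G|)%MM.
  apply/mnmP => j; rewrite mnmDE mnmBE mulmnE mnm1E;
    case: eqP => [<-|_]; last by rewrite mul0n subn0 addn0.
  by rewrite mul1n subnK.
have G0 : (0 < #|G|)%N by apply/card_gt0P; exists 1%g.
rewrite mE mpolyXD -mpolyXn cE mulr_sumr; apply: generated_sum => j.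
have jG : (j < #|G|)%N := ltn_ord j.
rewrite mulrCA mulrC mpolyXn -mpolyXD mdegD mdegMn mdeg1 mul1n.
have -> : (mdeg m' + #|G| = mdeg (m' + U_(i) *+ j) + (#|G| - j))%N.
  by rewrite mdegD mdegMn mdeg1 mul1n -addnA subnKC // ltnW.
apply: generatedM => //; last by apply: ch; rewrite ltnW.
apply: IHd; apply: leq_trans md; rewrite [in X in (_ < X)%N]mE !mdegD !mdegMn mdeg1.
by rewrite !mul1n ltn_add2l.
Qed.

Theorem homog_generated d f : f \is d.-homog -> generated d f.
Proof.
move=> fh; rewrite [f]mpolyE big_seq; elim/big_rec: _ => [|m x mf].
  exact: generated0.
apply: generatedD => //; have md : mdeg m = d := dhomogP _ _ _ fh m mf.
rewrite -md -[X in generated X]addn0.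
rewrite -mul_mpolyC mulrC; apply: generatedM; first exact: generatedX.
  by move=> g; apply: act_polyC.
by rewrite -alg_mpolyC; apply/rpredZ/dhomog1.
Qed.

End FiniteGeneration.

(** * Homogeneous components of polynomials *)

Section HomogeneousParts.

Variables (R : nzRingType) (n : nat).
Implicit Types p q : {mpoly R[n]}.

Lemma homog_ind (Q : {mpoly R[n]} -> Prop) :
  (forall p q, Q p -> Q q -> Q (p + q)) ->
  (forall d p, p \is d.-homog -> Q p) -> forall p, Q p.
Proof.
move=> QD Qh p; rewrite (pihomog_partitionE (leqnn (mmeasure mdeg p))).
elim/big_ind: _ => [|//|i _]; first exact/(Qh 0%N)/dhomog0.
exact/Qh/pihomogP.
Qed.

Lemma msize_homog d p : p \is d.-homog -> (msize p <= d.+1)%N.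
Proof.
move=> /dhomogP hp; rewrite msizeE; apply/bigmax_leqP_seq => m mp _.
by rewrite ltnS (hp m mp).
Qed.

Lemma msize_sum_le (I : Type) (r : seq I) (F : I -> {mpoly R[n]}) d :
  (forall i, (msize (F i) <= d)%N) -> (msize (\sum_(i <- r) F i) <= d)%N.
Proof.
move=> H; elim/big_rec: _ => [|i x _ xd]; first by rewrite msize0.
by apply: leq_trans (msizeD_le _ _) _; rewrite geq_max H.
Qed.

Lemma msize_sub_pihomog d p : (msize p <= d.+1)%N ->
  (msize (p - pihomog mdeg d p) <= d)%N.
Proof.
move=> pd; rewrite {1}(pihomog_partitionE pd) big_ord_recr /= addrK.
apply: msize_sum_le => i; apply: leq_trans (ltn_ord i).
exact/msize_homog/pihomogP.
Qed.

Lemma pihomogM c j p h : h \is j.-homog ->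
  pihomog mdeg (c + j) (p * h) = pihomog mdeg c p * h.
Proof.
move=> hj; elim/homog_ind: p => [p q Hp Hq|d p pd].
  by rewrite mulrDl !raddfD /= Hp Hq mulrDl.
have [dE|dc] := eqVneq d c; first by rewrite -dE !pihomog_dE //; apply: dhomogM.
rewrite (pihomog_ne0 dc pd) mul0r; apply: pihomog_ne0 (dhomogM pd hj).
by rewrite eqn_add2r.
Qed.

Lemma pihomog_msize d p : (msize p <= d)%N -> pihomog mdeg d p = 0.
Proof.
move=> pd; rewrite (pihomog_partitionE pd) raddf_sum /= big1 // => i _.
by apply: pihomog_ne0 (pihomogP mdeg i p); rewrite neq_ltn ltn_ord.
Qed.

Lemma pihomogM_lt m j p h : (m < j)%N -> h \is j.-homog ->
  pihomog mdeg m (p * h) = 0.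
Proof.
move=> mj hj; elim/homog_ind: p => [p q Hp Hq|d p pd].
  by rewrite mulrDl raddfD /= Hp Hq addr0.
by apply: pihomog_ne0 (dhomogM pd hj); lia.
Qed.

End HomogeneousParts.

Lemma additive_on_homog (R : nzRingType) (n : nat) (A : zmodType)
    (f g : {mpoly R[n]} -> A) :
  {morph f : x y / x + y} -> {morph g : x y / x + y} ->
  (forall d p, p \is d.-homog -> f p = g p) -> f =1 g.
Proof.
by move=> fD gD fg; elim/homog_ind=> [p q fgp fgq|]; rewrite ?fD ?gD ?fgp ?fgq.
Qed.

(** * Filtered quantizations of a skew group ring *)

Section Quantization.

Variables (k : idomainType) (n : nat) (G : finGroupType).
Local Notation P := {mpoly k[n]}.
Variable act : G -> {lrmorphism P -> P}.

(* [T] lifts symbols to the filtered ring [H], whose associated graded ring is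
   the skew group ring of [P] with [G]; [F d] consists of the elements of degree
   less than [d]. *)
Record quantization (H : pzRingType) (iota : G -> H) (T : {additive P -> H})
    (F : nat -> H -> Prop) : Prop := Quantization {
  q_iota1 : iota 1%g = 1;
  q_iotaM : forall g h, iota (g * h)%g = iota g * iota h;
  q_F0 : forall y, F 0%N y -> y = 0;
  q_Fz : forall d, F d 0;
  q_FB : forall d x y, F d x -> F d y -> F d (x - y);
  q_FS : forall d x, F d x -> F d.+1 x;
  q_Fex : forall x, exists d, F d x;
  q_FM : forall i j x y, F i.+1 x -> F j.+1 y -> F (i + j).+1 (x * y);
  q_Fg : forall g, F 1%N (iota g);
  q_FT : forall d f, f \is d.-homog -> F d.+1 (T f);
  q_TM : forall i j f g, f \is i.-homog -> g \is j.-homog ->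
    F (i + j)%N (T f * T g - T (f * g));
  q_gT : forall g d f, f \is d.-homog ->
    F d (iota g * T f - T (act g f) * iota g);
  q_lead : forall d y, F d.+1 y -> exists2 f : G -> P,
    forall g, f g \is d.-homog & F d (y - \sum_g T (f g) * iota g);
  q_free : forall d (f : G -> P), (forall g, f g \is d.-homog) ->
    F d (\sum_g T (f g) * iota g) -> forall g, f g = 0
}.

Hypotheses (act1 : act 1%g =1 id)
  (actM : forall g h, act (g * h)%g =1 act g \o act h)
  (act_homog : forall g d p, p \is d.-homog -> act g p \is d.-homog).

Section Basics.

Variables (H : pzRingType) (iota : G -> H) (T : {additive P -> H})
  (F : nat -> H -> Prop) (Q : quantization iota T F).

Lemma q_FN d x : F d x -> F d (- x).
Proof. by move=> Fx; rewrite -sub0r; apply: (q_FB Q) => //; apply: (q_Fz Q). Qed.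

Lemma q_FD d x y : F d x -> F d y -> F d (x + y).
Proof. by move=> Fx Fy; rewrite -[y]opprK; apply: (q_FB Q) => //; apply: q_FN. Qed.

Lemma q_Fsum d (I : Type) (r : seq I) (E : I -> H) :
  (forall i, F d (E i)) -> F d (\sum_(i <- r) E i).
Proof.
by move=> FE; elim/big_rec: _ => [|i x _]; [apply: (q_Fz Q) | apply: q_FD].
Qed.

Lemma q_Fle i j x : F i x -> (i <= j)%N -> F j x.
Proof.
move=> Fx /subnK<-; elim: (j - i)%N => [|m IHm]; rewrite ?add0n // addSn.
exact: (q_FS Q).
Qed.

Lemma q_FMr i j x y : F i x -> F j.+1 y -> F (i + j)%N (x * y).
Proof.
case: i => [/(q_F0 Q)-> _|i]; first by rewrite mul0r; apply: (q_Fz Q).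
exact: (q_FM Q).
Qed.

Lemma q_FMl i j x y : F i.+1 x -> F j y -> F (i + j)%N (x * y).
Proof.
case: j => [_ /(q_F0 Q)->|j]; first by rewrite mulr0; apply: (q_Fz Q).
rewrite addnS; exact: (q_FM Q).
Qed.

Lemma q_FM1r i x y : F i x -> F 1 y -> F i (x * y).
Proof. by move=> Fx Fy; have := q_FMr Fx Fy; rewrite addn0. Qed.

Lemma q_FM1l i x y : F 1 x -> F i y -> F i (x * y).
Proof. exact: (@q_FMl 0). Qed.

Lemma q_Ftrans d x y z : F d (x - y) -> F d (y - z) -> F d (x - z).
Proof. by move=> xy yz; have := q_FD xy yz; rewrite addrA subrK. Qed.

Lemma q_Fsym d x y : F d (x - y) -> F d (y - x).
Proof. by move=> /q_FN; rewrite opprB. Qed.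

Lemma q_FTsize d f : (msize f <= d)%N -> F d (T f).
Proof.
move=> fd; rewrite (pihomog_partitionE fd) raddf_sum; apply: q_Fsum => i.
by apply: q_Fle (ltn_ord i); apply/(q_FT Q)/pihomogP.
Qed.

Lemma iotaV_act g f : act g (act g^-1%g f) = f.
Proof. by rewrite -[LHS]/((_ \o _) f) -actM mulgV act1. Qed.

Lemma iota_actV g f : act g^-1%g (act g f) = f.
Proof. by rewrite -[LHS]/((_ \o _) f) -actM mulVg act1. Qed.

End Basics.

(** In the opposite ring the group embeds through inverses. Exchanging polynomials and group
    elements costs only terms of lower degree, so a leading term with coefficients [f g] becomes one
    with coefficients [act g (f g^-1%g)]. *)
Lemma quantization_op (H : pzRingType) (iota : G -> H) (T : {additive P -> H})
    (F : nat -> H -> Prop) : quantization iota T F ->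
  @quantization H^c (fun g => iota g^-1%g) T F.
Proof.
move=> Q; have lead d (f : G -> P) : (forall g, f g \is d.-homog) ->
    F d (\sum_g T (f g) * iota g -
         \sum_g iota g^-1%g * T (act g (f g^-1%g))).
  move=> fd; rewrite (reindex_inj (@invg_inj G)) -sumrB; apply: (q_Fsum Q) => g.
  rewrite -[X in T X * _](@iota_actV g) //; apply: (q_Fsym Q).
  by apply: (q_gT Q); apply: act_homog.
split.
- by rewrite invg1 (q_iota1 Q).
- by move=> g h; rewrite invMg (q_iotaM Q).
- exact: (q_F0 Q).
- exact: (q_Fz Q).
- exact: (q_FB Q).
- exact: (q_FS Q).
- exact: (q_Fex Q).
- by move=> i j x y Fx Fy; rewrite addnC; apply: (q_FM Q).
- by move=> g; apply: (q_Fg Q).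
- exact: (q_FT Q).
- by move=> i j f g fi gj; rewrite addnC mulrC; apply: (q_TM Q).
- move=> g d f fd; apply: (q_Fsym Q); rewrite -[X in _ - T X * _](iota_actV g).
  by apply: (q_gT Q); apply: act_homog.
- move=> d y /(q_lead Q)[f fd Ff]; exists (fun g => act g (f g^-1%g)).
    by move=> g; apply: act_homog.
  exact: (q_Ftrans Q) Ff (lead _ _ fd).
move=> d f fd Ff g.
have f'd h : act h (f h^-1%g) \is d.-homog by apply: act_homog.
suff Fh : F d (\sum_h T (act h (f h^-1%g)) * iota h).
  have := q_free Q f'd Fh g^-1%g; rewrite invgK => /(congr1 (act g)).
  by rewrite iotaV_act rmorph0.
have := lead d _ f'd; under [X in _ - X]eq_bigr => h _ do rewrite invgK iotaV_act.
by move=> /(q_FD Q)/(_ Ff); rewrite subrK.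
Qed.

End Quantization.

(** * The double centralizer property of a quantization *)

Section DoubleCentralizer.

Variables (k : idomainType) (n : nat) (G : finGroupType).
Local Notation P := {mpoly k[n]}.
Variable act : G -> {lrmorphism P -> P}.
Hypotheses (act1 : act 1%g =1 id)
  (actM : forall g h, act (g * h)%g =1 act g \o act h)
  (act_homog : forall g d p, p \is d.-homog -> act g p \is d.-homog)
  (act_reg : forall g : G, g != 1%g ->
     exists v w, coprime_pair (act g v - v) (act g w - w)).
Variables (H : pzRingType) (iota : G -> H) (T : {additive P -> H})
  (F : nat -> H -> Prop) (Q : quantization act iota T F).
Variable s : H.
Hypotheses (sG : s *+ #|G| = 1) (s_central : forall x, s * x = x * s)
  (Fs : F 1%N s).

(** [H] is only a ring here, so 1 / |G| is given as a central element [s] of filtration level 1. *)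
Let e := s * \sum_g iota g.

Local Notation inv := (invariant act).
Local Notation pi := (pihomog mdeg).

Lemma sym_iotal g : iota g * e = e.
Proof.
rewrite /e mulrA -s_central -mulrA; congr (_ * _); rewrite mulr_sumr.
by rewrite [RHS](reindex_inj (mulgI g)); apply: eq_bigr => h _; rewrite (q_iotaM Q).
Qed.

Lemma symMn : e *+ #|G| = \sum_g iota g.
Proof. by rewrite /e -mulrnAl sG mul1r. Qed.

Lemma sym_idem : e * e = e.
Proof.
rewrite {1}/e -mulrA mulr_suml; under eq_bigr => g _ do rewrite sym_iotal.
by rewrite sumr_const -mulrnAr /= mulrnAr -mulrnAl sG mul1r.
Qed.

Lemma sym_idemr x : x * e * e = x * e.
Proof. by rewrite -mulrA sym_idem. Qed.

Lemma q_Fe : F 1%N e.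
Proof.
by apply: (q_FM1r Q) => //; apply: (q_Fsum Q) => g; apply: (q_Fg Q).
Qed.

(** On symbols, [H] acts on He through the action of the skew group ring on [P], because [e] absorbs
    [iota g]. *)
Lemma symbol_mul c j (a : G -> P) f : (forall g, a g \is c.-homog) ->
  f \is j.-homog ->
  F (c + j)%N ((\sum_g T (a g) * iota g) * T f * e - T (\sum_g a g * act g f) * e).
Proof.
move=> ah fh; rewrite -mulrBl.
have -> : ((\sum_g T (a g) * iota g) * T f - T (\sum_g a g * act g f)) * e =
    \sum_g (T (a g) * (iota g * T f - T (act g f) * iota g) * e +
      (T (a g) * T (act g f) - T (a g * act g f)) * e).
  rewrite raddf_sum mulr_suml -sumrB mulr_suml; apply: eq_bigr => g _.
  rewrite mulrBr !mulrBl -!mulrA sym_iotal.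
  by rewrite addrA subrK.
apply: (q_Fsum Q) => g; apply: (q_FD Q); apply: (q_FM1r Q) q_Fe.
  by apply: (q_FMl Q); [apply: (q_FT Q) | apply: (q_gT Q)].
by apply: (q_TM Q) => //; apply: act_homog.
Qed.

(** On symbols, eHe acts on the right of He by multiplication by invariants: for invariant [q], the
    elements [e * T q * e] and [T q * e] agree up to lower degree. *)
Lemma symbol_mul_inv i j f q : f \is i.-homog -> q \is j.-homog -> inv q ->
  F (i + j)%N (T (f * q) * e - T f * e * T q * e).
Proof.
move=> fi qj qI; apply: (q_Ftrans Q (y := T f * T q * e)).
  by rewrite -mulrBl; apply: (q_FM1r Q) q_Fe; apply: (q_Fsym Q); apply: (q_TM Q).
rewrite -mulrBl -[T f * e * _]mulrA -mulrBr -mulrA.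
apply: (q_FMl Q); first exact: (q_FT Q).
have -> : (T q - e * T q) * e =
    - (s * \sum_g (iota g * T q - T (act g q) * iota g)) * e.
  rewrite sumrB mulrBr opprB !mulrBl -[s * _ * e in RHS]mulrA; congr (_ - _).
    rewrite mulr_suml; under eq_bigr => g _ do rewrite qI -mulrA sym_iotal.
    by rewrite sumr_const mulrnAr -mulrnAl sG mul1r.
  by rewrite /e -mulr_suml !mulrA.
apply: (q_FM1r Q) q_Fe; apply: (q_FN Q); apply: (q_FM1l Q) => //.
by apply: (q_Fsum Q) => g; apply: (q_gT Q).
Qed.

Lemma sym_lead d x : F d.+1 x -> exists2 f, f \is d.-homog & F d (x * e - T f * e).
Proof.
move=> /(q_lead Q)[f fd Ff]; exists (\sum_g f g).
  by apply: rpred_sum => g _; apply: fd.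
rewrite -mulrBl.
have -> : (x - T (\sum_g f g)) * e = (x - \sum_g T (f g) * iota g) * e.
  rewrite !mulrBl raddf_sum !mulr_suml; congr (_ - _).
  by apply: eq_bigr => g _; rewrite -mulrA sym_iotal.
exact: (q_FM1r Q) q_Fe.
Qed.

Lemma sym_free d f : f \is d.-homog -> F d (T f * e) -> f = 0.
Proof.
move=> fd Ff; apply: (q_free Q (d := d) (f := fun=> f) _ _ 1%g) => //.
by rewrite -mulr_sumr -symMn mulrnAr -sumr_const; apply: (q_Fsum Q).
Qed.

Lemma sym_free_msize d f : F d (T f * e) -> (msize f <= d)%N.
Proof.
(* [m] is a bound for [msize f], detached from it so that it can be lowered one homogeneous
   component at a time. *)
move=> Ff; have [m fm] := ex_intro (fun m => msize f <= m)%N _ (leqnn _).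
elim: m fm => [|m IHm] fm; first exact: leq_trans fm _.
have [dm|dm] := leqP m.+1 d; first exact: leq_trans dm.
have fm' := msize_sub_pihomog fm; apply: IHm.
suff f0 : pi m f = 0 by move: fm'; rewrite f0 subr0.
apply: (sym_free (pihomogP _ _ _)).
rewrite -[pi m f](subKr f) raddfB mulrBl; apply: (q_FB Q).
  exact: (q_Fle Q) Ff _.
by apply: (q_FM1r Q) q_Fe; apply: (q_FTsize Q).
Qed.

Lemma sym_coord_ex x : exists f, x * e = T f * e.
Proof.
have [d] := q_Fex Q x; elim: d x => [|d IHd] x Fx.
  by exists 0; rewrite (q_F0 Q Fx) raddf0.
have [f fd /IHd[g Hg]] := sym_lead Fx; exists (f + g).
move: Hg; rewrite mulrBl !sym_idemr raddfD mulrDl => <-.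
by rewrite addrC subrK.
Qed.

Definition sym_coord x : P := sval (cid (sym_coord_ex x)).

Lemma sym_coordE x : x * e = T (sym_coord x) * e.
Proof. exact: svalP (cid (sym_coord_ex x)). Qed.

Lemma sym_coord_inj f g : T f * e = T g * e -> f = g.
Proof.
move=> /eqP; rewrite -subr_eq0 -mulrBl -raddfB => /eqP E; apply/eqP.
rewrite -subr_eq0 -msize_poly_eq0 -leqn0 (@sym_free_msize 0) // E; exact: (q_Fz Q).
Qed.

Lemma sym_coordD : {morph sym_coord : x y / x + y}.
Proof.
move=> x y; apply: sym_coord_inj.
by rewrite -sym_coordE raddfD !mulrDl -!sym_coordE.
Qed.

Lemma sym_coord_msize d x : F d x -> (msize (sym_coord x) <= d)%N.
Proof.
move=> Fx; apply: sym_free_msize.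
by rewrite -sym_coordE; apply: (q_FM1r Q) q_Fe.
Qed.

(** If left multiplication by [h] kills He, the leading coefficients of [h] act as zero on [P] and
    vanish by [act_independent]; hence the degree of [h] can always be lowered. *)
Lemma sym_faithful h : (forall x, h * x * e = 0) -> h = 0.
Proof.
move=> h0; have [d] := q_Fex Q h; elim: d => [|d IHd]; first exact: (q_F0 Q).
move=> Fh; apply: IHd; have [a ad Fa] := q_lead Q Fh.
suff a0 g : a g = 0.
  by move: Fa; rewrite big1 ?subr0 // => g _; rewrite a0 raddf0 mul0r.
apply: (act_independent act1 actM act_reg) => {g}.
apply: additive_on_homog => [x y|x y|j f fj]; rewrite ?addr0 //.
  by rewrite -big_split; apply: eq_bigr => g _; rewrite rmorphD mulrDr.
apply: (@sym_free (d + j)); first by apply/rpred_sum => g _; apply/dhomogM/act_homog.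
have E1 : F (d + j)%N (h * T f * e - (\sum_g T (a g) * iota g) * T f * e).
  rewrite -!mulrBl; apply: (q_FM1r Q) q_Fe.
  exact: (q_FMr Q) Fa (q_FT Q fj).
have := q_Ftrans Q E1 (symbol_mul ad fj).
by rewrite h0 sub0r => /(q_FN Q); rewrite opprK.
Qed.

Lemma act_pihomog g d p : act g (pi d p) = pi d (act g p).
Proof.
elim/homog_ind: p => [p q Hp Hq|j p pj]; first by rewrite !raddfD /= Hp Hq.
have [jd|jd] := eqVneq j d; first by rewrite -jd !pihomog_dE ?act_homog.
by rewrite !(pihomog_ne0 jd) ?rmorph0 ?act_homog.
Qed.

Section Endomorphism.

Variable psi : H -> H.

(* The [eHe]-linear maps out of [He]; only the values of [psi] on [He] matter. *)
Definition sym_linear (psi : H -> H) : Prop := {morph psi : x y / x + y} /\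
  forall x z, psi (x * e * z * e) = psi (x * e) * e * z * e.

(* [psi] raises degrees by at most [b - a], which may be negative. *)
Definition degree_bound (psi : H -> H) (a b : nat) : Prop :=
  forall j x, F j x -> F (j + b - a)%N (psi (x * e)).

Hypothesis psiL : sym_linear psi.

Let psiD : {morph psi : x y / x + y} := psiL.1.

Lemma sym_linear0 : psi 0 = 0.
Proof. by apply: (addrI (psi 0)); rewrite -psiD !addr0. Qed.

Lemma sym_linearB : {morph psi : x y / x - y}.
Proof.
move=> x y; apply: (addIr (psi y)); rewrite -psiD !subrK.
by [].
Qed.

Lemma sym_linear_sum (I : Type) (r : seq I) (E : I -> H) :
  psi (\sum_(i <- r) E i) = \sum_(i <- r) psi (E i).
Proof. by apply: big_morph => //; apply: sym_linear0. Qed.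

(** The case [z = 1] of linearity: the values of [psi] on He lie in He. *)
Lemma sym_linear_r x : psi (x * e) * e = psi (x * e).
Proof. by have := psiL.2 x 1; rewrite !mulr1 !sym_idemr. Qed.

(** [C] bounds the degrees of [psi] on the finitely many monomial generators. Generation is known
    only for symbols, so the remainder [y], whose product with [e] has lower degree, is left to the
    induction. *)
Lemma sym_linear_bounded : exists C, degree_bound psi 0 C.
Proof.
pose B := (n * #|G|).+1.
have [C HC] : exists C, forall m : 'X_{1..n < B}, F C (psi (T 'X_[m] * e)).
  have /choice[c Hc] m : exists c, F c (psi (T 'X_[(m : 'X_{1..n < B})] * e)).
    exact: (q_Fex Q).
  exists (\max_m c m) => m; apply: (q_Fle Q) (Hc m) _.
  exact: leq_bigmax.
exists C; suff H1 d x : F d x -> F (d + C)%N (psi (x * e)).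
  by move=> d x /H1; rewrite subn0.
elim: d x => [|d IHd] x Fx.
  by rewrite (q_F0 Q Fx) mul0r sym_linear0; apply: (q_Fz Q).
have [f fd Ff] := sym_lead Fx.
have [q [qi qh fE]] := homog_generated act1 actM act_homog fd.
pose z m := T 'X_[(m : 'X_{1..n < B})] * e * T (q m) * e.
pose y := x - \sum_m z m.
have -> : psi (x * e) = psi (y * e) +
    \sum_m psi (T 'X_[(m : 'X_{1..n < B})] * e) * e * T (q m) * e.
  rewrite /y mulrBl sym_linearB mulr_suml -[LHS]addr0 -addrA; congr (_ + _).
  rewrite sym_linear_sum addrC -sumrB big1 // => m _.
  by rewrite /z sym_idemr psiL.2 subrr.
apply: (q_FD Q).
  rewrite -[y * e]sym_idemr addSn; apply: (q_FS Q); apply: IHd.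
  rewrite /y mulrBl; apply: (q_Ftrans Q (y := T f * e)) => //.
  rewrite fE raddf_sum !mulr_suml -sumrB; apply: (q_Fsum Q) => m.
  rewrite /z sym_idemr; have [j [q0|<-] qmh] := qh m.
    by rewrite q0 mulr0 raddf0 !(mulr0, mul0r) subr0; apply: (q_Fz Q).
  by apply: symbol_mul_inv => //; rewrite dhomogX.
apply: (q_Fsum Q) => m; apply: (q_FM1r Q) q_Fe; rewrite addnC sym_linear_r addnS.
apply: (q_FS Q); apply: (q_FMr Q) => //; have [j [q0|<-] qmh] := qh m.
  by rewrite q0 raddf0; apply: (q_Fz Q).
by apply: (q_Fle Q) (q_FT Q qmh) _; rewrite ltnS leq_addl.
Qed.

Section Peel.

Variables (a b : nat) (psib : degree_bound psi a b).

(** For [f] homogeneous of degree [j], the bound makes [j + b - a] the largest possible degree of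
    [psi (T f * e)], so this is its symbol. *)
Definition symbol_part j f : P := pi (j + b - a) (sym_coord (psi (T f * e))).

Lemma symbol_part_homog j f : symbol_part j f \is (j + b - a).-homog.
Proof. exact: pihomogP. Qed.

Lemma symbol_partD j : {morph symbol_part j : f g / f + g}.
Proof. by move=> f g; rewrite /symbol_part raddfD mulrDl psiD sym_coordD raddfD. Qed.

Lemma symbol_partE j f : f \is j.-homog ->
  F (j + b - a)%N (psi (T f * e) - T (symbol_part j f) * e).
Proof.
move=> fj; rewrite -{1}sym_linear_r sym_coordE -mulrBl -raddfB.
apply: (q_FM1r Q) q_Fe; apply: (q_FTsize Q).
have := sym_coord_msize (psib (q_FT Q fj)); rewrite /symbol_part.
have [ab|ab] := leqP a (j + b); first by rewrite addSn subSn //; apply: msize_sub_pihomog.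
rewrite (eqP (_ : j.+1 + b - a == 0)%N) ?leqn0; last by rewrite subn_eq0 addSn.
by rewrite msize_poly_eq0 => /eqP->; rewrite raddf0 subrr msize0.
Qed.

(** Here [j.+1 + b - a] truncates to 0, and only 0 has size at most 0. *)
Lemma symbol_part_lt j f : (j + b < a)%N -> f \is j.-homog -> symbol_part j f = 0.
Proof.
move=> ab fj; have := sym_coord_msize (psib (q_FT Q fj)); rewrite /symbol_part.
rewrite (eqP (_ : j.+1 + b - a == 0)%N) ?leqn0; last by rewrite subn_eq0 addSn.
by rewrite msize_poly_eq0 => /eqP->; rewrite raddf0.
Qed.

Lemma symbol_partM i j f q : f \is i.-homog -> q \is j.-homog -> inv q ->
  symbol_part (i + j) (f * q) = symbol_part i f * q.
Proof.
move=> fi qj qI; have fqh := dhomogM fi qj.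
have E1 : F (i + j + b - a)%N
    (psi (T f * e) * e * T q * e - T (symbol_part (i + j) (f * q)) * e).
  apply: (q_Ftrans Q) (symbol_partE fqh).
  rewrite -psiL.2; apply: (q_Fsym Q).
  have := psib (symbol_mul_inv fi qj qI).
  by rewrite mulrBl !sym_idemr sym_linearB.
(* Truncated subtraction is additive only if [a <= i + b]. Otherwise the bound forces
   [psi (T f * e) = 0], and the symbol of the product vanishes too. *)
have [ab|ab] := leqP a (i + b); last first.
  rewrite (symbol_part_lt ab fi) mul0r.
  have psi0 : psi (T f * e) = 0.
    apply: (q_F0 Q); have := psib (q_FT Q fi).
    by rewrite (eqP (_ : i.+1 + b - a == 0)%N) // subn_eq0 addSn.
  move: E1; rewrite psi0 !mul0r sub0r => /(q_FN Q); rewrite opprK.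
  exact/sym_free/symbol_part_homog.
have ijE : (i + j + b - a = (i + b - a) + j)%N by lia.
have sh := symbol_part_homog i f.
apply/eqP; rewrite -subr_eq0; apply/eqP; apply: (@sym_free (i + j + b - a)).
  by apply: rpredB; rewrite ?symbol_part_homog // ijE; apply: dhomogM.
rewrite raddfB mulrBl; apply: (q_Fsym Q); apply: (q_Ftrans Q) E1.
rewrite ijE; apply: (q_Ftrans Q (symbol_mul_inv sh qj qI)).
rewrite sym_linear_r -!mulrBl; apply: (q_FM1r Q) q_Fe.
apply: (q_FMr Q); last exact: (q_FT Q).
exact/(q_Fsym Q)/symbol_partE.
Qed.

Lemma symbol_part0 j : symbol_part j 0 = 0.
Proof. by apply: (addrI (symbol_part j 0)); rewrite -symbol_partD !addr0. Qed.

Definition symbol_map (f : P) : P := \sum_(j < msize f) symbol_part j (pi j f).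

Lemma symbol_mapwE N f : (msize f <= N)%N ->
  symbol_map f = \sum_(j < N) symbol_part j (pi j f).
Proof.
move=> fN; rewrite /symbol_map -!(big_mkord xpredT (fun j => symbol_part j (pi j f))).
rewrite (big_cat_nat (leq0n _) fN) //= [X in _ = _ + X]big_nat_cond.
rewrite [X in _ = _ + X]big1 ?addr0 // => j /andP[/andP[fj _] _].
by rewrite pihomog_msize ?symbol_part0.
Qed.

Lemma symbol_mapD : {morph symbol_map : f g / f + g}.
Proof.
move=> f g; pose N := maxn (msize f) (msize g).
rewrite !(@symbol_mapwE N) ?leq_maxl ?leq_maxr ?msizeD_le // -big_split.
by apply: eq_bigr => j _; rewrite raddfD symbol_partD.
Qed.

Lemma symbol_map_homog j f : f \is j.-homog -> symbol_map f = symbol_part j f.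
Proof.
move=> fj; rewrite (symbol_mapwE (msize_homog fj)) (bigD1 ord_max) //=.
rewrite pihomog_dE // big1 => [|i ij]; first exact: addr0.
rewrite (pihomog_ne0 _ fj) ?symbol_part0 //.
by apply: contraNneq ij => ji; apply/eqP/val_inj.
Qed.

Lemma symbol_mapM f q : inv q -> symbol_map (f * q) = symbol_map f * q.
Proof.
move=> qI; rewrite [q in LHS](pihomog_partitionE (leqnn (msize q))).
rewrite [q in RHS](pihomog_partitionE (leqnn (msize q))) !mulr_sumr.
have map_sum (E : 'I_(msize q) -> P) :
    symbol_map (\sum_i E i) = \sum_i symbol_map (E i).
  apply: big_morph; first exact: symbol_mapD.
  by rewrite /symbol_map msize0 big_ord0.
rewrite map_sum; apply: eq_bigr => d _.
(* The action preserves degrees, so the homogeneous components of an invariant are invariant. *)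
have qdI : inv (pi d q).
  by move=> g; rewrite -[RHS](congr1 (pi d) (qI g)); apply: act_pihomog.
have qd : pi d q \is d.-homog by apply: pihomogP.
move: (pi d q) qdI qd => {map_sum qI} r rI rd; move: f.
apply: additive_on_homog => [f g|f g|j f fj]; try by rewrite ?mulrDl !symbol_mapD ?mulrDl.
by rewrite (symbol_map_homog (dhomogM fj rd)) (symbol_map_homog fj) symbol_partM.
Qed.

(** [invariant_linear_act] applies to [symbol_map], which assembles the symbols of all degrees; only
    the components of degree [b - a] of its coefficients matter. If [b < a], an element of the skew
    group ring would have to lower degrees, which is impossible, so the symbol is zero and nothing
    is subtracted. *)
Lemma peel_symbol : exists2 h, (b < a)%N -> h = 0 &
  degree_bound (fun x => psi x - h * x) a.+1 b.
Proof.
have [c cE] := invariant_linear_act act1 actM act_reg symbol_mapD symbol_mapM.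
pose al g := if (a <= b)%N then pi (b - a) (c g) else 0.
pose h := \sum_g T (al g) * iota g; exists h.
  move=> ba; rewrite /h big1 // => g _.
  by rewrite /al leqNgt ba raddf0 mul0r.
have alE j f : f \is j.-homog -> symbol_part j f = \sum_g al g * act g f.
  move=> fj; have [ab|ba] := leqP a b.
    rewrite -(pihomog_dE (symbol_part_homog j f)) -symbol_map_homog // cE raddf_sum /=.
    apply: eq_bigr => g _; rewrite /al ab -(pihomogM _ _ (act_homog g fj)).
    by congr (pi _ _); lia.
  rewrite [RHS]big1 => [|g _]; last by rewrite /al leqNgt ba mul0r.
  have [jb|jb] := ltnP (j + b) a; first exact: symbol_part_lt.
  rewrite -(pihomog_dE (symbol_part_homog j f)) -symbol_map_homog // cE raddf_sum /=.
  by apply: big1 => g _; rewrite (@pihomogM_lt _ _ _ j) ?act_homog //; lia.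
have hb j x : F j x -> F (j + b - a)%N (h * (x * e)).
  move=> Fx; have [ab|ba] := leqP a b; last first.
    rewrite /h big1 ?mul0r; first exact: (q_Fz Q).
    by move=> g _; rewrite /al leqNgt ba raddf0 mul0r.
  have -> : (j + b - a = (b - a) + j)%N by lia.
  rewrite mulrA; apply: (q_FM1r Q) q_Fe; apply: (q_FMl Q) Fx.
  apply: (q_Fsum Q) => g; apply: (q_FM1r Q) (q_Fg Q g); apply: (q_FT Q).
  by rewrite /al ab; apply: pihomogP.
move=> [|j] x Fx.
  by rewrite (q_F0 Q Fx) mul0r sym_linear0 mulr0 subr0; apply: (q_Fz Q).
have [f fj Ff] := sym_lead Fx; rewrite addSn subSS.
(* [x * e] is [T f * e] plus [y * e]. On the first term [h] matches [psi] up to lower degree; on the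
   second, already of lower degree, the old bound is enough. *)
pose y := x - T f.
have -> : psi (x * e) - h * (x * e) =
    (psi (T f * e) - h * (T f * e)) + (psi (y * e * e) - h * (y * e * e)).
  rewrite sym_idemr /y mulrBl sym_linearB mulrBr addrACA -opprD.
  by rewrite [psi (T f * e) + _]addrC subrK [h * (T f * e) + _]addrC subrK.
have Fy : F j (y * e) by rewrite /y mulrBl.
apply: (q_FD Q); last by apply: (q_FB Q); [apply: psib | apply: hb].
apply: (q_Ftrans Q (symbol_partE fj)); rewrite (alE _ _ fj); apply: (q_Fsym Q).
have [ab|ba] := leqP a b.
  have -> : (j + b - a = (b - a) + j)%N by lia.
  rewrite mulrA; apply: symbol_mul fj => g.
  by rewrite /al ab; apply: pihomogP.
rewrite /h !big1 => [|g _|g _]; try by rewrite /al leqNgt ba ?raddf0 ?mul0r.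
by rewrite raddf0 !mul0r subrr; apply: (q_Fz Q).
Qed.

End Peel.
End Endomorphism.

Lemma sym_linear_sub psi h : sym_linear psi ->
  sym_linear (fun x => psi x - h * x).
Proof.
move=> [psiD psiE]; split=> [x y|x z]; first by rewrite psiD mulrDr opprD addrACA.
have he : h * (x * e) * e = h * (x * e) by rewrite -mulrA sym_idemr.
by rewrite psiE !mulrBl he !(mulrA h).
Qed.

Theorem sym_double_centralizer psi : sym_linear psi ->
  exists h, forall x, psi (x * e) = h * (x * e).
Proof.
move=> psiL; have [C psib] := sym_linear_bounded psiL.
(* After [C.+1] subtractions the degree of the map is negative, and from there on [peel_symbol]
   improves the bound with [h' = 0]. *)
have [h [hL hb]] : exists h, sym_linear (fun x => psi x - h * x) /\
    degree_bound (fun x => psi x - h * x) C.+1 C.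
  suff H1 a : exists h, degree_bound (fun x => psi x - h * x) a C.
    by have [h hb] := H1 C.+1; exists h; split=> //; apply: sym_linear_sub.
  elim: a => [|a [h hb]].
    by exists 0 => j x Fx; rewrite mul0r subr0; apply: psib.
  have [h' _ h'b] := peel_symbol (sym_linear_sub h psiL) hb.
  by exists (h + h') => j x /h'b; rewrite mulrDl opprD addrA.
exists h => x; apply/eqP; rewrite -subr_eq0; apply/eqP.
have {}hb a : degree_bound (fun x => psi x - h * x) (C.+1 + a) C.
  elim: a => [|a IHa]; first by rewrite addn0.
  have [h' h'0 h'b] := peel_symbol hL IHa; rewrite addnS.
  move=> j y /h'b; rewrite h'0 ?mul0r ?subr0 //.
  by rewrite ltnS leq_addr.
(* For [x] of level [j], the bound with [a = C.+1 + j] puts the value into level 0. *)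
have [j Fx] := q_Fex Q x; apply: (q_F0 Q); have := hb j j x Fx.
by rewrite (eqP (_ : j + C - (C.+1 + j) == 0)%N) // subn_eq0; lia.
Qed.

End DoubleCentralizer.

(** * The double centralizer property on the other side *)

Section OppositeDoubleCentralizer.

Variables (k : idomainType) (n : nat) (G : finGroupType).
Local Notation P := {mpoly k[n]}.
Variable act : G -> {lrmorphism P -> P}.
Hypotheses (act1 : act 1%g =1 id)
  (actM : forall g h, act (g * h)%g =1 act g \o act h)
  (act_homog : forall g d p, p \is d.-homog -> act g p \is d.-homog)
  (act_reg : forall g : G, g != 1%g ->
     exists v w, coprime_pair (act g v - v) (act g w - w)).
Variables (H : pzRingType) (iota : G -> H) (T : {additive P -> H})
  (F : nat -> H -> Prop) (Q : quantization act iota T F).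
Variable s : H.
Hypotheses (sG : s *+ #|G| = 1) (s_central : forall x, s * x = x * s)
  (Fs : F 1%N s).

Let e := s * \sum_g iota g.

Let eE : e = (s : H^c) * \sum_g (iota g^-1%g : H^c).
Proof.
by rewrite /e (reindex_inj (@invg_inj G)) s_central.
Qed.

Let Qop := quantization_op act1 actM act_homog Q.
Let s_central_op (x : H^c) : (s : H^c) * x = x * s := esym (s_central x).

Lemma sym_faithful_op h : (forall x, e * x * h = 0) -> h = 0.
Proof.
move=> h0; apply: (sym_faithful act1 actM act_homog act_reg Qop sG s_central_op Fs) => x.
by rewrite -eE -[RHS](h0 x) -mulrA.
Qed.

Theorem sym_double_centralizer_op (psi : H -> H) : {morph psi : x y / x + y} ->
  (forall x z, psi (e * z * e * x) = e * z * e * psi (e * x)) ->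
  exists h, forall x, psi (e * x) = e * x * h.
Proof.
move=> psiD psiE.
have E (x z : H) : psi (e * (z * (e * x))) = e * (z * (e * psi (e * x))).
  by rewrite !(mulrA z e) !(mulrA e (z * e)) (mulrA e z e); apply: psiE.
have psiL : sym_linear (H := H^c) (fun g => iota g^-1%g) s psi.
  by split=> // x z; rewrite -eE; apply: E.
have [h hE] := sym_double_centralizer act1 actM act_homog act_reg Qop sG s_central_op Fs psiL.
by exists h => x; have := hE x; rewrite -eE.
Qed.

End OppositeDoubleCentralizer.

(** * The PBW theorem *)

Section LeastVariable.

Variable n : nat.
Implicit Types (m : 'X_{1..n}) (i j l : 'I_n).

Lemma ord_gtF i l : (i < l)%N -> (l == i) = false.
Proof. by move=> il; rewrite -val_eqE /= gtn_eqF. Qed.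

(** The variable x_l comes no later than any variable of [m], so that putting it in front keeps the
    product ordered. *)
Definition below_supp l m : bool := [forall j : 'I_n, (j < l)%N ==> (m j == 0%N)].

Lemma below_suppP l m : reflect (forall j, (j < l)%N -> m j = 0%N) (below_supp l m).
Proof.
apply: (iffP forallP) => H j; last by apply/implyP => /H->.
by move=> jl; apply/eqP; have /implyP := H j; apply.
Qed.

Definition least_var m : option 'I_n := [pick l | (0 < m l)%N && below_supp l m].

Lemma least_var0 : least_var 0%MM = None.
Proof. by rewrite /least_var; case: pickP => // l; rewrite mnm0E. Qed.

Lemma least_varD l m : below_supp l m -> least_var (m + U_(l)) = Some l.
Proof.
move=> /below_suppP lm; rewrite /least_var; case: pickP => [i /andP[]|].
  rewrite mnmDE mnm1E; case: (ltngtP i l) => [il|li|/val_inj->//].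
    by rewrite lm // ord_gtF.
  by move=> _ /below_suppP/(_ l li); rewrite mnmDE mnm1E eqxx addn1.
move/(_ l); rewrite mnmDE mnm1E eqxx addn1 /= => /negP[].
apply/below_suppP => j jl; rewrite mnmDE mnm1E lm // ord_gtF //.
Qed.

(** Induction over ordered products by putting a first variable in front, which is the recursion
    followed by the operators below. *)
Lemma least_var_ind (Q : 'X_{1..n} -> Prop) : Q 0%MM ->
  (forall l m, below_supp l m -> Q m -> Q (m + U_(l))%MM) -> forall m, Q m.
Proof.
move=> Q0 QD m; have [d] := ubnP (mdeg m); elim: d m => // d IHd m md.
have [/existsP[i mi]|] := boolP [exists i, (0 < m i)%N]; last first.
  rewrite negb_exists => /forallP m0; suff -> : m = 0%MM by [].
  by apply/mnmP => i; rewrite mnm0E; have := m0 i; rewrite lt0n negbK => /eqP.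
pose l := [arg min_(j < i | (0 < m j)%N) (j : nat)].
have [ml lmin] : (0 < m l)%N /\ forall j, (0 < m j)%N -> (l <= j)%N.
  by rewrite /l; case: arg_minnP.
have mE : m = (m - U_(l) + U_(l))%MM.
  apply/mnmP => j; rewrite mnmDE mnmBE mnm1E; case: eqP => [<-|_].
    by rewrite subnK.
  by rewrite subn0 addn0.
rewrite mE; apply: QD.
  apply/below_suppP => j jl; rewrite mnmBE; have [//|/lmin] := posnP (m j).
    by move=> ->.
  by rewrite leqNgt jl.
by apply: IHd; move: md; rewrite {1}mE mdegD mdeg1 addn1.
Qed.

Lemma below_suppD l i m : below_supp l m -> (l <= i)%N -> below_supp l (m + U_(i)).
Proof.
move=> /below_suppP lm li; apply/below_suppP => j jl.
by rewrite mnmDE mnm1E lm // ord_gtF // (leq_trans jl).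
Qed.

Lemma below_supp_le i l m : below_supp l m -> (i <= l)%N -> below_supp i (m + U_(l)).
Proof.
move=> /below_suppP lm il; apply/below_suppP => j ji.
by rewrite mnmDE mnm1E lm ?ord_gtF // (leq_trans ji).
Qed.

End LeastVariable.

(** * Operators on P * G commuting with right multiplication by G *)

Section FilteredOperators.

Variables (k : comNzRingType) (n : nat) (G : finGroupType).
Local Notation P := {mpoly k[n]}.
Local Notation A := {ffun G -> P}.
Implicit Types (a b : A) (m : 'X_{1..n}).

Definition gelt (f : P) (g : G) : A := [ffun z => if z == g then f else 0].
(** Right multiplication by [h] in the skew group ring, with coefficients written to the left of
    group elements. *)
Definition gshift (a : A) (h : G) : A := [ffun z => a (z * h^-1)%g].
Definition gmono (m : 'X_{1..n}) : A := gelt 'X_[m] 1%g.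
Lemma gmono0 : gmono 0 = gelt 1 1%g.
Proof. by rewrite /gmono mpolyX0. Qed.

Definition degle (d : nat) (a : A) : Prop := forall g, (msize (a g) <= d)%N.

(** Left multiplications commute with right multiplication by the group, so the operators to be
    built are determined by their values on monomials, and [rext] rebuilds them from these. *)
Definition requiv (f : A -> A) : Prop :=
  (forall c a b, f (c *: a + b) = c *: f a + f b) /\
  (forall a h, f (gshift a h) = gshift (f a) h).

Lemma gshift1 a : gshift a 1%g = a.
Proof. by apply/ffunP => z; rewrite ffunE invg1 mulg1. Qed.

Lemma gshiftM a g h : gshift (gshift a g) h = gshift a (g * h)%g.
Proof. by apply/ffunP => z; rewrite !ffunE invMg mulgA. Qed.

Lemma gshift0 h : gshift 0 h = 0.
Proof. by apply/ffunP => z; rewrite !ffunE. Qed.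

Lemma gshiftD a b h : gshift (a + b) h = gshift a h + gshift b h.
Proof. by apply/ffunP => z; rewrite !ffunE. Qed.

Lemma gshiftZ c a h : gshift (c *: a) h = c *: gshift a h.
Proof. by apply/ffunP => z; rewrite !ffunE. Qed.

Lemma gshift_sum (I : Type) (r : seq I) (E : I -> A) h :
  gshift (\sum_(i <- r) E i) h = \sum_(i <- r) gshift (E i) h.
Proof.
by apply: (big_morph (fun a => gshift a h) (fun a b => gshiftD a b h) (gshift0 h)).
Qed.

Lemma gshift_gelt f g h : gshift (gelt f g) h = gelt f (g * h)%g.
Proof. by apply/ffunP => z; rewrite !ffunE (can2_eq (mulgKV h) (mulgK h)). Qed.

Lemma degle0 d : degle d 0.
Proof. by move=> g; rewrite ffunE msize0. Qed.

Lemma degle_le d e a : degle d a -> (d <= e)%N -> degle e a.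
Proof. by move=> ad de g; apply: leq_trans (ad g) de. Qed.

Lemma degleD d a b : degle d a -> degle d b -> degle d (a + b).
Proof.
move=> ad bd g; rewrite ffunE; apply: leq_trans (msizeD_le _ _) _.
by rewrite geq_max ad bd.
Qed.

Lemma degleZ d c a : degle d a -> degle d (c *: a).
Proof. by move=> ad g; rewrite ffunE; apply: leq_trans (msizeZ_le _ _) (ad g). Qed.

Lemma degleB d a b : degle d a -> degle d b -> degle d (a - b).
Proof. by move=> ad bd; apply: degleD => //; rewrite -scaleN1r; apply: degleZ. Qed.

Lemma degle_sum d (I : Type) (r : seq I) (E : I -> A) :
  (forall i, degle d (E i)) -> degle d (\sum_(i <- r) E i).
Proof. by move=> H; elim/big_rec: _ => [|i x _]; [apply: degle0 | apply: degleD]. Qed.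

Lemma degle_shift d a h : degle d a -> degle d (gshift a h).
Proof. by move=> ad g; rewrite ffunE. Qed.

Lemma degle_gmono m : degle (mdeg m).+1 (gmono m).
Proof. by move=> g; rewrite ffunE; case: ifP; rewrite ?msizeX ?msize0. Qed.

Lemma degle_eq0 a : degle 0 a -> a = 0.
Proof.
by move=> a0; apply/ffunP => g; rewrite ffunE; apply/eqP; rewrite -msize_poly_eq0 -leqn0.
Qed.

Lemma degle_ex a : exists d, degle d a.
Proof. by exists (\max_g msize (a g)) => g; apply: leq_bigmax. Qed.

Lemma gdecomp a : a = \sum_g \sum_(m <- msupp (a g)) (a g)@_m *: gshift (gmono m) g.
Proof.
apply/ffunP => z; rewrite sum_ffunE (bigD1 z) //= sum_ffunE [X in _ = _ + X]big1 ?addr0.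
  rewrite {1}[a z]mpolyE; apply: eq_bigr => m _.
  by rewrite /gmono gshift_gelt !ffunE mul1g eqxx.
move=> g gz; rewrite sum_ffunE big1 // => m _.
by rewrite /gmono gshift_gelt !ffunE mul1g eq_sym (negPf gz) scaler0.
Qed.

Lemma degle_ind d (Q : A -> Prop) : Q 0 ->
  (forall c a b, Q a -> Q b -> Q (c *: a + b)) ->
  (forall m h, (mdeg m < d)%N -> Q (gshift (gmono m) h)) ->
  forall a, degle d a -> Q a.
Proof.
move=> Q0 QP QX a ad; rewrite [a]gdecomp; elim/big_rec: _ => // g x _ Qx.
rewrite big_seq; elim/big_rec: _ => [|m y mg Qy]; rewrite ?add0r // -addrA.
apply: QP => //; apply: QX; exact: leq_trans (msize_mdeg_lt mg) (ad g).
Qed.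

Section Requiv.

Variables (f : A -> A) (fR : requiv f).

Lemma requivP c a b : f (c *: a + b) = c *: f a + f b. Proof. exact: fR.1. Qed.
Lemma requiv_shift a h : f (gshift a h) = gshift (f a) h. Proof. exact: fR.2. Qed.
Lemma requivD a b : f (a + b) = f a + f b.
Proof. by rewrite -[a]scale1r requivP !scale1r. Qed.
Lemma requiv0 : f 0 = 0.
Proof. by apply: (addrI (f 0)); rewrite -requivD !addr0. Qed.
Lemma requivZ c a : f (c *: a) = c *: f a.
Proof. by rewrite -[c *: a]addr0 requivP requiv0 addr0. Qed.
Lemma requivB a b : f (a - b) = f a - f b.
Proof. by rewrite -scaleN1r requivD requivZ scaleN1r. Qed.
Lemma requiv_sum (I : Type) (r : seq I) (E : I -> A) :
  f (\sum_(i <- r) E i) = \sum_(i <- r) f (E i).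
Proof. exact: (big_morph f requivD requiv0). Qed.

Lemma requiv_degle c d a : (forall m, degle (mdeg m + c).+1 (f (gmono m))) ->
  degle d a -> degle (d + c) (f a).
Proof.
move=> fX; apply: (degle_ind (Q := fun a => degle (d + c) (f a))) => [|e x y|m h md].
- by rewrite requiv0; apply: degle0.
- by move=> fx fy; rewrite requivP; apply/degleD/fy/degleZ.
by rewrite requiv_shift; apply: degle_shift; apply: degle_le (fX m) _; rewrite ltn_add2r.
Qed.

End Requiv.

Lemma requiv_eq d f f' : requiv f -> requiv f' ->
  (forall m, (mdeg m < d)%N -> f (gmono m) = f' (gmono m)) ->
  forall a, degle d a -> f a = f' a.
Proof.
move=> fR fR' ff'; apply: (degle_ind (Q := fun a => f a = f' a)) => [|c a b fa fb|m h md].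
- by rewrite !requiv0.
- by rewrite !requivP // fa fb.
by rewrite !requiv_shift // ff'.
Qed.

Lemma requiv_comp f f' : requiv f -> requiv f' -> requiv (fun a => f (f' a)).
Proof. by move=> fR fR'; split=> [c a b|a h]; rewrite ?requivP ?requiv_shift. Qed.

Lemma requiv_lincomb (I : Type) (r : seq I) (c : I -> k) (f : I -> A -> A) :
  (forall i, requiv (f i)) -> requiv (fun a => \sum_(i <- r) c i *: f i a).
Proof.
move=> fR; split=> [e a b|a h].
  rewrite scaler_sumr -big_split; apply: eq_bigr => i _ /=.
  by rewrite requivP // scalerDr !scalerA mulrC.
by rewrite gshift_sum; apply: eq_bigr => i _; rewrite requiv_shift // gshiftZ.
Qed.

Lemma requivBf f f' : requiv f -> requiv f' -> requiv (fun a => f a - f' a).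
Proof.
move=> fR fR'; split=> [c a b|a h].
  by rewrite (requivP fR) (requivP fR') scalerBr opprD addrACA.
rewrite (requiv_shift fR) (requiv_shift fR') gshiftD; congr (_ + _).
by rewrite -[in RHS]scaleN1r gshiftZ scaleN1r.
Qed.

Definition rext (B : 'X_{1..n} -> A) (a : A) : A :=
  \sum_g \sum_(m <- msupp (a g)) (a g)@_m *: gshift (B m) g.

Lemma rextwE d B a : degle d a -> rext B a =
  \sum_g \sum_(m : 'X_{1..n < d}) (a g)@_m *: gshift (B m) g.
Proof.
move=> ad; apply: eq_bigr => g _; pose I : subFinType _ := 'X_{1..n < d}.
rewrite (big_mksub I) ?msupp_uniq //=; last first.
  by move=> m /msize_mdeg_lt/leq_trans; apply.
rewrite big_rmcond //= => m /memN_msupp_eq0->; exact: scale0r.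
Qed.

Lemma rext_requiv B : requiv (rext B).
Proof.
split=> [c a b|a h].
  have [d ad] := degle_ex a; have [e be] := degle_ex b.
  have ad' : degle (maxn d e) a by apply: degle_le ad (leq_maxl _ _).
  have be' : degle (maxn d e) b by apply: degle_le be (leq_maxr _ _).
  rewrite !(@rextwE (maxn d e)) //; last by apply/degleD/be'/degleZ.
  rewrite scaler_sumr -big_split; apply: eq_bigr => g _ /=.
  rewrite scaler_sumr -big_split; apply: eq_bigr => m _ /=.
  by rewrite !ffunE mcoeffD mcoeffZ scalerDl scalerA.
rewrite /rext gshift_sum (reindex_inj (mulIg h)); apply: eq_bigr => g _.
rewrite gshift_sum ffunE mulgK; apply: eq_bigr => m _.
by rewrite gshiftZ gshiftM.
Qed.

Lemma rext_gmono B m : rext B (gmono m) = B m.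
Proof.
rewrite /rext (bigD1 1%g) //= [X in _ + X]big1 ?addr0 => [|g g1].
  by rewrite ffunE eqxx msuppX big_seq1 mcoeffX eqxx scale1r gshift1.
by rewrite ffunE (negPf g1) msupp0 big_nil.
Qed.

End FilteredOperators.

(** * Construction of the PBW operators and their relations *)

Section PBWOperators.

Variables (k : comNzRingType) (n : nat) (G : finGroupType).
Local Notation P := {mpoly k[n]}.
Local Notation A := {ffun G -> P}.
Local Notation gmono := (@gmono k n G).
Implicit Types (a b : A) (m : 'X_{1..n}) (i j l : 'I_n) (g h : G).

(* Row [i] of [r g] gives the coordinates of [g x_i]; [kap g i j] is the
   coefficient of [g] in the commutator of [x_i] and [x_j]. *)
Variables (r kap : G -> 'M[k]_n).

(** The operators for x_i and g on monomials of degree below the fuel [d]. For [l < i] the value at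
    x_l m' is forced by x_i x_l = x_l x_i + [x_i, x_l]. Once the monomial x_i m' is split off from
    the value of x_i at m', a remainder of degree less than that of m' is left, so the recursion is
    on the degree. The rule for g comes from g x_l = g(x_l) g. *)
Fixpoint pbw_ops (d : nat) : ('I_n -> 'X_{1..n} -> A) * (G -> 'X_{1..n} -> A) :=
  if d is d'.+1 then
    let: (L, M) := pbw_ops d' in
    (fun i m => if least_var m is Some l then
        gmono (m + U_(i)) +
        (if (l < i)%N then
           rext (L l) (L i (m - U_(l))%MM - gmono (m - U_(l) + U_(i))%MM) +
           \sum_g kap g i l *: M g (m - U_(l))%MM else 0)
      else gmono (m + U_(i)),
     fun g m => if least_var m is Some l then
        \sum_j r g l j *: rext (L j) (M g (m - U_(l))%MM)
      else gelt 1 g)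
  else (fun i m => gmono (m + U_(i)), fun g m => 0).

Lemma pbw_opsS d : pbw_ops d.+1 =
    (fun i m => if least_var m is Some l then
        gmono (m + U_(i)) +
        (if (l < i)%N then
           rext ((pbw_ops d).1 l)
             ((pbw_ops d).1 i (m - U_(l))%MM - gmono (m - U_(l) + U_(i))%MM) +
           \sum_g kap g i l *: (pbw_ops d).2 g (m - U_(l))%MM else 0)
      else gmono (m + U_(i)),
     fun g m => if least_var m is Some l then
        \sum_j r g l j *: rext ((pbw_ops d).1 j) ((pbw_ops d).2 g (m - U_(l))%MM)
      else gelt 1 g).
Proof. by rewrite /=; case: pbw_ops. Qed.

Lemma addmUK m l : (m + U_(l) - U_(l))%MM = m.
Proof. by apply/mnmP => j; rewrite mnmBE mnmDE addnK. Qed.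

Lemma mdegDU m l : mdeg (m + U_(l)) = (mdeg m).+1.
Proof. by rewrite mdegD mdeg1 addn1. Qed.

(** Holds for every fuel and every monomial, even where the fuel is too small; this is what
    [pbw_ops_stable] needs to compare two fuels. *)
Lemma pbw_ops_degle d :
  (forall i m, degle (mdeg m) ((pbw_ops d).1 i m - gmono (m + U_(i)))) /\
  (forall g m, degle (mdeg m).+1 ((pbw_ops d).2 g m)).
Proof.
elim: d => [|d [IHL IHM]].
  by split=> [i m|g m] /=; rewrite ?subrr; apply: degle0.
have IHL' i m : degle (mdeg m).+2 ((pbw_ops d).1 i m).
  rewrite -[(pbw_ops d).1 i m](subrK (gmono (m + U_(i)))); apply: degleD.
    exact: degle_le (IHL i m) (leqW (leqnSn _)).
  by rewrite -(mdegDU m i); apply: degle_gmono.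
have ext_degle l e a : degle e a -> degle e.+1 (rext ((pbw_ops d).1 l) a).
  move=> ae; rewrite -addn1; apply: (requiv_degle (rext_requiv _) _ ae) => m.
  by rewrite rext_gmono addn1.
rewrite pbw_opsS; split=> [i m|g m] /=; elim/least_var_ind: m => [|l m lm _].
- by rewrite least_var0 subrr; apply: degle0.
- rewrite least_varD // addmUK addrAC subrr add0r mdegDU.
  case: ifP => _; last exact: degle0.
  apply: degleD; first exact/ext_degle/IHL.
  by apply: degle_sum => g; apply/degleZ/IHM.
- by rewrite least_var0 => h; rewrite ffunE; case: ifP; rewrite ?msize1 ?msize0.
rewrite least_varD // addmUK mdegDU; apply: degle_sum => j.
exact/degleZ/ext_degle/IHM.
Qed.

Lemma rext_eq d (B B' : 'X_{1..n} -> A) a :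
  (forall m, (mdeg m < d)%N -> B m = B' m) -> degle d a -> rext B a = rext B' a.
Proof.
move=> BB'; apply: requiv_eq; try exact: rext_requiv.
by move=> m md; rewrite !rext_gmono BB'.
Qed.

Lemma pbw_ops_stable d e m : (mdeg m < d)%N -> (mdeg m < e)%N ->
  (forall i, (pbw_ops d).1 i m = (pbw_ops e).1 i m) /\
  (forall g, (pbw_ops d).2 g m = (pbw_ops e).2 g m).
Proof.
elim: d e m => // d IHd [//|e] m; rewrite !pbw_opsS /=.
elim/least_var_ind: m => [|l m lm _]; first by rewrite least_var0.
rewrite mdegDU !ltnS least_varD // addmUK => md me.
have [IHL IHM] := IHd e m md me.
split=> [i|g]; last first.
  apply: eq_bigr => j _; congr (_ *: _); rewrite IHM.
  apply: (@rext_eq (mdeg m).+1); last exact: (pbw_ops_degle e).2.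
  by move=> m' m'm; apply: (IHd e m' _ _).1; apply: leq_trans m'm _.
congr (_ + _); case: ifP => // _; congr (_ + _).
  rewrite IHL; apply: (@rext_eq (mdeg m)); last exact: (pbw_ops_degle e).1.
  by move=> m' m'm; apply: (IHd e m' _ _).1; apply: ltn_trans m'm _.
by apply: eq_bigr => g _; rewrite IHM.
Qed.

Definition pbw_var i : A -> A := rext (fun m => (pbw_ops (mdeg m).+1).1 i m).
Definition pbw_grp g : A -> A := rext (fun m => (pbw_ops (mdeg m).+1).2 g m).

Local Notation L := pbw_var.
Local Notation M := pbw_grp.

Definition pbw_comm i j a : A := \sum_g kap g i j *: M g a.
Local Notation K := pbw_comm.

Lemma pbw_varR i : requiv (L i). Proof. exact: rext_requiv. Qed.
Lemma pbw_grpR g : requiv (M g). Proof. exact: rext_requiv. Qed.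
Lemma pbw_commR i j : requiv (K i j).
Proof. by apply: requiv_lincomb => g; apply: pbw_grpR. Qed.

Local Hint Resolve pbw_varR pbw_grpR pbw_commR : core.

Lemma pbw_var_lead i m : degle (mdeg m) (L i (gmono m) - gmono (m + U_(i))).
Proof. by rewrite /L rext_gmono; apply: (pbw_ops_degle _).1. Qed.

Lemma pbw_var_degle i d a : degle d a -> degle d.+1 (L i a).
Proof.
move=> ad; rewrite -addn1; apply: (requiv_degle (pbw_varR i) _ ad) => m.
rewrite -[L i _](subrK (gmono (m + U_(i)))); apply: degleD.
  by apply: degle_le (pbw_var_lead i m) _; rewrite addn1 leqW.
by rewrite addn1 -(mdegDU m i); apply: degle_gmono.
Qed.

Lemma pbw_grp_degle g d a : degle d a -> degle d (M g a).
Proof.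
move=> ad; rewrite -[d]addn0; apply: (requiv_degle (pbw_grpR g) _ ad) => m.
by rewrite addn0 /M rext_gmono; apply: (pbw_ops_degle _).2.
Qed.

Lemma pbw_var_below i m : below_supp i m -> L i (gmono m) = gmono (m + U_(i)).
Proof.
move=> im; rewrite /L rext_gmono pbw_opsS /=.
elim/least_var_ind: m im => [_|l m lm _ im]; first by rewrite least_var0.
rewrite least_varD // ifF ?addr0 //; apply: contraTF im => li.
by apply/below_suppP => /(_ l li); rewrite mnmDE mnm1E eqxx addn1.
Qed.

Lemma pbw_var_swap i l m : below_supp l m -> (l < i)%N ->
  L i (gmono (m + U_(l))) = L l (L i (gmono m)) + K i l (gmono m).
Proof.
move=> lm li; rewrite [LHS]/L rext_gmono pbw_opsS /= least_varD // li addmUK addrA.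
congr (_ + _); last first.
  by apply: eq_bigr => g _; rewrite /M rext_gmono mdegDU.
rewrite -[in RHS](subrK (gmono (m + U_(i))) (L i (gmono m))) (requivD (pbw_varR l)) addrC.
congr (_ + _).
  rewrite [in RHS]/L rext_gmono mdegDU.
  apply: (@rext_eq (mdeg m)); last exact: (pbw_ops_degle _).1.
  by move=> m' m'm; apply: (pbw_ops_stable _ _).1; rewrite ltnS ?leqnn // ltnW.
by rewrite pbw_var_below ?below_suppD // ?(ltnW li) // -addmA [(U_(_) + U_(_))%MM]addmC addmA.
Qed.

Lemma pbw_grp0 g : M g (gmono 0) = gelt 1 g.
Proof. by rewrite /M rext_gmono pbw_opsS /= least_var0. Qed.

Lemma pbw_grpD g l m : below_supp l m ->
  M g (gmono (m + U_(l))) = \sum_j r g l j *: L j (M g (gmono m)).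
Proof.
move=> lm; rewrite [LHS]/M rext_gmono pbw_opsS /= least_varD // addmUK mdegDU.
apply: eq_bigr => j _; congr (_ *: _); rewrite /M rext_gmono.
apply: (@rext_eq (mdeg m).+1); last exact: (pbw_ops_degle _).2.
by move=> m' m'm; apply: (pbw_ops_stable _ _).1.
Qed.

Hypotheses (r1 : r 1%g = 1%:M) (rM : forall g h, r (g * h)%g = r h *m r g).
Hypotheses (kap_alt : forall g i, kap g i i = 0)
  (kap_skew : forall g i j, kap g i j = - kap g j i)
  (kap_equiv : forall h g i j,
     \sum_i' \sum_j' r h i i' * r h j j' * kap (h * g * h^-1)%g i' j' = kap g i j)
  (kap_jacobi : forall g i j l q,
     kap g i j * (r g - 1%:M) l q + kap g j l * (r g - 1%:M) i q
       + kap g l i * (r g - 1%:M) j q = 0).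

Definition pbw_vec (v : 'I_n -> k) a : A := \sum_i v i *: L i a.

Lemma pbw_vecR v : requiv (pbw_vec v).
Proof. by apply: requiv_lincomb => i; apply: pbw_varR. Qed.

Local Hint Resolve pbw_vecR : core.

Lemma pbw_comm_skew i j a : K i j a = - K j i a.
Proof.
rewrite /K -sumrN; apply: eq_bigr => g _.
by rewrite kap_skew scaleNr.
Qed.

(** The relations restricted to degree less than [d]. The three are proved by a joint induction,
    since each step up in degree uses others at the previous stage. *)
Definition comm_rel d :=
  forall i j a, degle d a -> L i (L j a) - L j (L i a) = K i j a.
Definition grp_var_rel d :=
  forall g i a, degle d a -> M g (L i a) = pbw_vec (r g i) (M g a).
Definition grp_mul_rel d :=
  forall g h a, degle d a -> M g (M h a) = M (g * h)%g a.

Lemma requiv_eqS d f f' : requiv f -> requiv f' ->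
  (forall a, degle d a -> f a = f' a) ->
  (forall m, mdeg m = d -> f (gmono m) = f' (gmono m)) ->
  forall a, degle d.+1 a -> f a = f' a.
Proof.
move=> fR fR' ff' H; apply: requiv_eq => // m; rewrite ltnS leq_eqVlt => /orP[/eqP/H//|md].
by apply: ff'; apply: degle_le (degle_gmono _ m) md.
Qed.

Lemma pbw_vec_comb (c : 'I_n -> k) g a :
  \sum_j c j *: pbw_vec (r g j) a = pbw_vec (fun q => \sum_j c j * r g j q) a.
Proof.
under eq_bigr => j _ do rewrite scaler_sumr.
rewrite exchange_big; apply: eq_bigr => q _ /=.
by rewrite scaler_suml; apply: eq_bigr => j _; rewrite scalerA.
Qed.

Lemma grp_mul_relS d : grp_mul_rel d -> grp_var_rel d -> grp_mul_rel d.+1.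
Proof.
move=> HM HB g h; apply: requiv_eqS => [|//|a|m].
- exact: requiv_comp.
- exact: HM.
elim/least_var_ind: m => [|l m lm _] md.
  rewrite !pbw_grp0.
  have -> : gelt (1 : P) h = gshift (gmono 0) h by rewrite gshift_gelt mul1g mpolyX0.
  by rewrite (requiv_shift (pbw_grpR g)) pbw_grp0 gshift_gelt.
have Xd : degle d (gmono m) by rewrite -md mdegDU; apply: degle_gmono.
rewrite !pbw_grpD // (requiv_sum (pbw_grpR g)).
under eq_bigr => j _.
  rewrite (requivZ (pbw_grpR g)) HB; last exact: pbw_grp_degle.
  rewrite (HM _ _ _ Xd); over.
rewrite pbw_vec_comb; apply: eq_bigr => j _.
by rewrite rM mxE.
Qed.

Lemma pbw_vec_comm d v w a : comm_rel d -> degle d a ->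
  pbw_vec v (pbw_vec w a) =
  pbw_vec w (pbw_vec v a) + \sum_i \sum_j (v i * w j) *: K i j a.
Proof.
move=> HC ad.
have E u u' : pbw_vec u (pbw_vec u' a) = \sum_i \sum_j (u i * u' j) *: L i (L j a).
  apply: eq_bigr => i _; rewrite (requiv_sum (pbw_varR i)) scaler_sumr.
  by apply: eq_bigr => j _; rewrite (requivZ (pbw_varR i)) scalerA.
rewrite !E [X in _ = X + _]exchange_big -big_split; apply: eq_bigr => i _ /=.
rewrite -big_split; apply: eq_bigr => j _ /=.
by rewrite [w j * _]mulrC -scalerDr -(HC i j a ad) addrC subrK.
Qed.

(** Moving [M g] past [M h] conjugates [h]; after reindexing the sum over the group, [kap_equiv]
    matches the coefficients. *)
Lemma pbw_grp_comm d g i j a : grp_mul_rel d -> degle d a ->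
  M g (K i j a) = \sum_i' \sum_j' (r g i i' * r g j j') *: K i' j' (M g a).
Proof.
move=> HM ad; rewrite (requiv_sum (pbw_grpR g)).
rewrite [RHS](eq_bigr (fun i' =>
    \sum_h \sum_j' (r g i i' * r g j j' * kap h i' j') *: M h (M g a))).
  rewrite [RHS]exchange_big [RHS](reindex_inj (@conjg_inj _ g^-1%g)) /=.
  apply: eq_bigr => h _; rewrite (requivZ (pbw_grpR g)) (HM _ _ _ ad).
  rewrite [RHS](eq_bigr (fun i' =>
      (\sum_j' r g i i' * r g j j' * kap (h ^ g^-1)%g i' j') *: M (g * h)%g a)).
    rewrite -scaler_suml -(kap_equiv g h i j) conjgE invgK mulgA.
    by [].
  move=> i' _; rewrite scaler_suml; apply: eq_bigr => j' _; congr (_ *: _).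
  by rewrite (HM _ _ _ ad) conjgE invgK -!mulgA mulVg mulg1.
move=> i' _; rewrite exchange_big; apply: eq_bigr => j' _ /=.
by rewrite scaler_sumr; apply: eq_bigr => h _; rewrite scalerA.
Qed.

(** Only x_l m with [l < i] needs work: exchanging x_i and x_l before or after applying [g] produces
    commutators which [pbw_grp_comm] and [pbw_vec_comm] identify. *)
Lemma grp_var_relS d : comm_rel d -> grp_mul_rel d -> grp_var_rel d -> grp_var_rel d.+1.
Proof.
move=> HC HM HB g i; apply: requiv_eqS => [||a|m md].
- exact: requiv_comp.
- exact: requiv_comp.
- exact: HB.
have [im|] := boolP (below_supp i m); first by rewrite pbw_var_below // pbw_grpD.
elim/least_var_ind: m md => [|l m lm _] md.
  by move=> /negP[]; apply/below_suppP => j _; rewrite mnm0E.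
have [li _|il /negP[]] := ltnP l i; last exact: below_supp_le.
have Xd : degle d (gmono m) by rewrite -md mdegDU; apply: degle_gmono.
rewrite pbw_var_swap // (requivD (pbw_grpR g)).
(* Split [L i (gmono m)] into its leading monomial, where [pbw_grpD] applies, and lower terms
   covered by induction. *)
have -> : M g (L l (L i (gmono m))) = pbw_vec (r g l) (M g (L i (gmono m))).
  have := pbw_var_lead i m; rewrite -{2 3}[L i (gmono m)](subrK (gmono (m + U_(i)))).
  move: (L i _ - _) => low lowd; rewrite (requivD (pbw_varR l)).
  rewrite !(requivD (pbw_grpR g)) (requivD (pbw_vecR _)).
  congr (_ + _).
    by apply: HB; apply: degle_le lowd _; rewrite -md mdegDU.
  by rewrite pbw_var_below ?below_suppD // ?(ltnW li) // pbw_grpD // below_suppD // ltnW.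
rewrite (HB _ _ _ Xd) (pbw_grp_comm _ _ _ HM Xd) pbw_grpD //.
by rewrite [RHS](pbw_vec_comm _ _ HC (pbw_grp_degle g Xd)).
Qed.

(** Moving [M g] past [L l] replaces x_l by g x_l, so the commutator of [K i j] with [L l] has
    coefficients [kap g i j] times those of (g - 1) x_l, and the cyclic sum is [kap_jacobi]. *)
Lemma pbw_comm_jacobi d i j l a : grp_var_rel d -> degle d a ->
  (K i j (L l a) - L l (K i j a)) + (K j l (L i a) - L i (K j l a))
    + (K l i (L j a) - L j (K l i a)) = 0.
Proof.
move=> HB ad.
have E i' j' l' : K i' j' (L l' a) - L l' (K i' j' a) =
    \sum_g \sum_q (kap g i' j' * (r g - 1%:M) l' q) *: L q (M g a).
  rewrite (requiv_sum (pbw_varR l')) -sumrB; apply: eq_bigr => g _.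
  rewrite (HB _ _ _ ad) (requivZ (pbw_varR l')) -scalerBr.
  under [RHS]eq_bigr => q _ do rewrite -scalerA.
  rewrite -scaler_sumr; congr (_ *: _).
  under [RHS]eq_bigr => q _ do rewrite !mxE scalerBl.
  rewrite sumrB; congr (_ - _); rewrite (bigD1 l') //= eqxx scale1r big1 ?addr0 //.
  by move=> q /negPf ql; rewrite eq_sym ql scale0r.
rewrite !E -!big_split big1 // => g _ /=; rewrite -!big_split big1 // => q _ /=.
by rewrite -!scalerDl kap_jacobi scale0r.
Qed.

(** The critical case is [l < j < i] at x_l m. Both x_i x_j x_l m and x_j x_i x_l m are rewritten by
    moving x_l to the front; given the relation for x_i and x_j at m, what remains is the Jacobi
    identity. *)
Lemma comm_relS d : comm_rel d -> grp_var_rel d -> comm_rel d.+1.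
Proof.
move=> HC HB.
suff HX i j m : (j < i)%N -> mdeg m = d ->
    L i (L j (gmono m)) - L j (L i (gmono m)) = K i j (gmono m).
  move=> i j; apply: requiv_eqS => [||a|m md].
  - by apply: requivBf; apply: requiv_comp.
  - by [].
  - exact: HC.
  case: (ltngtP i j) => [ij|ji|/val_inj->].
  - by rewrite -opprB HX // -pbw_comm_skew.
  - exact: HX.
  rewrite subrr /K big1 // => g _.
  by rewrite kap_alt scale0r.
move=> ji md.
have [jm|] := boolP (below_supp j m).
  by rewrite [L j (gmono m)]pbw_var_below // pbw_var_swap // addrC addKr.
elim/least_var_ind: m md => [|l m lm _] md.
  by move=> /negP[]; apply/below_suppP => q _; rewrite mnm0E.
have [lj _|il /negP[]] := ltnP l j; last exact: below_supp_le.
have Xd : degle d (gmono m) by rewrite -md mdegDU; apply: degle_gmono.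
have li := ltn_trans lj ji.
(* The induction hypothesis just misses this, as [L j' (gmono m)] has degree [d]. Its leading
   monomial falls under [pbw_var_swap], and the rest has lower degree. *)
have swap i' j' : (l < i')%N -> (l < j')%N ->
    L i' (L l (L j' (gmono m))) = L l (L i' (L j' (gmono m))) + K i' l (L j' (gmono m)).
  move=> li' lj'; have := pbw_var_lead j' m.
  rewrite -{2 3 4}[L j' (gmono m)](subrK (gmono (m + U_(j')))).
  move: (L j' _ - _) => low lowd.
  rewrite !(requivD (pbw_varR _)) (requivD (pbw_commR _ _)) addrACA; congr (_ + _).
    rewrite -(HC i' l low) 1?addrC ?subrK //.
    by apply: degle_le lowd _; rewrite -md mdegDU.
  have lmj : below_supp l (m + U_(j')) by rewrite below_suppD // ltnW.
  by rewrite [L l (gmono _)]pbw_var_below // pbw_var_swap.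
rewrite !(pbw_var_swap lm) // !(requivD (pbw_varR _)) !swap //.
rewrite -[gmono (m + U_(l))]pbw_var_below //.
have J := pbw_comm_jacobi i j l HB Xd.
have C := HC i j (gmono m) Xd.
have {}C : L l (L i (L j (gmono m))) = L l (L j (L i (gmono m))) + L l (K i j (gmono m)).
  by rewrite -C (requivB (pbw_varR l)) addrC subrK.
move: J; rewrite C (pbw_comm_skew l i (gmono m)) (pbw_comm_skew l i (L j _)).
have -> : L j (- K i l (gmono m)) = - L j (K i l (gmono m)).
  by rewrite -scaleN1r (requivZ (pbw_varR j)) scaleN1r.
move: (L l (L j _)) (L l (K i j _)) (K i l _) (L i _) (K j l _) (L j _) (K i j _).
move=> x1 x2 x3 x4 x5 x6 x7 /ffunP J; apply/ffunP => z.
by move: (J z); rewrite !ffunE => Jz; rewrite -[RHS]subr0 -Jz; ring.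
Qed.

Lemma pbw_relations d : [/\ comm_rel d, grp_var_rel d & grp_mul_rel d].
Proof.
elim: d => [|d [HC HB HM]]; last first.
  by split; [apply: comm_relS | apply: grp_var_relS | apply: grp_mul_relS].
split=> [i j|g i|g h] a /degle_eq0->; rewrite ?(requiv0 (pbw_varR _)) ?(requiv0 (pbw_grpR _)) //.
- by rewrite subrr (requiv0 (pbw_commR _ _)).
- by rewrite (requiv0 (pbw_vecR _)).
Qed.

End PBWOperators.

(** * Modules over a symplectic reflection algebra *)

Definition sra_vec (k : fieldType) (D : sra_datum k) (x : sra_space D) : sra D :=
  iq_pi _ (skew_vec x).

(** The coefficient of [g] in the commutator of [x] and [y]; it puts the defining relation into a
    single sum over the group. *)
Definition sra_kappa (k : fieldType) (D : sra_datum k) (g : sra_group D)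
    (x y : sra_space D) : k :=
  (if g == 1%g then sra_form D x y else 0) -
  (if g \in sra_refl D then sra_c g * sra_form_refl g x y else 0).

Section Relations.

Variables (k : fieldType) (D : sra_datum k).
Local Notation V := (sra_space D).
Local Notation Gamma := (sra_group D).

Lemma sra_grp1 : sra_grp (1%g : Gamma) = 1.
Proof. by []. Qed.

Lemma sra_vec_linear c (x y : V) : sra_vec (c *: x + y) = c *: sra_vec x + sra_vec y.
Proof.
rewrite /sra_vec -linearP; congr (iq_pi _ _).
by apply/ffunP => g; rewrite !ffunE; case: ifP; rewrite ?linearP // scaler0 addr0.
Qed.

Lemma sra_grp_vec g (x : V) :
  sra_grp g * sra_vec x = sra_vec (sra_rho g x) * sra_grp g.
Proof.
rewrite /sra_grp /sra_vec -!rmorphM /= !skew_eltM /= !mulg1 !mul1g.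
by rewrite rmorph1 mul1r mulr1 tensor_map_inj.
Qed.

Lemma sra_kappa_sum (x y : V) (M : lmodType k) (E : Gamma -> M) :
  \sum_g sra_kappa g x y *: E g = sra_form D x y *: E 1%g -
    \sum_(s in sra_refl D) (sra_c s * sra_form_refl s x y) *: E s.
Proof.
under eq_bigr => g _ do rewrite scalerBl.
rewrite sumrB; congr (_ - _).
  rewrite (bigD1 1%g) //= eqxx big1 ?addr0 // => g /negPf->.
  by rewrite scale0r.
rewrite [RHS]big_mkcond; apply: eq_bigr => g _.
by case: ifP; rewrite ?scale0r.
Qed.

Lemma sra_comm (x y : V) :
  sra_vec x * sra_vec y - sra_vec y * sra_vec x =
  \sum_g sra_kappa g x y *: sra_grp g.
Proof.
apply/eqP; rewrite -subr_eq0 sra_kappa_sum; apply/eqP.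
pose pr := iq_pi (fun r => exists x y : V, r = sra_relator x y).
transitivity (pr (sra_relator x y)); last by apply/iq_pi_eq0/ideal_gen_rel; exists x, y.
rewrite /sra_relator /pr !rmorphB /= !rmorphM linearZ rmorph_sum /=.
congr (_ - (_ - _)).
by apply: eq_bigr => s _; rewrite linearZ.
Qed.

End Relations.

(** * Modules from operators satisfying the defining relations *)

Section UniversalProperty.

Variables (k : fieldType) (D : sra_datum k) (A : lmodType k).
Local Notation V := (sra_space D).
Local Notation Gamma := (sra_group D).
Variables (X : V -> A -> A) (M : Gamma -> A -> A).
Hypotheses (Xl : forall c x y a, X (c *: x + y) a = c *: X x a + X y a)
  (Xr : forall x c a b, X x (c *: a + b) = c *: X x a + X x b)
  (Ml : forall g c a b, M g (c *: a + b) = c *: M g a + M g b)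
  (M1 : forall a, M 1%g a = a)
  (MM : forall g h a, M (g * h)%g a = M g (M h a))
  (MX : forall g x a, M g (X x a) = X (sra_rho g x) (M g a))
  (XX : forall x y a, X x (X y a) - X y (X x a) =
     \sum_g sra_kappa g x y *: M g a).

(** Formal expressions are evaluated directly as operators on [A]; this descends to the tensor
    algebra, then to the skew group algebra and to the quotient. *)
Fixpoint texpr_act (t : texpr V) (a : A) : A :=
  match t with
  | TVar x => X x a
  | TConst c => c *: a
  | TAdd t u => texpr_act t a + texpr_act u a
  | TMul t u => texpr_act t (texpr_act u a)
  end.

Lemma texpr_act_linear t c a b :
  texpr_act t (c *: a + b) = c *: texpr_act t a + texpr_act t b.
Proof.
elim: t a b => [x|e|t IHt u IHu|t IHt u IHu] a b /=.
- exact: Xr.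
- by rewrite scalerDr !scalerA mulrC.
- by rewrite IHt IHu scalerDr addrACA.
by rewrite IHu IHt.
Qed.

Lemma texpr_act_cong t u : texpr_cong t u -> texpr_act t =1 texpr_act u.
Proof.
elim=> {t u} /=.
- by [].
- by move=> t u _ tu a; rewrite tu.
- by move=> t u v _ tu _ uv a; rewrite tu.
- by move=> t t' u u' _ tt' _ uu' a; rewrite tt' uu'.
- by move=> t t' u u' _ tt' _ uu' a; rewrite tt' uu'.
- by move=> t u v a; rewrite addrA.
- by move=> t u a; rewrite addrC.
- by move=> t a; rewrite scale0r add0r.
- by [].
- by move=> t a; rewrite !scale0r.
- by move=> t a; rewrite scale1r.
- by [].
- by move=> t u v a; rewrite -[texpr_act u a]scale1r texpr_act_linear !scale1r.
- by move=> c d a; rewrite scalerDl.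
- by move=> c d a; rewrite scalerA.
- move=> c t a; have t0 : texpr_act t 0 = 0.
    apply: (addrI (texpr_act t 0)); rewrite addr0 -{1}[texpr_act t 0]scale1r.
    by rewrite -texpr_act_linear scaler0 addr0.
  by rewrite -[c *: a]addr0 texpr_act_linear t0 addr0.
- by move=> x y a; rewrite -[x]scale1r Xl !scale1r.
move=> c x a; have X0 : X 0 a = 0.
  by apply: (addrI (X 0 a)); rewrite addr0 -{1}[X 0 a]scale1r -Xl scaler0 addr0.
by rewrite -[c *: x]addr0 Xl X0 addr0.
Qed.

Definition tensor_act (t : tensor V) : A -> A := texpr_act (trepr t).

Lemma tensor_act_class t : tensor_act (tclass t) =1 texpr_act t.
Proof. exact/texpr_act_cong/trepr_class. Qed.

Lemma tensor_act_linear t c a b :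
  tensor_act t (c *: a + b) = c *: tensor_act t a + tensor_act t b.
Proof. exact: texpr_act_linear. Qed.

Lemma tensor_actP c t u a :
  tensor_act (c *: t + u) a = c *: tensor_act t a + tensor_act u a.
Proof.
elim/tensorW: t => t; elim/tensorW: u => u.
by rewrite /GRing.scale /GRing.add /= tclass_scale tclass_add !tensor_act_class.
Qed.

Lemma tensor_actD t u a : tensor_act (t + u) a = tensor_act t a + tensor_act u a.
Proof. by rewrite -[t]scale1r tensor_actP !scale1r. Qed.

Lemma tensor_act0 a : tensor_act 0 a = 0.
Proof. by apply: (addrI (tensor_act 0 a)); rewrite -tensor_actD !addr0. Qed.

Lemma tensor_actZ c t a : tensor_act (c *: t) a = c *: tensor_act t a.
Proof. by rewrite -[c *: t]addr0 tensor_actP tensor_act0 addr0. Qed.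

Lemma tensor_actM t u a : tensor_act (t * u) a = tensor_act t (tensor_act u a).
Proof.
elim/tensorW: t => t; elim/tensorW: u => u.
by rewrite /GRing.mul /= tclass_mul !tensor_act_class.
Qed.

Lemma tensor_act1 a : tensor_act 1 a = a.
Proof. by rewrite /GRing.one /= tensor_act_class /= scale1r. Qed.

Lemma tensor_act_inj x a : tensor_act (tensor_inj x) a = X x a.
Proof. exact: tensor_act_class. Qed.

Lemma tensor_act_grp g t a :
  M g (tensor_act t a) = tensor_act (tensor_map (sra_rho g) t) (M g a).
Proof.
have M0 : M g 0 = 0.
  apply: (addrI (M g 0)); rewrite addr0 -{1}[M g 0]scale1r.
  by rewrite -Ml scaler0 addr0.
elim/tensorW: t => t; rewrite tensor_act_class.
elim: t a => [x|c|t IHt u IHu|t IHt u IHu] a /=.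
- by rewrite -/(tensor_inj x) tensor_map_inj tensor_act_inj MX.
- have -> : tclass (TConst V c) = c *: (1 : tensor V).
    rewrite /GRing.scale /GRing.one /= tclass_scale; apply/tclassP.
    exact: tc_trans (tc_sym (tc_mul1 _)) (tc_constC _ _).
  by rewrite linearZ /= rmorph1 !tensor_actZ !tensor_act1 -[c *: a]addr0 Ml M0 addr0.
- have -> : tclass (TAdd t u) = tclass t + tclass u :> tensor V.
    by rewrite /GRing.add /= tclass_add.
  rewrite raddfD /= tensor_actD.
  by rewrite -[texpr_act t a]scale1r Ml !scale1r IHt IHu.
have -> : tclass (TMul t u) = tclass t * tclass u :> tensor V.
  by rewrite /GRing.mul /= tclass_mul.
by rewrite rmorphM tensor_actM IHt IHu.
Qed.

Local Notation TVG := (skew_alg (sra_tensor_act D)).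

Definition skew_act (u : TVG) (a : A) : A := \sum_g tensor_act (u g) (M g a).

Lemma skew_actP c u v a : skew_act (c *: u + v) a = c *: skew_act u a + skew_act v a.
Proof.
rewrite scaler_sumr -big_split; apply: eq_bigr => g _ /=.
by rewrite !ffunE tensor_actP.
Qed.

Lemma skew_act_linear u c a b :
  skew_act u (c *: a + b) = c *: skew_act u a + skew_act u b.
Proof.
rewrite scaler_sumr -big_split; apply: eq_bigr => g _ /=.
by rewrite Ml tensor_act_linear.
Qed.

Lemma skew_actD u v a : skew_act (u + v) a = skew_act u a + skew_act v a.
Proof. by rewrite -[u]scale1r skew_actP !scale1r. Qed.

Lemma skew_act0 a : skew_act 0 a = 0.
Proof. by apply: (addrI (skew_act 0 a)); rewrite -skew_actD !addr0. Qed.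

Lemma skew_actZ c u a : skew_act (c *: u) a = c *: skew_act u a.
Proof. by rewrite -[c *: u]addr0 skew_actP skew_act0 addr0. Qed.

Lemma skew_actB u v a : skew_act (u - v) a = skew_act u a - skew_act v a.
Proof. by rewrite -scaleN1r skew_actD skew_actZ scaleN1r. Qed.

Lemma skew_act_elt t g a :
  skew_act (skew_elt (sra_tensor_act D) t g) a = tensor_act t (M g a).
Proof.
rewrite /skew_act (bigD1 g) //= ffunE eqxx big1 ?addr0 // => h /negPf hg.
by rewrite ffunE hg tensor_act0.
Qed.

Lemma skew_act0r u : skew_act u 0 = 0.
Proof.
apply: (addrI (skew_act u 0)); rewrite addr0 -{1}[skew_act u 0]scale1r.
by rewrite -skew_act_linear scaler0 addr0.
Qed.

Lemma skew_act_sumr u (I : Type) (r : seq I) (E : I -> A) :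
  skew_act u (\sum_(i <- r) E i) = \sum_(i <- r) skew_act u (E i).
Proof.
apply: (big_morph (skew_act u)); last exact: skew_act0r.
by move=> x y; rewrite -[x]scale1r skew_act_linear !scale1r.
Qed.

Lemma skew_suml (I : Type) (r : seq I) (P : pred I) (E : I -> TVG) a :
  skew_act (\sum_(i <- r | P i) E i) a = \sum_(i <- r | P i) skew_act (E i) a.
Proof.
exact: (big_morph (fun u => skew_act u a) (fun u v => skew_actD u v a) (skew_act0 a)).
Qed.

Lemma skew_decomp (u : TVG) : u = \sum_g skew_elt (sra_tensor_act D) (u g) g.
Proof.
apply/ffunP => z; rewrite sum_ffunE (bigD1 z) //= ffunE eqxx big1 ?addr0 // => g gz.
by rewrite ffunE eq_sym (negPf gz).
Qed.

Lemma skew_actM u v a : skew_act (u * v) a = skew_act u (skew_act v a).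
Proof.
rewrite [u]skew_decomp [v]skew_decomp mulr_suml !skew_suml.
apply: eq_bigr => g _; rewrite mulr_sumr !skew_suml skew_act_sumr.
apply: eq_bigr => h _; rewrite skew_eltM !skew_act_elt.
by rewrite tensor_actM MM tensor_act_grp.
Qed.

Lemma skew_act_ideal u a :
  ideal_gen (fun r : TVG => exists x y, r = sra_relator x y) u -> skew_act u a = 0.
Proof.
move=> Iu; elim: Iu a => {u}.
- move=> _ [x [y ->]] a; rewrite /sra_relator !skew_actB !skew_actM.
  rewrite skew_suml; under eq_bigr => s _ do rewrite skew_actZ skew_act_elt tensor_act1.
  rewrite skew_actZ !skew_act_elt !tensor_act_inj tensor_act1 !M1 XX.
  by rewrite sra_kappa_sum M1 subrr.
- exact: skew_act0.
- by move=> x y _ IHx _ IHy a; rewrite skew_actD IHx IHy addr0.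
- by move=> b x _ IHx a; rewrite skew_actM IHx skew_act0r.
by move=> b x _ IHx a; rewrite skew_actM IHx.
Qed.

Definition sra_act (h : sra D) (a : A) : A := skew_act (iq_repr h) a.

Lemma sra_act_pi u a : sra_act (iq_pi _ u) a = skew_act u a.
Proof.
apply/eqP; rewrite -subr_eq0 -skew_actB; apply/eqP/skew_act_ideal.
exact: iq_repr_pi.
Qed.

Lemma sra_actP c h h' a : sra_act (c *: h + h') a = c *: sra_act h a + sra_act h' a.
Proof.
elim/iqW: h => u; elim/iqW: h' => v.
by rewrite -linearP !sra_act_pi skew_actP.
Qed.

Lemma sra_actM h h' a : sra_act (h * h') a = sra_act h (sra_act h' a).
Proof.
elim/iqW: h => u; elim/iqW: h' => v.
by rewrite -rmorphM !sra_act_pi skew_actM.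
Qed.

Lemma sra_act_vec x a : sra_act (sra_vec x) a = X x a.
Proof. by rewrite sra_act_pi skew_act_elt tensor_act_inj M1. Qed.

Lemma sra_act_grp g a : sra_act (sra_grp g) a = M g a.
Proof. by rewrite sra_act_pi skew_act_elt tensor_act1. Qed.

End UniversalProperty.

(** * Equivariance and Jacobi identity of the commutator form *)

Section CommutatorForm.

Variables (k : fieldType) (D : sra_datum k).
Local Notation V := (sra_space D).
Local Notation Gamma := (sra_group D).
Local Notation omega := (sra_form D).
Local Notation rho := (@sra_rho k D).
Hypotheses (G0 : (#|Gamma|%:R : k) != 0) (two0 : (2%:R : k) != 0).

Lemma sra_form_skew (x y : V) : omega x y = - omega y x.
Proof. by rewrite hermC /= expr1 mulN1r. Qed.

Lemma sra_form_alt (x : V) : omega x x = 0.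
Proof.
have := sra_form_skew x x; move/eqP; rewrite -subr_eq0 opprK -mulr2n -mulr_natl.
by rewrite mulf_eq0 (negPf two0) => /eqP.
Qed.

Lemma sra_form_linearl c (x x' y : V) :
  omega (c *: x + x') y = c * omega x y + omega x' y.
Proof. by rewrite linearPl. Qed.

Lemma sra_kappa_skew g (x y : V) : sra_kappa g x y = - sra_kappa g y x.
Proof.
rewrite /sra_kappa opprB addrC; congr (_ + _); last first.
  by case: eqP; rewrite ?oppr0 // sra_form_skew.
by case: ifP; rewrite ?oppr0 // /sra_form_refl sra_form_skew mulrN opprK.
Qed.

Lemma sra_kappa_alt g (x : V) : sra_kappa g x x = 0.
Proof.
rewrite /sra_kappa /sra_form_refl !sra_form_alt mulr0.
by rewrite !if_same subrr.
Qed.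

Lemma sra_kappa_linearl g c (x x' y : V) :
  sra_kappa g (c *: x + x') y = c * sra_kappa g x y + sra_kappa g x' y.
Proof.
rewrite /sra_kappa /sra_form_refl linearP !sra_form_linearl.
by case: eqP => _; case: ifP => _; ring.
Qed.

Lemma sra_rho_inv g (x : V) : rho g^-1%g (rho g x) = x.
Proof. by rewrite -comp_lfunE -sra_rhoM mulVg sra_rho1 id_lfunE. Qed.

Lemma sra_proj_id s (u : V) : sra_proj s (u - rho s u) = u - rho s u.
Proof.
rewrite /sra_proj daddv_pi_id ?sra_ker_im //.
by apply/memv_imgP; exists u; rewrite ?memvf // !lfun_simp.
Qed.

Lemma sra_proj_decomp s (x : V) : exists u w,
  [/\ x = (u - rho s u) + w, rho s w = w & sra_proj s x = u - rho s u].
Proof.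
have IK0 := sra_ker_im s G0; rewrite /sra_proj.
set I := limg _ in IK0 *; set K := lker _ in IK0 *.
have IK : (I + K = fullv)%VS.
  apply/eqP; rewrite eqEdim subvf /= dimv_disjoint_sum // addnC.
  by rewrite -(limg_ker_dim (\1 - rho s)%VF fullv) capfv.
have dec : daddv_pi I K x + daddv_pi K I x = x.
  by apply: daddv_pi_add; rewrite // IK memvf.
have /memv_imgP[u _ uE] := memv_pi I K x.
have {}uE : daddv_pi I K x = u - rho s u by rewrite uE !lfun_simp.
exists u, (daddv_pi K I x); split=> //; first by rewrite -uE dec.
have := memv_pi K I x; rewrite memv_ker !lfun_simp subr_eq0 => /eqP E.
by rewrite -E.
Qed.

Lemma sra_proj_ker s (w : V) : rho s w = w -> sra_proj s w = 0.
Proof.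
move=> ww; have [u [v [wE vv pE]]] := sra_proj_decomp s w; rewrite pE.
have := sra_ker_im s G0 => IK0; apply/eqP; rewrite -memv0 -IK0 memv_cap.
apply/andP; split; first by apply/memv_imgP; exists u; rewrite ?memvf // !lfun_simp.
have -> : u - rho s u = w - v by rewrite wE addrK.
by rewrite memv_ker linearB /= !lfun_simp ww vv !subrr.
Qed.

(** [rho h] carries the image and the kernel of 1 - s to those of 1 - h s h^-1. *)
Lemma sra_proj_conj (h s : Gamma) (x : V) :
  sra_proj (h * s * h^-1)%g (rho h x) = rho h (sra_proj s x).
Proof.
have rhoE y : rho (h * s * h^-1)%g (rho h y) = rho h (rho s y).
  by rewrite !sra_rhoM !comp_lfunE sra_rho_inv.
have [u [w [-> ww ->]]] := sra_proj_decomp s x.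
rewrite [rho h (_ + w)]linearD [LHS]linearD /= [sra_proj _ (rho h w)]sra_proj_ker ?rhoE ?ww //.
by rewrite addr0 linearB /= -rhoE sra_proj_id.
Qed.

Lemma sra_refl_conj (h s : Gamma) :
  (h * s * h^-1)%g \in sra_refl D = (s \in sra_refl D).
Proof.
rewrite !inE; congr (_ == _).
have -> : limg (\1 - rho (h * s * h^-1)%g)%VF = (rho h @: limg (\1 - rho s)%VF)%VS.
  apply/vspaceP => y; apply/memv_imgP/memv_imgP => [[u _ ->]|[v /memv_imgP[u _ ->] ->]].
    exists (rho h^-1%g u - rho s (rho h^-1%g u)).
      by apply/memv_imgP; exists (rho h^-1%g u); rewrite ?memvf // !lfun_simp.
    have := sra_rho_inv h^-1%g u; rewrite invgK => E.
    by rewrite !lfun_simp linearB /= E !sra_rhoM !comp_lfunE.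
  exists (rho h u); rewrite ?memvf // !lfun_simp linearB /=.
  by rewrite !sra_rhoM !comp_lfunE sra_rho_inv.
apply: limg_dim_eq; apply/eqP; rewrite -subv0; apply/subvP => x /memv_capP[_].
by rewrite memv_ker memv0 => /eqP/(congr1 (rho h^-1%g)); rewrite sra_rho_inv linear0 => ->.
Qed.

Lemma sra_kappa_conj (h g : Gamma) (x y : V) :
  sra_kappa (h * g * h^-1)%g (rho h x) (rho h y) = sra_kappa g x y.
Proof.
rewrite /sra_kappa sra_refl_conj /sra_form_refl !(sra_proj_conj h g).
rewrite (sra_rho_form h x y) (sra_rho_form h (sra_proj g x) (sra_proj g y)).
have -> : (h * g * h^-1 == 1)%g = (g == 1%g).
  by rewrite -eq_mulgV1 -{2}[h]mulg1 (inj_eq (mulgI h)).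
congr (_ - _); case: ifP => // gS; congr (_ * _).
by rewrite -(sra_cJ h^-1%g gS) conjgE invgK mulgA.
Qed.

(** For a reflection, both [rho g v - v] and the form depend only on projections to the plane im (1
    - g), where any three vectors satisfy omega(x, y) z + omega(y, z) x + omega(z, x) y = 0. *)
Lemma sra_kappa_jacobi g (x y z : V) :
  sra_kappa g x y *: (rho g z - z) + sra_kappa g y z *: (rho g x - x)
    + sra_kappa g z x *: (rho g y - y) = 0.
Proof.
have [->|g1] := eqVneq g 1%g; first by rewrite sra_rho1 !id_lfunE !subrr !scaler0 !addr0.
rewrite /sra_kappa (negPf g1); case: ifP => gS; last by rewrite subrr !scale0r !addr0.
have rhoB v : rho g v - v = - (sra_proj g v - rho g (sra_proj g v)).
  have [u [w [-> ww ->]]] := sra_proj_decomp g v.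
  by move: (u - rho g u) => d; rewrite linearD /= ww opprB opprD addrACA subrr addr0.
rewrite /sra_form_refl !rhoB !sub0r !scalerN !scaleNr !opprK.
have projI v : sra_proj g v \in limg (\1 - rho g)%VF by apply: memv_pi.
move: gS; rewrite inE => /eqP; set I := limg _ in projI * => dimI.
have [u1 [u2 H]] : exists u1 u2, forall v, exists a b, sra_proj g v = a *: u1 + b *: u2.
  pose b i := (vbasis I)`_i; have bE v : exists c : nat -> k,
      sra_proj g v = \sum_(i < \dim I) c i *: b i.
    (* Coordinates are extended by 0 to all of [nat], so that the dimension can be rewritten to 2 in
       the sum. *)
    exists (fun i => oapp (fun j => coord (vbasis I) j (sra_proj g v)) 0 (insub i)).
    by rewrite {1}(coord_vbasis (projI v)); apply: eq_bigr => i _; rewrite valK.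
  exists (b 0%N), (b 1%N) => v; have [c ->] := bE v.
  by rewrite dimI !big_ord_recl big_ord0 addr0; exists (c 0%N), (c 1%N).
have [a1 [b1 ->]] := H x; have [a2 [b2 ->]] := H y; have [a3 [b3 ->]] := H z.
have omr c v v' w : omega w (c *: v + v') = c * omega w v + omega w v'.
  by rewrite sra_form_skew sra_form_linearl sra_form_skew (sra_form_skew v') mulrN opprD !opprK.
have omZ v w c : omega (c *: v) w = c * omega v w.
  by rewrite -[c *: v]addr0 sra_form_linearl linear0l addr0.
have omZr v w c : omega w (c *: v) = c * omega w v.
  by rewrite sra_form_skew omZ sra_form_skew mulrN opprK.
have wE a b a' b' : omega (a *: u1 + b *: u2) (a' *: u1 + b' *: u2) =
    (a * b' - b * a') * omega u1 u2.
  rewrite sra_form_linearl !omr omZ !omZr omZ !sra_form_alt (sra_form_skew u2 u1).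
  by ring.
rewrite !wE.
have rE a b : a *: u1 + b *: u2 - rho g (a *: u1 + b *: u2) =
    a *: (u1 - rho g u1) + b *: (u2 - rho g u2).
  by rewrite linearD !linearZ /= opprD addrACA -!scalerBr.
have addr6 (a b c d e f : V) : a + b + (c + d) + (e + f) = a + c + e + (b + d + f).
  by rewrite (addrACA a) (addrACA (a + c)).
rewrite !rE; move: (u1 - _) (u2 - _) => U W.
rewrite !scalerDr !scalerA addr6 -!scalerDl.
by rewrite [X in X *: _ + _](_ : _ = 0) ?[X in _ + X *: _](_ : _ = 0) ?scale0r ?addr0 //; ring.
Qed.

End CommutatorForm.

(** * Linear forms and linear substitutions *)

Section LinearForms.

Variables (k : fieldType) (n : nat).
Local Notation P := {mpoly k[n]}.

Definition linear_form (v : 'I_n -> k) : P := \sum_i v i *: 'X_i.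

Lemma linear_form_homog v : linear_form v \is 1.-homog.
Proof. by apply: rpred_sum => i _; apply/rpredZ; rewrite dhomogX /= mdeg1. Qed.

Lemma linear_form_coeff v i : (linear_form v)@_U_(i) = v i.
Proof.
rewrite raddf_sum (bigD1 i) //= mcoeffZ mcoeffX eqxx mulr1 big1 ?addr0 // => j ji.
rewrite mcoeffZ mcoeffX; case: eqP => [/mnmP/(_ i)|]; last by rewrite mulr0.
by rewrite !mnm1E eqxx (negPf ji).
Qed.

Definition subst_lin (r : 'M[k]_n) : {lrmorphism P -> P} :=
  comp_mpoly [tuple linear_form (r i) | i < n].

Lemma subst_linX r i : subst_lin r 'X_i = linear_form (r i).
Proof. by rewrite /= comp_mpolyXU -tnth_nth tnth_mktuple. Qed.

Lemma subst_lin_form r v :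
  subst_lin r (linear_form v) = linear_form (fun j => \sum_i v i * r i j).
Proof.
rewrite linear_sum /=.
under eq_bigr => i _ do rewrite linearZ /= comp_mpolyXU -tnth_nth tnth_mktuple scaler_sumr.
rewrite exchange_big; apply: eq_bigr => j _ /=.
by rewrite scaler_suml; apply: eq_bigr => i _; rewrite scalerA.
Qed.

Lemma mpoly_lrmorph_eq (A : comAlgType k) (f g : {lrmorphism P -> A}) :
  (forall i, f 'X_i = g 'X_i) -> f =1 g.
Proof.
move=> fg; elim/mpolyind => [|c m p _ _ IHp]; first by rewrite !rmorph0.
rewrite !linearP /= IHp; congr (c *: _ + _).
rewrite mpolyXE_id !rmorph_prod; apply: eq_bigr => i _.
by rewrite !rmorphXn /= fg.
Qed.

Lemma subst_lin1 : subst_lin 1%:M =1 id.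
Proof.
apply: (mpoly_lrmorph_eq (f := subst_lin 1%:M) (g := idfun)) => i.
rewrite subst_linX /linear_form (bigD1 i) //= mxE eqxx scale1r big1 ?addr0 // => j ji.
by rewrite mxE eq_sym (negPf ji) scale0r.
Qed.

Lemma subst_linM (r s : 'M[k]_n) : subst_lin (s *m r) =1 subst_lin r \o subst_lin s.
Proof.
apply: (mpoly_lrmorph_eq (f := subst_lin (s *m r))
  (g := subst_lin r \o subst_lin s : {lrmorphism P -> P})) => i.
transitivity (subst_lin r (subst_lin s 'X_i)) => //.
rewrite !subst_linX subst_lin_form; apply: eq_bigr => j _.
by rewrite mxE.
Qed.

Lemma subst_lin_homog r d p : p \is d.-homog -> subst_lin r p \is d.-homog.
Proof.
move=> /dhomogP pd; rewrite {1}[p]mpolyE linear_sum big_seq.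
apply: rpred_sum => m /pd md; rewrite linearZ; apply: rpredZ.
move: md; rewrite /= comp_mpolyX => <-; rewrite mdegE.
elim/big_rec2: _ => [|i e q _ qe]; first exact: dhomog1.
apply: dhomogM => //; rewrite tnth_mktuple.
by have := dhomogMn (m i) (linear_form_homog (r i)); rewrite mul1n.
Qed.

(** Solving lv = 0 for x_i gives an endomorphism [phi] that kills lv and is the identity modulo lv.
    The nonzero minor keeps [phi lw] nonzero, so y lw = z lv forces [phi y = 0], and lv divides
    [y]. *)
Lemma coprime_linear_form v w i j : v i * w j != v j * w i -> v i != 0 ->
  coprime_pair (linear_form v) (linear_form w).
Proof.
move=> vw vi; split.
  by apply: contraNneq vi => v0; rewrite -(linear_form_coeff v i) v0 mcoeff0.
set lv := linear_form v; set lw := linear_form w.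
have [phi phiX] : exists phi : {lrmorphism P -> P},
    forall l, phi 'X_l = 'X_l - (if l == i then (v i)^-1 *: lv else 0).
  exists (comp_mpoly [tuple 'X_l - (if l == i then (v i)^-1 *: lv else 0) | l < n]).
  by move=> l; rewrite /= comp_mpolyXU -tnth_nth tnth_mktuple.
have phil u : phi (linear_form u) = linear_form u - (u i / v i) *: lv.
  rewrite linear_sum (eq_bigr (fun l => u l *: 'X_l -
    u l *: (if l == i then (v i)^-1 *: lv else 0))).
    rewrite sumrB; congr (_ - _); rewrite (bigD1 i) //= eqxx scalerA big1 ?addr0 //.
    by move=> l /negPf->; rewrite scaler0.
  by move=> l _; rewrite linearZ /= phiX scalerBr.
have phi_mod p : exists q, p - phi p = q * lv.
  elim/mpolyind: p => [|c m p _ _ [q qE]]; first by exists 0; rewrite rmorph0 subrr mul0r.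
  have [s sE] : exists s, 'X_[m] - phi 'X_[m] = s * lv.
    rewrite mpolyXE_id rmorph_prod; elim/big_rec2: _ => [|l x y _ [s sE]].
      by exists 0; rewrite subrr mul0r.
    have [t tE] : exists t, 'X_l ^+ m l - phi ('X_l ^+ m l) = t * lv.
      rewrite rmorphXn /=; elim: (m l) => [|e [t tE]]; first by exists 0; rewrite subrr mul0r.
      exists (t * 'X_l + phi 'X_l ^+ e * (if l == i then (v i)^-1%:MP else 0)).
      rewrite !exprS mulrDl mulrAC -tE phiX; case: eqP => _.
        by rewrite -mul_mpolyC; ring.
      by ring.
    exists (t * x + phi ('X_l ^+ m l) * s).
    rewrite mulrDl mulrAC -tE -[phi _ * s * _]mulrA -sE. ring.
  exists (c *: s + q); rewrite linearP mulrDl -scalerAl -sE -qE scalerBr.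
  by rewrite opprD addrACA.
move=> y z yz; have [q qE] := phi_mod y; exists q.
suff py : phi y = 0 by rewrite -qE py subr0.
have philv : phi lv = 0 by rewrite phil divff // scale1r subrr.
have : phi y * phi lw = phi z * phi lv by rewrite -!rmorphM yz.
rewrite philv mulr0 => /eqP; rewrite mulf_eq0 => /orP[/eqP//|]; rewrite phil => /eqP E.
case/eqP: vw; have := congr1 (fun p => p@_U_(j)) E.
rewrite mcoeffB mcoeffZ !linear_form_coeff mcoeff0 => /eqP; rewrite subr_eq0 => /eqP->.
by field.
Qed.

End LinearForms.

(** * Generation by vectors and group elements *)

Section Generation.

Variables (k : fieldType) (D : sra_datum k).

Lemma sra_ind (Q : sra D -> Prop) :
  (forall x, Q (sra_vec x)) -> (forall g, Q (sra_grp g)) ->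
  (forall h h', Q h -> Q h' -> Q (h + h')) ->
  (forall h h', Q h -> Q h' -> Q (h * h')) ->
  (forall c h, Q h -> Q (c *: h)) -> forall h, Q h.
Proof.
move=> Qv Qg QD QM QZ; elim/iqW => u; rewrite [u]skew_decomp raddf_sum /=.
elim/big_ind: _ => [||g _]; first by rewrite -(scale0r (sra_grp 1%g)); apply/QZ/Qg.
  exact: QD.
have -> : skew_elt (sra_tensor_act D) (u g) g =
    skew_elt (sra_tensor_act D) (u g) 1%g * skew_grp g.
  by rewrite skew_eltM rmorph1 mulr1 mul1g.
rewrite rmorphM /=; apply: (QM _ _ _ (Qg g)); elim/tensorW: (u g) => t.
elim: t => [x|c|t IHt t' IHt'|t IHt t' IHt']; first exact: Qv.
- have -> : tclass (TConst (sra_space D) c) = c *: (1 : tensor (sra_space D)).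
    rewrite /GRing.scale /GRing.one /= tclass_scale; apply/tclassP.
    exact: tc_trans (tc_sym (tc_mul1 _)) (tc_constC _ _).
  have -> : skew_elt (sra_tensor_act D) (c *: 1) 1%g = c *: skew_grp 1%g.
    by apply/ffunP => z; rewrite !ffunE; case: ifP; rewrite ?scaler0.
  by rewrite linearZ; apply/QZ/Qg.
- have -> : skew_elt (sra_tensor_act D) (tclass (TAdd t t')) 1%g =
      skew_elt (sra_tensor_act D) (tclass t) 1%g +
      skew_elt (sra_tensor_act D) (tclass t') 1%g.
    apply/ffunP => z; rewrite !ffunE; case: ifP; rewrite ?addr0 // => _.
    by rewrite [RHS]/GRing.add /= tclass_add.
  by rewrite raddfD; apply: QD.
have -> : skew_elt (sra_tensor_act D) (tclass (TMul t t')) 1%g =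
    skew_elt (sra_tensor_act D) (tclass t) 1%g *
    skew_elt (sra_tensor_act D) (tclass t') 1%g.
  rewrite skew_eltM aact1 mulg1.
  by rewrite [in RHS]/GRing.mul /= tclass_mul.
by rewrite rmorphM; apply: QM.
Qed.

End Generation.

(** * Matrices of the action and of the commutator form *)

Section Coordinates.

Variables (k : fieldType) (D : sra_datum k).
Local Notation V := (sra_space D).
Local Notation Gamma := (sra_group D).
Local Notation rho := (@sra_rho k D).
Hypotheses (G0 : (#|Gamma|%:R : k) != 0) (two0 : (2%:R : k) != 0).

Local Notation n := (\dim (fullv : {vspace V})).

Definition sra_base (i : 'I_n) : V := (vbasis (fullv : {vspace V}))`_i.
Definition sra_coord (x : V) (i : 'I_n) : k := coord (vbasis (fullv : {vspace V})) i x.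

Lemma sra_coordE x : x = \sum_i sra_coord x i *: sra_base i.
Proof. exact/coord_vbasis/memvf. Qed.

Lemma sra_coordP c x y i : sra_coord (c *: x + y) i = c * sra_coord x i + sra_coord y i.
Proof. by rewrite /sra_coord linearP. Qed.

Lemma sra_coord_sum (I : Type) (s : seq I) (c : I -> k) (E : I -> V) i :
  sra_coord (\sum_(j <- s) c j *: E j) i = \sum_(j <- s) c j * sra_coord (E j) i.
Proof.
by rewrite /sra_coord linear_sum; apply: eq_bigr => j _; rewrite linearZ.
Qed.

Lemma sra_coord_base i j : sra_coord (sra_base i) j = (i == j)%:R.
Proof.
rewrite /sra_coord /sra_base coord_free; last exact: basis_free (vbasisP _).
by rewrite eq_sym.
Qed.

Definition sra_mx (g : Gamma) : 'M[k]_n :=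
  \matrix_(i, j) sra_coord (rho g (sra_base i)) j.
Definition sra_kapmx (g : Gamma) : 'M[k]_n :=
  \matrix_(i, j) sra_kappa g (sra_base i) (sra_base j).

Lemma sra_coord_rho g x j : sra_coord (rho g x) j = \sum_i sra_coord x i * sra_mx g i j.
Proof.
rewrite {1}(sra_coordE x) linear_sum.
under eq_bigr => i _ do rewrite linearZ.
by rewrite sra_coord_sum; apply: eq_bigr => i _; rewrite mxE.
Qed.

Lemma sra_mx1 : sra_mx 1%g = 1%:M.
Proof. by apply/matrixP => i j; rewrite !mxE sra_rho1 id_lfunE sra_coord_base. Qed.

(** The rows of [sra_mx g] are the images of the basis vectors, whence the reversed order. *)
Lemma sra_mxM g h : sra_mx (g * h)%g = sra_mx h *m sra_mx g.
Proof.
apply/matrixP => i j; rewrite !mxE sra_rhoM comp_lfunE sra_coord_rho.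
by apply: eq_bigr => l _; rewrite !mxE.
Qed.

Lemma sra_kappa_suml (g : Gamma) (I : Type) (s : seq I) (c : I -> k) (E : I -> V) y :
  sra_kappa g (\sum_(i <- s) c i *: E i) y = \sum_(i <- s) c i * sra_kappa g (E i) y.
Proof.
elim: s => [|i s IHs]; last by rewrite !big_cons sra_kappa_linearl IHs.
rewrite !big_nil; have := sra_kappa_linearl g (-1) 0 0 y.
by rewrite scaler0 addr0 mulN1r addNr.
Qed.

Lemma sra_kappa_coord (g : Gamma) x y : sra_kappa g x y =
  \sum_i \sum_j sra_coord x i * sra_coord y j * sra_kapmx g i j.
Proof.
rewrite {1}(sra_coordE x) sra_kappa_suml; apply: eq_bigr => i _.
rewrite sra_kappa_skew {1}(sra_coordE y) sra_kappa_suml -sumrN mulr_sumr.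
by apply: eq_bigr => j _; rewrite mxE (sra_kappa_skew g (sra_base i)) !mulrN mulrA.
Qed.

Lemma sra_kapmx_alt g i : sra_kapmx g i i = 0.
Proof. by rewrite mxE sra_kappa_alt. Qed.

Lemma sra_kapmx_skew g i j : sra_kapmx g i j = - sra_kapmx g j i.
Proof. by rewrite !mxE sra_kappa_skew. Qed.

Lemma sra_kapmx_equiv h g i j :
  \sum_i' \sum_j' sra_mx h i i' * sra_mx h j j' * sra_kapmx (h * g * h^-1)%g i' j'
  = sra_kapmx g i j.
Proof.
rewrite [RHS]mxE -(sra_kappa_conj G0 h) sra_kappa_coord.
by apply: eq_bigr => i' _; apply: eq_bigr => j' _; rewrite !mxE.
Qed.

Lemma sra_kapmx_jacobi g i j l q :
  sra_kapmx g i j * (sra_mx g - 1%:M) l q + sra_kapmx g j l * (sra_mx g - 1%:M) i q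
    + sra_kapmx g l i * (sra_mx g - 1%:M) j q = 0.
Proof.
have E i' : (sra_mx g - 1%:M) i' q = sra_coord (rho g (sra_base i') - sra_base i') q.
  by rewrite !mxE /sra_coord linearB /= -/(sra_coord (sra_base i') q) sra_coord_base.
have := congr1 (fun x => sra_coord x q)
  (sra_kappa_jacobi G0 two0 g (sra_base i) (sra_base j) (sra_base l)).
rewrite -[X in sra_coord (_ + X)]addr0 -addrA !sra_coordP [sra_coord 0 q]linear0 addr0.
by rewrite !E !mxE addrA.
Qed.

End Coordinates.

(** * The PBW isomorphism *)

Section PBWBasis.

Variables (k : fieldType) (D : sra_datum k).
Local Notation V := (sra_space D).
Local Notation Gamma := (sra_group D).
Local Notation rho := (@sra_rho k D).
Hypotheses (G0 : (#|Gamma|%:R : k) != 0) (two0 : (2%:R : k) != 0).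

Local Notation n := (\dim (fullv : {vspace V})).
Local Notation P := {mpoly k[n]}.
Local Notation A := {ffun Gamma -> P}.
Local Notation H := (sra D).
Local Notation r := (@sra_mx k D).
Local Notation kap := (@sra_kapmx k D).
Local Notation L := (pbw_var r kap).
Local Notation M := (pbw_grp r kap).
Local Notation K := (pbw_comm r kap).
Local Notation gmono := (@gmono k n Gamma).
Local Notation b := (@sra_base k D).

Let rels d := pbw_relations (@sra_mxM k D) (sra_kapmx_alt (D := D) two0)
  (@sra_kapmx_skew k D) (sra_kapmx_equiv G0) (sra_kapmx_jacobi G0 two0) d.

Lemma pbw_grp_var g i a : M g (L i a) = pbw_vec r kap (r g i) (M g a).
Proof. by have [d ad] := degle_ex a; have [_ HB _] := rels d; apply: HB. Qed.

Lemma pbw_grpM g h a : M g (M h a) = M (g * h)%g a.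
Proof. by have [d ad] := degle_ex a; have [_ _ HM] := rels d; apply: HM. Qed.

Lemma pbw_grp1 a : M 1%g a = a.
Proof.
have [d ad] := degle_ex a.
apply: (@requiv_eq _ _ _ d (M 1%g) id) ad; [exact: pbw_grpR | by split | ].
move=> m _; elim/least_var_ind: m => [|l m lm IHm]; first by rewrite pbw_grp0 gmono0.
rewrite pbw_grpD // IHm sra_mx1 (bigD1 l) //= mxE eqxx scale1r big1 ?addr0.
  by rewrite pbw_var_below.
by move=> j jl; rewrite mxE eq_sym (negPf jl) scale0r.
Qed.

Definition vec_act (x : V) (a : A) : A := pbw_vec r kap (sra_coord x) a.

Lemma vec_act_linearl c x y a :
  vec_act (c *: x + y) a = c *: vec_act x a + vec_act y a.
Proof.
rewrite scaler_sumr -big_split; apply: eq_bigr => i _ /=.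
by rewrite sra_coordP scalerDl scalerA.
Qed.

Lemma vec_act_linearr x c a a' :
  vec_act x (c *: a + a') = c *: vec_act x a + vec_act x a'.
Proof. exact: (pbw_vecR _ _ _).1. Qed.

Lemma vec_act_base i a : vec_act (b i) a = L i a.
Proof.
rewrite /vec_act /pbw_vec (bigD1 i) //= sra_coord_base eqxx scale1r big1 ?addr0 //.
by move=> j ji; rewrite sra_coord_base eq_sym (negPf ji) scale0r.
Qed.

Lemma grp_vec_act g x a : M g (vec_act x a) = vec_act (rho g x) (M g a).
Proof.
rewrite (requiv_sum (pbw_grpR _ _ g)).
under eq_bigr => i _ do rewrite (requivZ (pbw_grpR _ _ g)) pbw_grp_var.
rewrite pbw_vec_comb; apply: eq_bigr => j _.
by rewrite sra_coord_rho.
Qed.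

Lemma vec_act_comm x y a : vec_act x (vec_act y a) - vec_act y (vec_act x a) =
  \sum_g sra_kappa g x y *: M g a.
Proof.
have [d ad] := degle_ex a; have [HC _ _] := rels d.
rewrite /vec_act (pbw_vec_comm _ _ HC ad) addrC addKr.
under [RHS]eq_bigr => g _ do rewrite sra_kappa_coord scaler_suml.
rewrite [RHS]exchange_big; apply: eq_bigr => i _ /=.
under [RHS]eq_bigr => g _ do rewrite scaler_suml.
rewrite [RHS]exchange_big; apply: eq_bigr => j _ /=.
by rewrite scaler_sumr; apply: eq_bigr => g _; rewrite scalerA.
Qed.

Lemma grp_act_linear g c a a' : M g (c *: a + a') = c *: M g a + M g a'.
Proof. exact: (pbw_grpR _ _ _).1. Qed.

Definition pbw_act (h : H) (a : A) : A := sra_act vec_act M h a.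

Let vl := vec_act_linearl.
Let vr := vec_act_linearr.
Let gl := grp_act_linear.
Let g1 := pbw_grp1.
Let gm g h a : M (g * h)%g a = M g (M h a) := esym (pbw_grpM g h a).
Let gv := grp_vec_act.
Let vc := vec_act_comm.

Lemma pbw_actP c h h' a : pbw_act (c *: h + h') a = c *: pbw_act h a + pbw_act h' a.
Proof. exact: (sra_actP vl vr gl g1 gm gv vc). Qed.
Lemma pbw_actM h h' a : pbw_act (h * h') a = pbw_act h (pbw_act h' a).
Proof. exact: (sra_actM vl vr gl g1 gm gv vc). Qed.
Lemma pbw_act_vec x a : pbw_act (sra_vec x) a = vec_act x a.
Proof. exact: (sra_act_vec vl vr gl g1 gm gv vc). Qed.
Lemma pbw_act_grp g a : pbw_act (sra_grp g) a = M g a.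
Proof. exact: (sra_act_grp vl vr gl g1 gm gv vc). Qed.

Lemma pbw_actD h h' a : pbw_act (h + h') a = pbw_act h a + pbw_act h' a.
Proof. by rewrite -[h]scale1r pbw_actP !scale1r. Qed.
Lemma pbw_act0 a : pbw_act 0 a = 0.
Proof. by apply: (addrI (pbw_act 0 a)); rewrite -pbw_actD !addr0. Qed.
Lemma pbw_actZ c h a : pbw_act (c *: h) a = c *: pbw_act h a.
Proof. by rewrite -[c *: h]addr0 pbw_actP pbw_act0 addr0. Qed.
(* The ordered monomial [x_1^m_1 ... x_n^m_n]. *)
Fixpoint ordered_rec (d : nat) (m : 'X_{1..n}) : H :=
  if d is d'.+1 then
    if least_var m is Some l then sra_vec (b l) * ordered_rec d' (m - U_(l))%MM else 1
  else 1.

Definition ordered (m : 'X_{1..n}) : H := ordered_rec (mdeg m) m.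

Lemma ordered0 : ordered 0%MM = 1.
Proof. by rewrite /ordered mdeg0. Qed.

Lemma orderedD l m : below_supp l m ->
  ordered (m + U_(l))%MM = sra_vec (b l) * ordered m.
Proof. by move=> lm; rewrite /ordered mdegDU /= least_varD // addmUK. Qed.

Definition quant (f : P) : H := \sum_(m <- msupp f) f@_m *: ordered m.

Lemma quantwE d f : (msize f <= d)%N ->
  quant f = \sum_(m : 'X_{1..n < d}) f@_m *: ordered m.
Proof.
move=> fd; pose I : subFinType _ := 'X_{1..n < d}.
rewrite /quant (big_mksub I) ?msupp_uniq //=; last first.
  by move=> m /msize_mdeg_lt/leq_trans; apply.
by rewrite big_rmcond //= => m /memN_msupp_eq0->; rewrite scale0r.
Qed.

Lemma quant_linear c f g : quant (c *: f + g) = c *: quant f + quant g.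
Proof.
pose d := maxn (msize f) (msize g).
have fd : (msize f <= d)%N := leq_maxl _ _.
have gd : (msize g <= d)%N := leq_maxr _ _.
have fgd : (msize (c *: f + g) <= d)%N.
  apply: leq_trans (msizeD_le _ _) _; rewrite geq_max gd andbT.
  exact: leq_trans (msizeZ_le _ _) fd.
rewrite !(@quantwE d) // scaler_sumr -big_split; apply: eq_bigr => m _ /=.
by rewrite mcoeffD mcoeffZ scalerDl scalerA.
Qed.

HB.instance Definition _ := GRing.isLinear.Build k P H *:%R quant quant_linear.

Lemma quantX m : quant 'X_[m] = ordered m.
Proof. by rewrite /quant msuppX big_seq1 mcoeffX eqxx scale1r. Qed.

(** The PBW map from P * G to [H]; its inverse is the action of [H] on 1, by [quantA_surj] and
    [quantAK]. *)
Definition quantA (a : A) : H := \sum_g quant (a g) * sra_grp g.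

Lemma quantAP c a a' : quantA (c *: a + a') = c *: quantA a + quantA a'.
Proof.
rewrite scaler_sumr -big_split; apply: eq_bigr => g _ /=.
by rewrite !ffunE linearP mulrDl iq_scalerAl.
Qed.

Lemma quantAD a a' : quantA (a + a') = quantA a + quantA a'.
Proof. by rewrite -[a]scale1r quantAP !scale1r. Qed.
Lemma quantA0 : quantA 0 = 0.
Proof. by apply: (addrI (quantA 0)); rewrite -quantAD !addr0. Qed.
Lemma quantAZ c a : quantA (c *: a) = c *: quantA a.
Proof. by rewrite -[c *: a]addr0 quantAP quantA0 addr0. Qed.
Lemma quantAB a a' : quantA (a - a') = quantA a - quantA a'.
Proof. by rewrite -scaleN1r quantAD quantAZ scaleN1r. Qed.
Lemma quantA_sum (I : Type) (s : seq I) (E : I -> A) :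
  quantA (\sum_(i <- s) E i) = \sum_(i <- s) quantA (E i).
Proof. exact: (big_morph quantA quantAD quantA0). Qed.

Lemma quantA_gelt f g : quantA (gelt f g) = quant f * sra_grp g.
Proof.
rewrite /quantA (bigD1 g) //= ffunE eqxx big1 ?addr0 // => h /negPf hg.
by rewrite ffunE hg raddf0 mul0r.
Qed.

Lemma quantA_shift a h : quantA (gshift a h) = quantA a * sra_grp h.
Proof.
rewrite /quantA [LHS](reindex_inj (mulIg h)) mulr_suml; apply: eq_bigr => g _.
by rewrite ffunE mulgK sra_grpM mulrA.
Qed.

Lemma quantA_gmono m : quantA (gmono m) = ordered m.
Proof. by rewrite quantA_gelt quantX sra_grp1 mulr1. Qed.

Lemma sra_vec_sum (I : Type) (s : seq I) (c : I -> k) (E : I -> V) :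
  sra_vec (\sum_(i <- s) c i *: E i) = \sum_(i <- s) c i *: sra_vec (E i).
Proof.
elim: s => [|i s IHs]; last by rewrite !big_cons sra_vec_linear IHs.
rewrite !big_nil; apply: (addrI (sra_vec (0 : V))).
by rewrite -{1}[sra_vec 0]scale1r -sra_vec_linear scaler0 !addr0.
Qed.

Lemma sra_vec_rho g l : sra_vec (rho g (b l)) = \sum_j r g l j *: sra_vec (b j).
Proof.
rewrite (sra_coordE (rho g (b l))) sra_vec_sum.
by apply: eq_bigr => j _; rewrite mxE.
Qed.

(** The relations that define the operators on ordered monomials hold in [H], so [quantA] turns the
    operators into left multiplications. *)
Lemma quantA_ops d a : degle d a ->
  (forall i, quantA (L i a) = sra_vec (b i) * quantA a) /\
  (forall g, quantA (M g a) = sra_grp g * quantA a).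
Proof.
elim: d a => [|d IHd] a.
  move=> /degle_eq0->; split=> [i|g];
    rewrite ?(requiv0 (pbw_varR _ _ _)) ?(requiv0 (pbw_grpR _ _ _)).
    by rewrite quantA0 mulr0.
  by rewrite quantA0 mulr0.
suff Hm m : mdeg m = d ->
    (forall i, quantA (L i (gmono m)) = sra_vec (b i) * ordered m) /\
    (forall g, quantA (M g (gmono m)) = sra_grp g * ordered m).
  apply: (degle_ind (Q := fun a => (forall i, quantA (L i a) = sra_vec (b i) * quantA a) /\
    (forall g, quantA (M g a) = sra_grp g * quantA a))) => [|c x y [Lx Mx] [Ly My]|m h].
  - split=> [i|g]; rewrite ?(requiv0 (pbw_varR _ _ _)) ?(requiv0 (pbw_grpR _ _ _)).
      by rewrite quantA0 mulr0.
    by rewrite quantA0 mulr0.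
  - split=> [i|g].
      by rewrite (requivP (pbw_varR _ _ i)) !quantAP Lx Ly mulrDr iq_scalerAr.
    by rewrite (requivP (pbw_grpR _ _ g)) !quantAP Mx My mulrDr iq_scalerAr.
  rewrite ltnS leq_eqVlt => /orP[/eqP/Hm[HL HM]|md].
    split=> [i|g].
      by rewrite (requiv_shift (pbw_varR _ _ i)) !quantA_shift HL quantA_gmono mulrA.
    by rewrite (requiv_shift (pbw_grpR _ _ g)) !quantA_shift HM quantA_gmono mulrA.
  by apply: IHd; apply/degle_shift/(degle_le (degle_gmono _ m)).
move=> md; have below i : below_supp i m -> quantA (L i (gmono m)) = sra_vec (b i) * ordered m.
  by move=> im; rewrite pbw_var_below // quantA_gmono orderedD.
elim/least_var_ind: m md below => [|l m lm _] md below; split=> [i|g].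
- by apply: below; apply/below_suppP => j _; rewrite mnm0E.
- by rewrite pbw_grp0 quantA_gelt -mpolyX0 quantX ordered0 mul1r mulr1.
- have [li|il] := ltnP l i; last by apply: below; apply: below_supp_le.
  have Xd : degle d (gmono m) by rewrite -md mdegDU; apply: degle_gmono.
  have [HL HM] := IHd _ Xd.
  rewrite pbw_var_swap // quantAD orderedD // [quantA (K _ _ _)]quantA_sum.
  (* The leading monomial is ordered, and the lower terms are covered by induction. *)
  have -> : quantA (L l (L i (gmono m))) = sra_vec (b l) * quantA (L i (gmono m)).
    have := pbw_var_lead r kap i m; rewrite -{2 3}[L i (gmono m)](subrK (gmono (m + U_(i)))).
    move: (L i _ - _) => low lowd; rewrite (requivD (pbw_varR _ _ l)) !quantAD mulrDr.
    have lowd' : degle d low by apply: degle_le lowd _; rewrite -md mdegDU.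
    rewrite (IHd _ lowd').1; congr (_ + _).
    rewrite pbw_var_below ?below_suppD ?(ltnW li) // !quantA_gmono.
    by rewrite orderedD // below_suppD // ltnW.
  under eq_bigr => g _ do rewrite quantAZ HM mxE iq_scalerAl.
  rewrite -mulr_suml -sra_comm HL quantA_gmono mulrBl !mulrA.
  by rewrite addrC subrK.
have Xd : degle d (gmono m) by rewrite -md mdegDU; apply: degle_gmono.
have [_ HM] := IHd _ Xd.
rewrite pbw_grpD // quantA_sum.
under eq_bigr => j _.
  rewrite quantAZ (IHd _ (pbw_grp_degle _ _ g Xd)).1 HM; over.
have -> : sra_grp g * ordered (m + U_(l)) = sra_vec (rho g (b l)) * (sra_grp g * ordered m).
  rewrite (orderedD lm) mulrA sra_grp_vec.
  exact/esym/mulrA.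
rewrite sra_vec_rho mulr_suml quantA_gmono.
by apply: eq_bigr => j _; rewrite iq_scalerAl.
Qed.

Lemma quantA_var i a : quantA (L i a) = sra_vec (b i) * quantA a.
Proof. by have [d ad] := degle_ex a; apply: (quantA_ops ad).1. Qed.

Lemma quantA_grp g a : quantA (M g a) = sra_grp g * quantA a.
Proof. by have [d ad] := degle_ex a; apply: (quantA_ops ad).2. Qed.

Lemma quantA_act h a : quantA (pbw_act h a) = h * quantA a.
Proof.
elim/sra_ind: h a => [x|g|h h' IH IH'|h h' IH IH'|c h IH] a.
- rewrite pbw_act_vec /vec_act quantA_sum {2}[x]sra_coordE sra_vec_sum mulr_suml.
  by apply: eq_bigr => i _; rewrite quantAZ quantA_var iq_scalerAl.
- by rewrite pbw_act_grp quantA_grp.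
- by rewrite pbw_actD quantAD IH IH' mulrDl.
- by rewrite pbw_actM IH IH' mulrA.
by rewrite pbw_actZ quantAZ IH iq_scalerAl.
Qed.

Lemma quantA1 : quantA (gmono 0) = 1.
Proof. by rewrite quantA_gmono ordered0. Qed.

(** [quantA] is a map of left [H]-modules taking the value 1 at [gmono 0]. *)
Lemma quantA_surj h : h = quantA (pbw_act h (gmono 0)).
Proof. by rewrite quantA_act quantA1 mulr1. Qed.

(** Each factor comes no later than those already applied, so no reordering takes place. *)
Lemma ordered_act m h : pbw_act (ordered m) (gshift (gmono 0) h) = gshift (gmono m) h.
Proof.
elim/least_var_ind: m => [|l m lm IHm].
  by rewrite ordered0 -(sra_grp1 D) pbw_act_grp pbw_grp1.
rewrite orderedD // pbw_actM IHm pbw_act_vec vec_act_base.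
by rewrite (requiv_shift (pbw_varR _ _ l)) pbw_var_below.
Qed.

(** The linear independence in the PBW theorem: acting on 1, an ordered expression gives back its
    coefficients. *)
Lemma quantAK a : pbw_act (quantA a) (gmono 0) = a.
Proof.
have [d] := degle_ex a; move: a.
apply: degle_ind => [|c a a' IHa IHa'|m h _].
- by rewrite quantA0 pbw_act0.
- by rewrite quantAP pbw_actP IHa IHa'.
rewrite quantA_shift quantA_gmono pbw_actM pbw_act_grp.
have -> : M h (gmono 0) = gshift (gmono 0) h.
  by rewrite pbw_grp0 gshift_gelt mul1g mpolyX0.
exact: ordered_act.
Qed.

Lemma quantA_inj : injective quantA.
Proof. by move=> a a' E; rewrite -(quantAK a) E quantAK. Qed.

End PBWBasis.

(** * Leading terms of the PBW operators *)

Section LeadingTerms.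

Variables (k : fieldType) (n : nat) (G : finGroupType) (r kap : G -> 'M[k]_n).
Local Notation P := {mpoly k[n]}.
Local Notation A := {ffun G -> P}.
Local Notation L := (pbw_var r kap).
Local Notation M := (pbw_grp r kap).
Local Notation gmono := (@gmono k n G).

Lemma gelt_linear c (f f' : P) g :
  gelt (c *: f + f') g = c *: gelt f g + gelt f' g :> A.
Proof. by apply/ffunP => z; rewrite !ffunE; case: ifP; rewrite ?scaler0 ?addr0. Qed.

Lemma gelt0 g : gelt (0 : P) g = 0 :> A.
Proof. by apply/ffunP => z; rewrite !ffunE if_same. Qed.

Lemma gelt_sum (I : Type) (s : seq I) (c : I -> k) (E : I -> P) g :
  gelt (\sum_(i <- s) c i *: E i) g = \sum_(i <- s) c i *: gelt (E i) g :> A.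
Proof.
elim: s => [|i s IHs]; last by rewrite !big_cons gelt_linear IHs.
by rewrite !big_nil gelt0.
Qed.

Lemma gelt_shift (f : P) g : gelt f g = gshift (gelt f 1%g) g :> A.
Proof. by rewrite gshift_gelt mul1g. Qed.

Lemma gshiftB (a a' : A) g : gshift a g - gshift a' g = gshift (a - a') g.
Proof. by apply/ffunP => z; rewrite !ffunE. Qed.

Lemma degle_gelt d (f : P) g : (msize f <= d)%N -> degle d (gelt f g : A).
Proof. by move=> fd z; rewrite ffunE; case: ifP; rewrite ?msize0. Qed.

Lemma homog_mono_ind d (Q : P -> Prop) : Q 0 ->
  (forall c f f', Q f -> Q f' -> Q (c *: f + f')) ->
  (forall m, mdeg m = d -> Q 'X_[m]) -> forall f, f \is d.-homog -> Q f.
Proof.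
move=> Q0 QP QX f fd; rewrite [f]mpolyE big_seq; elim/big_rec: _ => // m x mf Qx.
by apply: QP => //; apply: QX; apply: (dhomogP _ _ _ fd m mf).
Qed.

Lemma var_lead d l f g : f \is d.-homog ->
  degle d (L l (gelt f g) - gelt ('X_l * f) g).
Proof.
move=> fd; rewrite gelt_shift [X in _ - X]gelt_shift (requiv_shift (pbw_varR _ _ l)).
rewrite gshiftB; apply: degle_shift; move: f fd.
apply: homog_mono_ind => [|c f f' IH IH'|m <-].
- by rewrite mulr0 gelt0 (requiv0 (pbw_varR _ _ l)) subr0; apply: degle0.
- rewrite mulrDr -scalerAr !gelt_linear (requivP (pbw_varR _ _ l)) opprD addrACA -scalerBr.
  exact: (degleD (degleZ _ IH) IH').
by rewrite -mpolyXD addmC; apply: pbw_var_lead.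
Qed.

Lemma grp_lead d g f : f \is d.-homog ->
  degle d (M g (gelt f 1%g) - gelt (subst_lin (r g) f) g).
Proof.
move: f; apply: homog_mono_ind => [|c f f' IH IH'|m <-].
- by rewrite linear0 !gelt0 (requiv0 (pbw_grpR _ _ g)) subr0; apply: degle0.
- rewrite linearP !gelt_linear (requivP (pbw_grpR _ _ g)) opprD addrACA -scalerBr.
  exact: (degleD (degleZ _ IH) IH').
elim/least_var_ind: m => [|l m lm IHm].
  by rewrite [M g _]pbw_grp0 mpolyX0 rmorph1 subrr; apply: degle0.
have gE m' : gelt 'X_[m'] 1%g = gmono m' by [].
rewrite gE (pbw_grpD _ _ g lm).
have -> : subst_lin (r g) 'X_[(m + U_(l))%MM] =
    \sum_j r g l j *: ('X_j * subst_lin (r g) 'X_[m]).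
  rewrite mpolyXD rmorphM /= -/(subst_lin (r g) _) -/(subst_lin (r g) _) mulrC.
  rewrite (subst_linX (r g) l) mulr_suml.
  by apply: eq_bigr => j _; rewrite scalerAl.
rewrite gelt_sum -sumrB; apply: degle_sum => j; rewrite -scalerBr; apply: degleZ.
have mh : subst_lin (r g) 'X_[m] \is (mdeg m).-homog.
  by apply: subst_lin_homog; rewrite dhomogX.
rewrite mdegDU; move: IHm mh; rewrite gE.
move: (subst_lin (r g) 'X_[m]) (M g (gmono m)) => f a IHm fm.
have -> : L j a - gelt ('X_j * f) g =
    L j (a - gelt f g) + (L j (gelt f g) - gelt ('X_j * f) g).
  by rewrite (requivB (pbw_varR _ _ j)) addrA subrK.
apply: degleD; first exact: pbw_var_degle.
exact: degle_le (var_lead _ _ fm) _.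
Qed.

End LeadingTerms.

(** * Symplectic reflection algebras as quantizations *)

Section SRAQuantization.

Variables (k : fieldType) (D : sra_datum k).
Local Notation V := (sra_space D).
Local Notation Gamma := (sra_group D).
Hypotheses (G0 : (#|Gamma|%:R : k) != 0) (two0 : (2%:R : k) != 0).

Local Notation n := (\dim (fullv : {vspace V})).
Local Notation P := {mpoly k[n]}.
Local Notation A := {ffun Gamma -> P}.
Local Notation H := (sra D).
Local Notation r := (@sra_mx k D).
Local Notation kap := (@sra_kapmx k D).
Local Notation L := (pbw_var r kap).
Local Notation M := (pbw_grp r kap).
Local Notation gmono := (@gmono k n Gamma).
Local Notation b := (@sra_base k D).
Local Notation T := (@quant k D).
Local Notation TA := (@quantA k D).
Local Notation act := (@pbw_act k D).

(** The degree filtration of P * G, carried over by the PBW bijection. *)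
Definition sra_filt (d : nat) (y : H) : Prop := exists2 a : A, degle d a & y = quantA a.

Definition sra_poly_act (g : Gamma) : {lrmorphism P -> P} := subst_lin (r g).

Lemma ordered_degle m d a : degle d a -> degle (mdeg m + d) (act (ordered m) a).
Proof.
move=> ad; elim/least_var_ind: m => [|l m lm IHm].
  by rewrite ordered0 mdeg0 -(sra_grp1 D) (pbw_act_grp G0 two0) pbw_grp1.
rewrite (orderedD lm) (pbw_actM G0 two0) (pbw_act_vec G0 two0) vec_act_base mdegDU addSn.
exact: pbw_var_degle.
Qed.

Lemma ordered_lead m d f : f \is d.-homog ->
  degle (mdeg m + d) (act (ordered m) (gelt f 1%g) - gelt ('X_[m] * f) 1%g).
Proof.
move=> fd; elim/least_var_ind: m => [|l m lm IHm].
  rewrite ordered0 -(sra_grp1 D) (pbw_act_grp G0 two0) pbw_grp1.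
  by rewrite mpolyX0 mul1r subrr; apply: degle0.
rewrite (orderedD lm) (pbw_actM G0 two0) (pbw_act_vec G0 two0) vec_act_base mdegDU addSn.
have mh : 'X_[m] * f \is (mdeg m + d).-homog by apply: dhomogM => //; rewrite dhomogX.
rewrite mpolyXD mulrAC mulrC; move: IHm mh.
move: (act _ _) ('X_[m] * f) => a f' IHm fm.
have -> : L l a - gelt ('X_l * f') 1%g =
    L l (a - gelt f' 1%g) + (L l (gelt f' 1%g) - gelt ('X_l * f') 1%g).
  by rewrite (requivB (pbw_varR _ _ l)) addrA subrK.
apply: degleD; first exact: pbw_var_degle.
exact: degle_le (var_lead _ _ _ _ fm) _.
Qed.

(** Reduces products in [H] to the action on P * G, where degrees can be read off. *)
Lemma quantA_mul a a' : TA a * TA a' = TA (act (TA a) a').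
Proof. by rewrite (quantA_act G0 two0). Qed.

Lemma filt_mul i j x y :
  sra_filt i.+1 x -> sra_filt j.+1 y -> sra_filt (i + j).+1 (x * y).
Proof.
move=> [a ai ->] [a' aj ->]; rewrite quantA_mul; exists (act (TA a) a') => //.
move: ai; apply: (degle_ind (Q := fun a => degle (i + j).+1 (act (TA a) a'))).
- by rewrite quantA0 (pbw_act0 G0 two0); apply: degle0.
- move=> c u v IHu IHv; rewrite quantAP (pbw_actP G0 two0).
  exact: (degleD (degleZ _ IHu) IHv).
move=> m h; rewrite ltnS => md.
rewrite quantA_shift quantA_gmono (pbw_actM G0 two0) (pbw_act_grp G0 two0).
apply: degle_le (ordered_degle m (pbw_grp_degle _ _ h aj)) _.
by rewrite addnS ltnS leq_add2r.
Qed.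

Lemma quantA_gelt1 f : TA (gelt f 1%g) = T f.
Proof. by rewrite quantA_gelt sra_grp1 mulr1. Qed.

Lemma quant_mul i j f g : f \is i.-homog -> g \is j.-homog ->
  sra_filt (i + j) (T f * T g - T (f * g)).
Proof.
move=> fi gj; rewrite -!quantA_gelt1 quantA_mul -quantAB.
set a := _ - _; exists a => //; rewrite /a {a} quantA_gelt1.
move: f fi; apply: homog_mono_ind => [|c f f' IH IH'|m <-].
- by rewrite raddf0 mul0r gelt0 (pbw_act0 G0 two0) subr0; apply: degle0.
- rewrite linearP mulrDl -scalerAl gelt_linear (pbw_actP G0 two0) opprD addrACA -scalerBr.
  exact: (degleD (degleZ _ IH) IH').
by rewrite quantX; apply: ordered_lead.
Qed.

Lemma quant_grp g d f : f \is d.-homog ->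
  sra_filt d (sra_grp g * T f - T (sra_poly_act g f) * sra_grp g).
Proof.
move=> fd; exists (M g (gelt f 1%g) - gelt (sra_poly_act g f) g); first exact: grp_lead.
by rewrite quantAB quantA_grp quantA_gelt1 quantA_gelt.
Qed.

Lemma quantA_finfun (f : Gamma -> P) : TA [ffun g => f g] = \sum_g T (f g) * sra_grp g.
Proof. by apply: eq_bigr => g _; rewrite ffunE. Qed.

Theorem sra_quantization :
  quantization sra_poly_act (@sra_grp k D) (T : {additive P -> H}) sra_filt.
Proof.
split.
- exact: sra_grp1.
- exact: sra_grpM.
- by move=> y [a /degle_eq0-> ->]; rewrite quantA0.
- by move=> d; exists 0; rewrite ?quantA0 //; apply: degle0.
- by move=> d x y [a ad ->] [a' ad' ->]; exists (a - a'); rewrite ?quantAB //; apply: degleB.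
- by move=> d x [a ad ->]; exists a => //; apply: degle_le ad _.
- move=> x; have [d ad] := degle_ex (act x (gmono 0)).
  exists d, (act x (gmono 0)) => //; exact: (quantA_surj G0 two0).
- exact: filt_mul.
- by move=> g; exists (gelt 1 g); rewrite ?quantA_gelt -?mpolyX0 ?quantX ?ordered0 ?mul1r //;
    apply: degle_gelt; rewrite msizeX mdeg0.
- move=> d f fd; exists (gelt f 1%g); last by rewrite quantA_gelt1.
  exact/degle_gelt/msize_homog.
- exact: quant_mul.
- exact: quant_grp.
- move=> d y [a ad ->]; exists (fun g => pihomog mdeg d (a g)) => [g|].
    exact: pihomogP.
  exists (a - [ffun g => pihomog mdeg d (a g)]); last by rewrite quantAB quantA_finfun.
  by move=> g; rewrite !ffunE; apply: msize_sub_pihomog.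
move=> d f fd [a ad]; rewrite -quantA_finfun => /(quantA_inj G0 two0) fa g.
rewrite -(pihomog_dE (fd g)); apply: pihomog_msize.
by have := ad g; rewrite -fa ffunE.
Qed.

End SRAQuantization.

(** * Corner rings *)

Lemma inj_surj_bij (X : choiceType) (Y : Type) (f : X -> Y) :
  injective f -> (forall y, exists x, f x = y) -> bijective f.
Proof.
move=> fI /choice[g gK]; exists g => // x.
by apply: fI; rewrite gK.
Qed.

Section CornerMaps.

Variables (A : pzRingType) (e0 : idempotent_elt A).
Local Notation e := (idem_val e0).
Local Notation R := (eAe e0).

Lemma idem_mulr (a : A) : a * e * e = a * e.
Proof. by rewrite -mulrA idemP. Qed.

Lemma in_Ae_mul (a : A) : a * e \in in_Ae e0.
Proof. by apply/in_AeP; rewrite -mulrA idemP. Qed.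
Lemma in_eA_mul (a : A) : e * a \in in_eA e0.
Proof. by apply/in_eAP; rewrite mulrA idemP. Qed.
Lemma in_eAe_mul (a : A) : e * a * e \in in_eAe e0.
Proof. by apply/asboolP; exists a. Qed.

Definition mkAe (a : A) : Ae e0 := AeElt (in_Ae_mul a).
Definition mkeA (a : A) : eA e0 := EAElt (in_eA_mul a).
Definition mkeAe (a : A) : R := EAeElt (in_eAe_mul a).

Lemma Ae_mule (x : Ae e0) : Ae_val x * e = Ae_val x.
Proof. exact/in_AeP/Ae_valP. Qed.
Lemma eA_emul (x : eA e0) : e * eA_val x = eA_val x.
Proof. exact/in_eAP/eA_valP. Qed.

Lemma mkAeK (x : Ae e0) : mkAe (Ae_val x) = x.
Proof. by apply: val_inj; rewrite /= Ae_mule. Qed.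
Lemma mkeAK (x : eA e0) : mkeA (eA_val x) = x.
Proof. by apply: val_inj; rewrite /= eA_emul. Qed.

Definition corner_rmul (a : R) (x : Ae_l e0) : Ae_l e0 := Ae_r_scale a x.

Lemma corner_rmul_linear a : linear (corner_rmul a).
Proof. by move=> c x y; apply: val_inj; rewrite /= mulrDl mulrA. Qed.

HB.instance Definition _ a :=
  GRing.isLinear.Build A (Ae_l e0) (Ae_l e0) *:%R (corner_rmul a) (corner_rmul_linear a).

Definition corner_phi1 (a : R) : (endo (Ae_l e0))^c := (corner_rmul a : endo (Ae_l e0)).

Lemma corner_phi1_additive : zmod_morphism corner_phi1.
Proof. by move=> a b; apply: modhomP => x; apply: val_inj; rewrite /= mulrBr. Qed.

Lemma corner_phi1_monoid : monoid_morphism corner_phi1.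
Proof.
split; first by apply: modhomP => x; apply: val_inj; rewrite /= Ae_mule.
by move=> a b; apply: modhomP => x; apply: val_inj; rewrite /= mulrA.
Qed.

HB.instance Definition _ := GRing.isZmodMorphism.Build R (endo (Ae_l e0))^c
  corner_phi1 corner_phi1_additive.
HB.instance Definition _ := GRing.isMonoidMorphism.Build R (endo (Ae_l e0))^c
  corner_phi1 corner_phi1_monoid.

(** As [e] generates Ae, an endomorphism f is right multiplication by f(e), which lies in eAe
    because e f(e) = f(e e) = f(e). *)
Lemma corner_phi1_bij : bijective corner_phi1.
Proof.
pose u : Ae_l e0 := mkAe 1.
have uE : Ae_val u = e by rewrite /= mul1r.
apply: inj_surj_bij => [a b ab|f].
  have /(congr1 val) : corner_rmul a u = corner_rmul b u.
    exact: (congr1 (fun f : endo (Ae_l e0) => f u) ab).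
  rewrite /= mul1r.
  have [-> _] := (in_eAeP _ _).1 (eAe_valP a); have [-> _] := (in_eAeP _ _).1 (eAe_valP b).
  exact: val_inj.
have fe : e *: f u = f u.
  by rewrite -linearZ; congr (f _); apply: val_inj; rewrite /= mul1r idemP.
have fuP : Ae_val (f u) \in in_eAe e0.
  apply/in_eAeP; rewrite -{1}fe /= mulrA idemP -/(e *: f u) Ae_mule.
  by split=> //; apply: (congr1 val fe).
exists (EAeElt fuP); apply: modhomP => x; apply: val_inj => /=.
have {2}<- : (Ae_val x *: u : Ae_l e0) = x.
  by apply: val_inj; rewrite /= mul1r Ae_mule.
by rewrite linearZ.
Qed.

(* These replace the fullness of the idempotent [e]: [AeA] may be a proper
   ideal. *)
Hypotheses
  (faithl : forall h, (forall x, h * x * e = 0) -> h = 0)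
  (faithr : forall h, (forall x, e * x * h = 0) -> h = 0)
  (doublel : forall psi : A -> A, {morph psi : x y / x + y} ->
     (forall x z, psi (x * e * z * e) = psi (x * e) * e * z * e) ->
     exists h, forall x, psi (x * e) = h * (x * e))
  (doubler : forall psi : A -> A, {morph psi : x y / x + y} ->
     (forall x z, psi (e * z * e * x) = e * z * e * psi (e * x)) ->
     exists h, forall x, psi (e * x) = (e * x) * h).

Lemma mkAeD x y : mkAe (x + y) = mkAe x + mkAe y.
Proof. by apply: val_inj; rewrite /= mulrDl. Qed.
Lemma mkeAD x y : mkeA (x + y) = mkeA x + mkeA y.
Proof. by apply: val_inj; rewrite /= mulrDr. Qed.

Definition corner_lmul (h : A) (x : Ae_r e0) : Ae_r e0 := Ae_l_scale h x.

Lemma corner_lmul_linear h : linear (corner_lmul h).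
Proof. by move=> c x y; apply: val_inj; rewrite /= mulrDr mulrA. Qed.

HB.instance Definition _ h :=
  GRing.isLinear.Build R^c (Ae_r e0) (Ae_r e0) *:%R (corner_lmul h) (corner_lmul_linear h).

Definition corner_phi2 (h : A) : endo (Ae_r e0) := corner_lmul h.

Lemma corner_phi2_additive : zmod_morphism corner_phi2.
Proof. by move=> a b; apply: modhomP => x; apply: val_inj; rewrite /= mulrBl. Qed.

Lemma corner_phi2_monoid : monoid_morphism corner_phi2.
Proof.
split; first by apply: modhomP => x; apply: val_inj; rewrite /= mul1r.
by move=> a b; apply: modhomP => x; apply: val_inj; rewrite /= mulrA.
Qed.

HB.instance Definition _ := GRing.isZmodMorphism.Build A (endo (Ae_r e0))
  corner_phi2 corner_phi2_additive.
HB.instance Definition _ := GRing.isMonoidMorphism.Build A (endo (Ae_r e0))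
  corner_phi2 corner_phi2_monoid.

(** With [v] the inclusion of the target into [A], this serves both for endomorphisms of Ae and for
    functionals with values in eAe. To apply [doublel], [f] is extended to [A] along a |-> a e. *)
Lemma Ae_additive_mul (N : zmodType) (f : Ae_r e0 -> N) (v : N -> A) :
  {morph f : x y / x + y} -> {morph v : x y / x + y} ->
  (forall (z : R) x, v (f ((z : R^c) *: x)) = v (f x) * eAe_val z) ->
  exists h, forall x, v (f x) = h * Ae_val x.
Proof.
move=> fD vD fZ.
have [x y|x z|h Hh] := doublel (psi := fun x => v (f (mkAe x))).
- by rewrite mkAeD fD vD.
- have e1 : mkAe (x * e * z * e) = (mkeAe z : R^c) *: (mkAe (x * e) : Ae_r e0).
    by apply: val_inj; rewrite /= !mulrA !idem_mulr.
  have e2 : mkAe (x * e) = mkAe x by apply: val_inj; rewrite /= -mulrA idemP.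
  by rewrite e1 fZ /= e2 !mulrA.
exists h => x; have := Hh (Ae_val x).
by rewrite Ae_mule mkAeK.
Qed.

Lemma eA_additive_mul (N : zmodType) (f : eA_l e0 -> N) (v : N -> A) :
  {morph f : x y / x + y} -> {morph v : x y / x + y} ->
  (forall (z : R) x, v (f (z *: x)) = eAe_val z * v (f x)) ->
  exists h, forall x, v (f x) = eA_val x * h.
Proof.
move=> fD vD fZ.
have [x y|x z|h Hh] := doubler (psi := fun x => v (f (mkeA x))).
- by rewrite mkeAD fD vD.
- have e1 : mkeA (e * z * e * x) = mkeAe z *: (mkeA (e * x) : eA_l e0).
    by apply: val_inj; rewrite /= !mulrA !idem_mulr idemP.
  have e2 : mkeA (e * x) = mkeA x by apply: val_inj; rewrite /= mulrA idemP.
  by rewrite e1 fZ /= e2.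
exists h => x; have := Hh (eA_val x).
by rewrite eA_emul mkeAK.
Qed.

Lemma Ae_faith (h h' : A) : (forall x : Ae e0, h * Ae_val x = h' * Ae_val x) -> h = h'.
Proof.
move=> hh; apply/eqP; rewrite -subr_eq0; apply/eqP/faithl => x.
by have := hh (mkAe x); rewrite /= -mulrA mulrBl => ->; rewrite subrr.
Qed.

Lemma eA_faith (h h' : A) : (forall x : eA e0, eA_val x * h = eA_val x * h') -> h = h'.
Proof.
move=> hh; apply/eqP; rewrite -subr_eq0; apply/eqP/faithr => x.
by have := hh (mkeA x); rewrite /= mulrBr => ->; rewrite subrr.
Qed.

Lemma corner_phi2_bij : bijective corner_phi2.
Proof.
apply: inj_surj_bij => [a b ab|f].
  apply: Ae_faith => x.
  exact: (congr1 (fun f : endo (Ae_r e0) => Ae_val (f x)) ab).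
have [x y|//|z x|h hE] := @Ae_additive_mul _ f (@Ae_val _ _); first exact: raddfD.
  by rewrite linearZ.
by exists h; apply: modhomP => x; apply: val_inj; rewrite /= hE.
Qed.

Lemma corner_pair_subproof (y : eA e0) (x : Ae e0) : eA_val y * Ae_val x \in in_eAe e0.
Proof. by apply/in_eAeP; rewrite mulrA eA_emul -mulrA Ae_mule. Qed.

Definition corner_pair (y : eA e0) (x : Ae e0) : R := EAeElt (corner_pair_subproof y x).

Definition corner_eA_fun (y : eA_l e0) (x : Ae_r e0) : (R^c)^o := corner_pair y x.

Lemma corner_eA_fun_linear y : linear (corner_eA_fun y).
Proof. by move=> c x x'; apply: val_inj; rewrite /= mulrDr mulrA. Qed.

HB.instance Definition _ y :=
  GRing.isLinear.Build R^c (Ae_r e0) (R^c)^o *:%R (corner_eA_fun y) (corner_eA_fun_linear y).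

Definition corner_phi3 (y : eA_l e0) : rdual (Ae_r e0) := corner_eA_fun y.

Lemma corner_phi3_linear : linear corner_phi3.
Proof.
by move=> c y y'; apply: modhomP => x; apply: val_inj; rewrite /= mulrDl mulrA.
Qed.

HB.instance Definition _ :=
  GRing.isLinear.Build R (eA_l e0) (rdual (Ae_r e0)) *:%R corner_phi3 corner_phi3_linear.

Lemma corner_phi3_bij : bijective corner_phi3.
Proof.
apply: inj_surj_bij => [y y' yy|f].
  apply/val_inj/Ae_faith => x.
  exact: (congr1 (fun f : rdual (Ae_r e0) => eAe_val (f x)) yy).
have [x y|//|z x|h hE] := @Ae_additive_mul _ f (@eAe_val _ _); first exact: raddfD.
  by rewrite linearZ.
(* The products [h * x] lie in eAe, so [e * h] gives the same functional, and it belongs to eA. *)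
exists (mkeA h); apply: modhomP => x; apply: val_inj; rewrite /= -mulrA -hE.
by have [-> _] := (in_eAeP _ _).1 (eAe_valP (f x)).
Qed.

Definition corner_Ae_fun (x : Ae_r e0) (y : eA_l e0) : R^o := corner_pair y x.

Lemma corner_Ae_fun_linear x : linear (corner_Ae_fun x).
Proof. by move=> c y y'; apply: val_inj; rewrite /= mulrDl mulrA. Qed.

HB.instance Definition _ x :=
  GRing.isLinear.Build R (eA_l e0) R^o *:%R (corner_Ae_fun x) (corner_Ae_fun_linear x).

Definition corner_phi4 (x : Ae_r e0) : ldual (eA_l e0) := corner_Ae_fun x.

Lemma corner_phi4_linear : linear corner_phi4.
Proof.
by move=> c x x'; apply: modhomP => y; apply: val_inj; rewrite /= mulrDr mulrA.
Qed.

HB.instance Definition _ :=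
  GRing.isLinear.Build R^c (Ae_r e0) (ldual (eA_l e0)) *:%R corner_phi4 corner_phi4_linear.

Lemma corner_phi4_bij : bijective corner_phi4.
Proof.
apply: inj_surj_bij => [x x' xx|f].
  apply/val_inj/eA_faith => y.
  exact: (congr1 (fun f : ldual (eA_l e0) => eAe_val (f y)) xx).
have [x y|//|z x|h hE] := @eA_additive_mul _ f (@eAe_val _ _); first exact: raddfD.
  by rewrite linearZ.
exists (mkAe h); apply: modhomP => y; apply: val_inj; rewrite /= mulrA -hE.
by have [_ ->] := (in_eAeP _ _).1 (eAe_valP (f y)).
Qed.

(** Composition with [corner_phi3] identifies the bidual of Ae with the dual of eA and turns
    evaluation at [x] into [corner_phi4 x]. *)
Lemma corner_rreflexive : rreflexive (Ae_r e0).
Proof.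
have [phi3' _ phi3K] := corner_phi3_bij.
apply: inj_surj_bij => [x x' xx|f].
  apply: (bij_inj corner_phi4_bij); apply: modhomP => y.
  exact: (congr1 (fun g : ldual (rdual (Ae_r e0)) => g (corner_phi3 y)) xx).
have [phi4' _ phi4K] := corner_phi4_bij.
exists (phi4' (f \o corner_phi3)); apply: modhomP => g; rewrite -[g]phi3K.
exact: (congr1 (fun h : ldual (eA_l e0) => h (phi3' g)) (phi4K (f \o corner_phi3))).
Qed.

Lemma corner_lreflexive : lreflexive (eA_l e0).
Proof.
have [phi4' _ phi4K] := corner_phi4_bij.
apply: inj_surj_bij => [y y' yy|f].
  apply: (bij_inj corner_phi3_bij); apply: modhomP => x.
  exact: (congr1 (fun g : rdual (ldual (eA_l e0)) => g (corner_phi4 x)) yy).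
have [phi3' _ phi3K] := corner_phi3_bij.
exists (phi3' (f \o corner_phi4)); apply: modhomP => g; rewrite -[g]phi4K.
exact: (congr1 (fun h : rdual (Ae_r e0) => h (phi4' g)) (phi3K (f \o corner_phi4))).
Qed.

End CornerMaps.

(** * Independent vectors in the image of g - 1 *)

Section RootDifferences.

Variables (k : fieldType) (D : sra_datum k).
Local Notation V := (sra_space D).
Local Notation Gamma := (sra_group D).
Local Notation omega := (sra_form D).
Local Notation rho := (@sra_rho k D).
Hypotheses (G0 : (#|Gamma|%:R : k) != 0) (two0 : (2%:R : k) != 0).
Local Notation n := (\dim (fullv : {vspace V})).
Local Notation P := {mpoly k[n]}.

Lemma sra_form_nondeg (u : V) : (forall y, omega u y = 0) -> u = 0.
Proof.
have [/eqP nd _ _] := sra_formP D => u0; apply/eqP; rewrite -memv0 -nd.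
by apply/mem_orthovP => y _; apply: u0.
Qed.

(* A nontrivial transvection [g] has [u] in both the image and the kernel of
   [1 - g], which excludes finite order prime to [p]. *)
Lemma sra_not_transvection (g : Gamma) (u : V) (lam : V -> k) :
  (forall y, rho g y = y + lam y *: u) -> g = 1%g.
Proof.
move=> gE.
have lam_u : lam u *: u = 0.
  have [->|u0] := eqVneq u 0; first by rewrite scaler0.
  have [y uy] : exists y, omega u y != 0.
    apply: contrapT => H; case/eqP: u0; apply: sra_form_nondeg => y.
    by have [//|uy] := eqVneq (omega u y) 0; case: H; exists y.
  (* [g] scales [u] by 1 + [lam u]; as [omega u u = 0], invariance of the form leaves
     [lam u * omega u y = 0]. *)
  have : omega (lam u *: u + u) (lam y *: u + y) = omega u y.
    by rewrite ![_ *: u + _]addrC -!gE sra_rho_form.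
  rewrite sra_form_linearl (sra_form_skew u (_ + _)) sra_form_linearl (sra_form_alt two0).
  rewrite mulr0 add0r -(sra_form_skew u y).
  move/eqP; rewrite -subr_eq0 addrK mulf_eq0 (negPf uy) orbF => /eqP->.
  exact: scale0r.
apply: (@sra_rho_inj k D); rewrite sra_rho1; apply/lfunP => y; rewrite id_lfunE.
have uu : rho g u = u by rewrite gE lam_u addr0.
(* The projection fixes y - g y, which is a multiple of [u], but kills [u]. *)
have := sra_proj_id G0 g y; rewrite {1}gE opprD addrA subrr add0r -scaleNr linearZ /=.
rewrite (sra_proj_ker G0 uu) scaler0 => /esym/eqP; rewrite subr_eq0 => /eqP E.
by rewrite -E.
Qed.

(** Linear forms serve as witnesses. If no two differences [d x], [d y] were independent, all of
    them would be multiples of a single one, and [g] would be a transvection. *)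
Lemma sra_poly_act_reg (g : Gamma) : g != 1%g -> exists v w,
  coprime_pair (sra_poly_act g v - v) (sra_poly_act g w - w).
Proof.
move=> g1; pose d (x : V) := rho g x - x.
have linE x : sra_poly_act g (linear_form (sra_coord x)) - linear_form (sra_coord x) =
    linear_form (sra_coord (d x)).
  rewrite /sra_poly_act subst_lin_form -sumrB; apply: eq_bigr => i _.
  rewrite -sra_coord_rho -scalerBl; congr (_ *: _).
  by rewrite /sra_coord linearB.
apply: contrapT => no; case/eqP: g1.
have [[x dx]|d0] := pselect (exists x, d x <> 0); last first.
  apply: (@sra_not_transvection g 0 (fun=> 0)) => y; rewrite scaler0 addr0.
  by apply/eqP; rewrite -subr_eq0; apply: contrapT => dy; apply: d0; exists y => /eqP.
have [i di] : exists i, sra_coord (d x) i != 0.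
  apply: contrapT => H; apply: dx; rewrite (sra_coordE (d x)) big1 // => i _.
  have [->|di] := eqVneq (sra_coord (d x) i) 0; first by rewrite scale0r.
  by case: H; exists i.
apply: (@sra_not_transvection g (d x)
  (fun y => sra_coord (d y) i / sra_coord (d x) i)) => y.
rewrite -[rho g y](subrK y) addrC; congr (_ + _); rewrite -/(d y).
set c := _ / _.
transitivity (\sum_j c *: (sra_coord (d x) j *: sra_base j)); last first.
  by rewrite -scaler_sumr -sra_coordE.
rewrite {1}(sra_coordE (d y)); apply: eq_bigr => j _; rewrite scalerA; congr (_ *: _).
apply: contrapT => ne; apply: no.
exists (linear_form (sra_coord x)), (linear_form (sra_coord y)); rewrite !linE.
apply: (@coprime_linear_form _ _ _ _ i j) => //.
apply/eqP => E; apply: ne; apply: (mulfI di); rewrite E.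
by rewrite mulrA [_ * (_ / _)]mulrC divfK // mulrC.
Qed.

End RootDifferences.

(** * Faithfulness and double centralizers for the symmetrizing idempotent *)

Section CornerOfSRA.

Variables (k : fieldType) (D : sra_datum k).
Local Notation V := (sra_space D).
Local Notation Gamma := (sra_group D).
Local Notation H := (sra D).
Hypotheses (G0 : (#|Gamma|%:R : k) != 0) (two0 : (2%:R : k) != 0).

Local Notation e := (sra_sym D).
Local Notation s := ((#|Gamma|%:R : k)^-1 *: (1 : H)).

Let act1 : sra_poly_act (D := D) 1%g =1 id.
Proof. by move=> f; rewrite /sra_poly_act sra_mx1 subst_lin1. Qed.

Let actM (g h : Gamma) : sra_poly_act (g * h)%g =1 sra_poly_act g \o sra_poly_act h.
Proof. by move=> f; rewrite /sra_poly_act sra_mxM subst_linM. Qed.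

Let acth (g : Gamma) d p : p \is d.-homog -> sra_poly_act g p \is d.-homog.
Proof. exact: subst_lin_homog. Qed.

Let sG : s *+ #|Gamma| = 1.
Proof. by rewrite -scaler_nat scalerA divff // scale1r. Qed.

Let sC (x : H) : s * x = x * s.
Proof. by rewrite -iq_scalerAl -iq_scalerAr mul1r mulr1. Qed.

Let Fs : sra_filt 1 s.
Proof.
exists (#|Gamma|%:R^-1 *: gelt 1 1%g).
  by apply/degleZ/degle_gelt; rewrite msize1.
by rewrite quantAZ quantA_gelt1 -mpolyX0 quantX ordered0.
Qed.

Let eE : e = s * \sum_g sra_grp g.
Proof. by rewrite -iq_scalerAl mul1r. Qed.

Lemma sra_sym_faithfull (h : H) : (forall x, h * x * e = 0) -> h = 0.
Proof.
move=> h0; have FF := sym_faithful act1 actM acth (sra_poly_act_reg G0 two0)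
  (sra_quantization G0 two0) sG sC Fs.
apply: (FF h) => x.
by rewrite -eE.
Qed.

Lemma sra_sym_doublel (psi : H -> H) : {morph psi : x y / x + y} ->
  (forall x z, psi (x * e * z * e) = psi (x * e) * e * z * e) ->
  exists h, forall x, psi (x * e) = h * (x * e).
Proof.
rewrite eE => psiD psiE; apply: (sym_double_centralizer act1 actM acth
  (sra_poly_act_reg G0 two0) (sra_quantization G0 two0) sG sC Fs).
by split.
Qed.

Lemma sra_sym_faithfulr (h : H) : (forall x, e * x * h = 0) -> h = 0.
Proof.
move=> h0; have FF := sym_faithful_op act1 actM acth (sra_poly_act_reg G0 two0)
  (sra_quantization G0 two0) sG sC Fs.
by apply: (FF h) => x; rewrite -eE.
Qed.

Lemma sra_sym_doubler (psi : H -> H) : {morph psi : x y / x + y} ->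
  (forall x z, psi (e * z * e * x) = e * z * e * psi (e * x)) ->
  exists h, forall x, psi (e * x) = (e * x) * h.
Proof.
rewrite eE; exact: (sym_double_centralizer_op act1 actM acth
  (sra_poly_act_reg G0 two0) (sra_quantization G0 two0) sG sC Fs).
Qed.

End CornerOfSRA.

Theorem theorem3p2 (k : closedFieldType) (p : nat) (p_odd : odd p)
    (kp : p \in [pchar k]) (D : sra_datum k)
    (pG : ~~ (p %| #|sra_group D|)%N) :
  let H := sra D in
  let e : idempotent_elt H := sra_e kp pG in
  [/\ exists phi : {rmorphism eAe e -> (endo (Ae_l e))^c},
        [/\ bijective phi,
            forall (a : eAe e) (x : Ae e),
              Ae_val (phi a x) = Ae_val x * eAe_val a &
            forall (c : k) (a b : eAe e), eAe_val b = c *: eAe_val a ->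
              forall x : Ae e, Ae_val (phi b x) = c *: Ae_val (phi a x)],
      exists phi : {rmorphism H -> endo (Ae_r e)},
        [/\ bijective phi,
            forall (h : H) (x : Ae e), Ae_val (phi h x) = h * Ae_val x &
            forall (c : k) (h : H) (x : Ae e),
              Ae_val (phi (c *: h) x) = c *: Ae_val (phi h x)],
      exists phi : {linear eA_l e -> rdual (Ae_r e)},
        bijective phi /\
        forall (y : eA e) (x : Ae e), eAe_val (phi y x) = eA_val y * Ae_val x,
      exists phi : {linear Ae_r e -> ldual (eA_l e)},
        bijective phi /\
        forall (x : Ae e) (y : eA e), eAe_val (phi x y) = eA_val y * Ae_val x &
      rreflexive (Ae_r e) /\ lreflexive (eA_l e)].
Proof.
move=> H e.
have G0 : (#|sra_group D|%:R : k) != 0 := sra_card_neq0 kp pG.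
have two0 : (2%:R : k) != 0.
  rewrite -(dvdn_pcharf kp); apply: contraL p_odd => /dvdn_leq p2.
  suff -> : p = 2%N by [].
  by apply/eqP; rewrite eqn_leq p2 // prime_gt1 // (pcharf_prime kp).
have fl := @sra_sym_faithfull k D G0 two0.
have fr := @sra_sym_faithfulr k D G0 two0.
have dl := @sra_sym_doublel k D G0 two0.
have dr := @sra_sym_doubler k D G0 two0.
split.
- exists (@corner_phi1 _ e); split=> [||c a b ab x] //; first exact: corner_phi1_bij.
  by rewrite /= ab -iq_scalerAr.
- exists (@corner_phi2 _ e); split=> [||c h x] //; first exact: corner_phi2_bij.
  by rewrite /= -iq_scalerAl.
- by exists (@corner_phi3 _ e); split=> //; apply: corner_phi3_bij.
- by exists (@corner_phi4 _ e); split=> //; apply: corner_phi4_bij.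
split; [exact: corner_rreflexive | exact: corner_lreflexive].
Qed.
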